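(* Let $(\Omega,\Sigma,\mu)$ be a purely non-atomic measure space, and let $1<p<\infty$. The following statements are equivalent. (1) $L^{p,\infty}(\Omega,\Sigma,\mu)$ is isomorphic to $L^{p,\infty}(\Omega',\Sigma',\mu')$ for some purely atomic measure space $(\Omega',\Sigma',\mu')$. (2) $L^{p,\infty}(\Omega,\Sigma,\mu)$ is isomorphic to a subspace of $L^{p,\infty}(\Omega',\Sigma',\mu')$ for some purely atomic measure space $(\Omega',\Sigma',\mu')$. (3) There is a measurable partition $\Omega=\Omega_1\cup\Omega_2$ such that $(\Omega_1,\Sigma\cap\Omega_1,\mu|_{\Sigma\cap\Omega_1})$ is countably generated and $\sigma$-finite, and $\mu(\sigma)=0$ or $\infty$ for every measurable $\sigma\subseteq\Omega_2$. (4) $L^{p,\infty}(\Omega,\Sigma,\mu)$ is isomorphic to $\ell^{p,\infty}$.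
   Context: All measure spaces are assumed non-trivial, i.e. they contain a measurable set of finite non-zero measure. For a measure space $(\Omega,\Sigma,\mu)$ and $1<p<\infty$, the weak $L^p$ space $L^{p,\infty}(\Omega,\Sigma,\mu)$ is the space of (equivalence classes of) measurable $f$ with $\|f\|=\sup_{c>0}c\,(\mu\{|f|>c\})^{1/p}<\infty$; this quasi-norm is equivalent to a norm making it a Banach space, and ''isomorphic'' means linearly homeomorphic. $\ell^{p,\infty}$ is the weak $L^p$ space of $\mathbb{N}$ with counting measure. An atom is a measurable $\sigma$ with $\mu(\sigma)>0$ such that every measurable $\sigma'\subseteq\sigma$ has $\mu(\sigma')=0$ or $\mu(\sigma\setminus\sigma')=0$; purely non-atomic means there are no atoms. A collection $S$ of measurable sets generates $(\Omega,\Sigma,\mu)$ if $\Sigma$ is the smallest $\sigma$-algebra containing $S$ and the $\mu$-null sets; the space is purely atomic if it is generated by its atoms, and countably generated if it is generated by some sequence of measurable sets. *)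

(* Defs.v *)
From HB Require Import structures.
From mathcomp Require Import all_boot all_order all_algebra.
From mathcomp Require Import all_classical all_reals all_analysis.
Set Implicit Arguments. Unset Strict Implicit. Unset Printing Implicit Defensive.
Import Order.TTheory GRing.Theory Num.Theory.
Local Open Scope classical_set_scope.
Local Open Scope ring_scope.

Section weak_Lp.
Context {R : realType}.

Definition nontrivial_ms d (T : measurableType d) (mu : set T -> \bar R) :=
  exists A : set T, [/\ measurable A, (0 < mu A)%E & (mu A < +oo)%E].

Definition null_sets_in d (T : measurableType d) (mu : set T -> \bar R)
  (D : set T) : set (set T) :=
  [set N | [/\ measurable N, N `<=` D & mu N = 0%E]].

Definition trace_sigma d (T : measurableType d) (D : set T) : set (set T) :=
  [set B | measurable B /\ B `<=` D].

Definition is_atom d (T : measurableType d) (mu : set T -> \bar R) (s : set T) :=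
  [/\ measurable s, (0 < mu s)%E &
      forall s', measurable s' -> s' `<=` s -> mu s' = 0%E \/ mu (s `\` s') = 0%E].

Definition purely_non_atomic d (T : measurableType d) (mu : set T -> \bar R) :=
  forall s, ~ is_atom mu s.

Definition generates_on d (T : measurableType d) (mu : set T -> \bar R)
  (D : set T) (S : set (set T)) :=
  S `<=` trace_sigma D /\
  trace_sigma D = <<s D, S `|` null_sets_in mu D >>.

Definition purely_atomic d (T : measurableType d) (mu : set T -> \bar R) :=
  generates_on mu setT (is_atom mu).

Definition countably_generated_on d (T : measurableType d)
  (mu : set T -> \bar R) (D : set T) :=
  exists G : (set T)^nat, generates_on mu D (range G).

Definition weak_norm d (T : measurableType d) (mu : set T -> \bar R) (p : R)
  (f : T -> R) : \bar R :=
  ereal_sup [set (c%:E * poweR (mu [set x | (c < `|f x|)%R]) p^-1)%E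
            | c in [set c : R | (0 < c)%R]].

Definition weakLp d (T : measurableType d) (mu : set T -> \bar R) (p : R)
  (f : T -> R) := measurable_fun setT f /\ (weak_norm mu p f < +oo)%E.

Definition ae_eq_fun d (T : measurableType d) (mu : set T -> \bar R)
  (f g : T -> R) :=
  exists N, [/\ measurable N, mu N = 0%E & [set x | f x <> g x] `<=` N].

(* An isomorphism (linear homeomorphism) of L^{p,oo}(mu) onto a subspace of
   L^{p,oo}(nu), represented on representatives: a map compatible with a.e.
   equality, linear modulo a.e. equality, and bounded above and below. *)
Definition weakLp_embedding d (T : measurableType d) (mu : set T -> \bar R)
  d' (T' : measurableType d') (nu : set T' -> \bar R) (p : R)
  (J : (T -> R) -> (T' -> R)) :=
  [/\ forall f, weakLp mu p f -> weakLp nu p (J f),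
      forall f g, weakLp mu p f -> weakLp mu p g -> ae_eq_fun mu f g ->
        ae_eq_fun nu (J f) (J g),
      forall (a : R) f g, weakLp mu p f -> weakLp mu p g ->
        ae_eq_fun nu (J (a \*: f \+ g)) (a \*: J f \+ J g) &
      exists C : R, 0 < C /\ forall f, weakLp mu p f ->
        (weak_norm nu p (J f) <= C%:E * weak_norm mu p f)%E /\
        (weak_norm mu p f <= C%:E * weak_norm nu p (J f))%E].

Definition weakLp_iso_subspace d (T : measurableType d) (mu : set T -> \bar R)
  d' (T' : measurableType d') (nu : set T' -> \bar R) (p : R) :=
  exists J, weakLp_embedding mu nu p J.

Definition weakLp_isomorphic d (T : measurableType d) (mu : set T -> \bar R)
  d' (T' : measurableType d') (nu : set T' -> \bar R) (p : R) :=
  exists J, weakLp_embedding mu nu p J /\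
    forall h, weakLp nu p h -> exists f, weakLp mu p f /\ ae_eq_fun nu (J f) h.

End weak_Lp.

(* Main.v *)
(* (3) => (4) is Pelczynski's decomposition method. Code the points of the
   separable part of [mu] by an increasing sequence of finite partitions into
   cells. The maps that average over the cells of the [n]-th partition and
   transplant the result to disjoint sets of proportional measure in a second
   space embed a sup-sum of countably many copies of L^{p,oo} into that space,
   provided that the proportionality factors are so far apart that different
   copies hardly interact; a limit along an ultrafilter inverts the embedding.
   Both an atomless space and the counting measure have room for such sets, so
   each of the two spaces absorbs the other.

   (2) => (3): let [J] embed L^{p,oo}(mu) into an atomic space. An atom cannot
   carry many images of an orthogonal system, because the best choice of signs
   makes the norm grow linearly; hence images of orthogonal functions can be
   chosen essentially disjoint, as far as the functions range over a filter that
   contains all orthogonality constraints. Applied to Rademacher functions this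
   shows that the functions on a set [E] with tails bounded by a power better
   than [p] have images at arbitrarily large or small levels.
   If [mu] has no maximal sigma-finite part, such functions of well separated
   levels exist outside every sigma-finite set; sums of blocks of them, scaled
   to their levels, are bounded, but their almost disjoint images are not.
   If a set of finite measure is not countably generated, conditional
   expectations provide functions on it orthogonal to any given countable
   family. For [2 < p], the disjointness of their images contradicts the
   orthogonality in L^2; for [p <= 2] one repeats the block construction on a
   disjoint sequence of subsets. *)
Require Import Defs.
From HB Require Import structures.
From mathcomp Require Import all_boot all_order all_algebra.
From mathcomp Require Import all_classical all_reals all_analysis.
From mathcomp Require Import measurable_realfun.
From mathcomp Require Import ring lra zify.
Set Implicit Arguments. Unset Strict Implicit. Unset Printing Implicit Defensive.
Import Order.TTheory GRing.Theory Num.Theory.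
Import numFieldNormedType.Exports.
Local Open Scope classical_set_scope.
Local Open Scope ring_scope.

(** Everything is phrased by bounds on distribution functions ([wb]): only a quasi-norm is at hand,
    so each addition costs a factor 2^p, and such bounds pass to representatives and to level sets
    directly. In (2) => (3) two growth rates are compared. A signed sum of n orthogonal functions
    with values in [-1, 1] has a bound of order n^max(1, p - 1), while n functions of one sign and
    size on a single atom force order n^p. Orthogonality to cubes of earlier sums is demanded
    besides ordinary orthogonality because variances only give tails of order c^-2, which at p = 2
    is no better than weak L^p itself; fourth moments give c^-4, enough for the exponent 2p when p
    <= 2. In both block constructions the number of functions per block makes every block weigh
    about the same in the image. In the domain the exponent 2p makes the contributions decay
    geometrically away from one critical block, so the bound there does not depend on the number of
    blocks, while the image grows linearly with it. *)

Lemma powRD_gt0 {R : realType} (x r s : R) : 0 < x ->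
  x `^ (r + s) = x `^ r * x `^ s.
Proof. by move=> x0; rewrite powRD// (gt_eqF x0) implybT. Qed.

(** * Bounds in weak L^p *)

Section weak_bound.
Context {R : realType} {d : measure_display} {T : measurableType d}.
Variables (mu : {measure set T -> \bar R}) (p : R).
Hypothesis p1 : 1 < p.
Implicit Types (f g : T -> R) (K L : R).

(* [K] bounds the [p]-th power of the weak quasi-norm. *)
Definition wb f K := forall c : R, 0 < c ->
  (mu [set x | (c < `|f x|)%R] <= (K * c `^ (- p))%:E)%E.

Let p0 : 0 < p. Proof. by apply: lt_trans p1. Qed.

Lemma measurable_gt_norm f c : measurable_fun setT f ->
  measurable [set x | c < `|f x|].
Proof.
move=> mf; rewrite -[X in measurable X]setTI.
have mn : measurable_fun setT (fun x => `|f x|) by exact: measurableT_comp.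
rewrite (_ : [set x | _] = (fun x => `|f x|) @^-1` `]c, +oo[); last first.
  by apply/seteqP; split => x /=; rewrite in_itv/= andbT.
exact: mn.
Qed.

Lemma weak_norm_wb f (M : R) : 0 <= M ->
  (weak_norm mu p f <= M%:E)%E -> wb f (M `^ p).
Proof.
move=> M0 fM c c0.
have : (c%:E * poweR (mu [set x | (c < `|f x|)%R]) p^-1 <= M%:E)%E.
  by apply: le_trans fM; apply: ereal_sup_ubound; exists c.
set m := mu _.
have m0 : (0 <= m)%E by exact: measure_ge0.
case: m m0 => [m| |] //=.
- rewrite lee_fin => m0.
  rewrite -EFinM !lee_fin => h.
  have h2 : m `^ p^-1 <= M / c by rewrite ler_pdivlMr// mulrC.
  have := ge0_ler_powR (ltW p0) (powR_ge0 _ _) (divr_ge0 M0 (ltW c0)) h2.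
  rewrite -powRrM mulVf ?gt_eqF// powRr1// powRM ?invr_ge0 ?(ltW c0)//.
  by rewrite -powR_inv1 ?(ltW c0)// -powRrM mulN1r.
- by rewrite invr_eq0 gt_eqF// gt0_muley ?lte_fin// leye_eq.
Qed.

Lemma wb_weak_norm f K : 0 <= K -> wb f K ->
  (weak_norm mu p f <= (K `^ p^-1)%:E)%E.
Proof.
move=> K0 fK; apply: ge_ereal_sup => _ [c /= c0 <-].
have := fK c c0; set m := mu _.
have m0 : (0 <= m)%E by exact: measure_ge0.
case: m m0 => [m| |] //=.
rewrite lee_fin => m0; rewrite -EFinM !lee_fin => h.
have := ge0_ler_powR (_ : 0 <= p^-1) m0 (le_trans m0 h) h.
rewrite invr_ge0 (ltW p0) => /(_ isT) h2.
rewrite mulrC -ler_pdivlMr//.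
apply: (le_trans h2).
rewrite powRM ?powR_ge0// -powRrM mulNr mulfV ?gt_eqF// powR_inv1 ?(ltW c0)//.
Qed.

Lemma weakLp_wb f : weakLp mu p f <->
  measurable_fun setT f /\ exists2 K, 0 <= K & wb f K.
Proof.
split=> -[mf].
- have n0 : (0 <= weak_norm mu p f)%E.
    apply: le_trans (_ : _ <= 1%:E * poweR (mu [set x | (1 < `|f x|)%R]) p^-1)%E _.
      by rewrite mul1e poweR_ge0.
    by apply: ereal_sup_ubound; exists 1 => //=.
  move=> ny; split => //.
  have e : weak_norm mu p f = (fine (weak_norm mu p f))%:E.
    by rewrite fineK// ge0_fin_numE.
  exists (fine (weak_norm mu p f) `^ p); first exact: powR_ge0.
  by apply: weak_norm_wb; rewrite ?fine_ge0// -e.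
- move=> [K K0 /wb_weak_norm fK]; split => //.
  by apply: le_lt_trans (fK K0) _; rewrite ltry.
Qed.

Lemma wbW f K L : K <= L -> wb f K -> wb f L.
Proof.
move=> KL fK c c0; apply: le_trans (fK c c0) _.
by rewrite lee_fin ler_wpM2r// powR_ge0.
Qed.

Lemma wb0 K : 0 <= K -> wb (fun=> 0) K.
Proof.
move=> K0 c c0; rewrite (_ : [set x | _] = set0) ?measure0.
  by rewrite lee_fin mulr_ge0// powR_ge0.
by apply/seteqP; split => x //=; rewrite normr0 ltNge (ltW c0).
Qed.

Lemma wb_ge0 f K : wb f K -> 0 <= K.
Proof.
move=> /(_ 1 ltr01); rewrite powR1 mulr1 -lee_fin.
by apply: le_trans; exact: measure_ge0.
Qed.

Lemma wbZ f a K : measurable_fun setT f -> wb f K ->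
  wb (fun x => a * f x) (`|a| `^ p * K).
Proof.
move=> mf fK; have [->|a0] := eqVneq a 0.
  under [X in wb X]funext do rewrite mul0r.
  by apply: wb0; rewrite mulr_ge0// ?powR_ge0//; exact: wb_ge0 fK.
move=> c c0; have na : 0 < `|a| by rewrite normr_gt0.
have := fK (c / `|a|) (divr_gt0 c0 na).
rewrite (_ : [set x | _] = [set x | c < `|a * f x|]); last first.
  by apply/seteqP; split => x /=; rewrite ltr_pdivrMr// normrM mulrC.
move/le_trans; apply; rewrite lee_fin.
rewrite powRM ?invr_ge0 ?(ltW c0)//.
rewrite -[`|a|^-1]powR_inv1// -powRrM mulN1r opprK.
by rewrite (mulrC (c `^ _)) mulrA (mulrC K).
Qed.

(** Where |f + g| exceeds c, one summand exceeds c/2; halving the level costs the factor 2^p. *)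
Lemma wbD f g K L : measurable_fun setT f -> measurable_fun setT g ->
  wb f K -> wb g L -> wb (fun x => f x + g x) (2 `^ p * (K + L)).
Proof.
move=> mf mg fK gL c c0.
have c20 : 0 < c / 2 by rewrite divr_gt0.
apply: (@le_trans _ _ (mu ([set x | c / 2 < `|f x|] `|` [set x | c / 2 < `|g x|]))).
  apply: le_measure; rewrite ?inE.
  - by apply: measurable_gt_norm; exact: measurable_funD.
  - by apply: measurableU; exact: measurable_gt_norm.
  - move=> x /= h; apply/orP; apply: contraTT h.
    rewrite negb_or -!leNgt => /andP[h1 h2].
    by rewrite (le_trans (ler_normD _ _))// (splitr c) lerD.
apply: le_trans (measureU2 _ _ _) _; [exact: measurable_gt_norm..|].
apply: le_trans (leeD (fK _ c20) (gL _ c20)) _.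
rewrite -EFinD lee_fin -mulrDl powRM ?invr_ge0 ?(ltW c0)//.
rewrite -[2^-1]powR_inv1// -powRrM mulN1r opprK.
by rewrite (mulrC (c `^ _)) mulrA (mulrC (K + L)).
Qed.

End weak_bound.

Section weak_integral.
Context {R : realType} {d : measure_display} {T : measurableType d}.
Variables (mu : {measure set T -> \bar R}) (p : R).
Hypothesis p1 : 1 < p.
Implicit Types (f g : T -> R) (K L : R) (B : set T).

Let p0 : 0 < p. Proof. by apply: lt_trans p1. Qed.

Lemma exists_pow2_ge (x : R) : exists n : nat, x <= 2 ^+ n.
Proof.
exists (Num.bound x); apply: ltW; apply: le_lt_trans (_ : _ <= `|x|) _.
  exact: ler_norm.
apply: lt_le_trans (archi_boundP (normr_ge0 x)) _.
rewrite /Num.bound normr_id -natrX ler_nat ltnW// ltn_expl//.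
Qed.

(** Twice the sum of the geometric series with ratio 2^(1-p), which converges because p > 1; it
    comes from the dyadic layers in [weak_integral_le]. *)
Definition cI : R := 2 / (1 - 2 `^ (1 - p)).

Let r := 2 `^ (1 - p) : R.

Let r0 : 0 < r. Proof. exact: powR_gt0. Qed.

Let r1 : r < 1.
Proof.
rewrite /r -opprB powRN invf_lt1 ?powR_gt0//.
have := @gt0_ltr_powR R (p - 1) _ 1 2; rewrite powR1; apply.
- by rewrite subr_gt0.
- by rewrite nnegrE.
- by rewrite nnegrE.
- by rewrite ltr1n.
Qed.

Lemma cI_gt0 : 0 < cI.
Proof. by rewrite divr_gt0// subr_gt0. Qed.

(** Dyadic layers above the height t: a point with 2^n t < |f| <= 2^(n+1) t is paid for by the n-th
    term of the series, and the n-th term integrates to at most 2 K t^(1-p) times the n-th power of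
    2^(1-p). *)
Lemma weak_integral_le f K B t : measurable_fun setT f -> wb mu p f K ->
  measurable B -> 0 < t ->
  (\int[mu]_(x in B) `|f x|%:E <= t%:E * mu B + (cI * K * t `^ (1 - p))%:E)%E.
Proof.
move=> mf fK mB t0.
have K0 := wb_ge0 fK.
pose A k := [set x | 2 ^+ k * t < `|f x|].
have mA k : measurable (A k) by exact: measurable_gt_norm.
pose g k x : \bar R := ((2 ^+ k.+1 * t)%:E * (\1_(A k) x)%:E)%E.
have g0 k x : (0 <= g k x)%E.
  by rewrite /g -EFinM lee_fin !mulr_ge0 ?exprn_ge0 ?(ltW t0)//.
have mg k : measurable_fun B (g k).
  apply: measurable_funeM; apply/measurable_EFinP; exact: measurable_indic.
have ptw x : (`|f x|%:E <= t%:E + \sum_(0 <= k <oo) g k x)%E.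
  have [ft|ft] := leP (`|f x|) t.
    by rewrite -[leLHS]adde0 leeD ?lee_fin// nneseries_ge0.
  have /ex_minnP[[|n]] : exists n : nat, `|f x| <= 2 ^+ n * t.
  - have [n hn] := exists_pow2_ge (`|f x| / t).
    by exists n; rewrite -ler_pdivrMr.
  - by rewrite expr0 mul1r leNgt ft.
  - move=> fn min.
    have Axn : A n x.
      by rewrite /A/= ltNge; apply/negP => /min; rewrite ltnn.
    apply: (@le_trans _ _ (g n x)).
      by rewrite /g indicE mem_set// mule1 lee_fin.
    rewrite -[leLHS]add0e leeD ?lee_fin ?(ltW t0)//.
    apply: le_trans (nneseries_lim_ge n.+1 _) => //.
    by rewrite big_nat_recr//= -[leLHS]add0e leeD// sume_ge0.
apply: (@le_trans _ _ (\int[mu]_(x in B) (t%:E + \sum_(0 <= k <oo) g k x))%E).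
  apply: ge0_le_integral => //.
  - by apply/measurable_EFinP; apply: measurableT_comp => //; exact: measurable_funTS.
  - apply: emeasurable_funD => //; apply: ge0_emeasurable_sum => //.
rewrite ge0_integralD//; first last.
- by apply: ge0_emeasurable_sum.
- by move=> x _; rewrite nneseries_ge0.
- by move=> x _; rewrite lee_fin ltW.
rewrite integral_cst// leeD//.
rewrite integral_nneseries//.
have gk k : (\int[mu]_(x in B) g k x <= (2 * K * t `^ (1 - p) * r ^+ k)%:E)%E.
  rewrite ge0_integralZl_EFin//; last 2 first.
  - by apply/measurable_EFinP; exact: measurable_indic.
  - by rewrite mulr_ge0 ?exprn_ge0 ?(ltW t0)//.
  rewrite integral_indic//.
  have c0 : 0 < 2 ^+ k * t by rewrite mulr_gt0// exprn_gt0.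
  apply: (@le_trans _ _ ((2 ^+ k.+1 * t)%:E * (K * (2 ^+ k * t) `^ (- p))%:E)%E).
    apply: lee_pmul => //; first by rewrite lee_fin mulr_ge0 ?exprn_ge0 ?(ltW t0).
    apply: le_trans (fK _ c0); apply: le_measure; rewrite ?inE//.
    - exact: measurableI.
    - exact: measurable_gt_norm.
  rewrite -EFinM lee_fin.
  rewrite exprS powRM ?exprn_ge0 ?(ltW t0)//.
  rewrite le_eqVlt; apply/orP; left; apply/eqP.
  have -> : r ^+ k = 2 ^+ k * (2 ^+ k) `^ (- p).
    rewrite -!powR_mulrn ?(ltW r0)// -!powRrM mulrC -powRD//.
      by congr (_ `^ _); ring.
    by rewrite (@pnatr_eq0 R 2) implybT.
  have -> : t `^ (1 - p) = t * t `^ (- p).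
    by rewrite powRD_gt0// powRr1// ltW.
  ring.
apply: le_trans (_ : (\sum_(0 <= k <oo) (2 * K * t `^ (1 - p) * r ^+ k)%:E <= _)%E).
  by apply: lee_nneseries => // k *; apply: integral_ge0.
apply: lime_le.
  by apply: is_cvg_nneseries => k _ _; rewrite lee_fin !mulr_ge0 ?exprn_ge0 ?powR_ge0 ?(ltW r0).
near=> n.
rewrite sumEFin lee_fin -mulr_sumr.
rewrite /cI -/r.
have -> : 2 / (1 - r) * K * t `^ (1 - p) = 2 * K * t `^ (1 - p) * (1 - r)^-1 by ring.
rewrite ler_wpM2l ?mulr_ge0 ?powR_ge0//.
have -> : \sum_(0 <= i < n) r ^+ i = (1 - r ^+ n) / (1 - r).
  apply: (canRL (mulfK _)); first by rewrite subr_eq0 gt_eqF.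
  elim: (n) => [|k IH]; first by rewrite big_nil expr0; ring.
  by rewrite big_nat_recr//= mulrDl IH exprS; ring.
by rewrite ler_pdivrMr ?subr_gt0// mulVf ?subr_eq0 ?gt_eqF// lerBlDr lerDl exprn_ge0 ?ltW.
Unshelve. all: by end_near. Qed.

Lemma weak_integrable f K B : measurable_fun setT f -> wb mu p f K ->
  measurable B -> (mu B < +oo)%E -> mu.-integrable B (EFin \o f).
Proof.
move=> mf fK mB Bfin; apply/integrableP; split.
  by apply/measurable_EFinP; exact: measurable_funTS.
apply: le_lt_trans (weak_integral_le mf fK mB ltr01) _.
by rewrite mul1e lte_add_pinfty// ltry.
Qed.

Lemma weak_Rintegral_le f K B t : measurable_fun setT f -> wb mu p f K ->
  measurable B -> (mu B < +oo)%E -> 0 < t ->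
  \int[mu]_(x in B) `|f x| <= t * fine (mu B) + cI * K * t `^ (1 - p).
Proof.
move=> mf fK mB Bfin t0; rewrite -lee_fin.
have := weak_integral_le mf fK mB t0.
have Bf : mu B \is a fin_num by rewrite ge0_fin_numE.
rewrite -{1}(fineK Bf) -EFinM -EFinD /Rintegral fineK//.
apply: integrable_fin_num => //.
by apply: integrable_norm => //; exact: weak_integrable fK mB Bfin.
Qed.

(** The height t = (K / mu B)^(1/p) balances the two terms of [weak_Rintegral_le]; the cases where
    it is not a positive real are treated apart, K = 0 by letting t tend to 0. Together with
    [powR_solve] this lets weak bounds be replaced by bounds on integrals, which survive averaging
    and limits. *)
Lemma weak_Rintegral_powR f K B : measurable_fun setT f -> wb mu p f K ->
  measurable B -> (mu B < +oo)%E ->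
  \int[mu]_(x in B) `|f x| <= (1 + cI) * K `^ p^-1 * fine (mu B) `^ (1 - p^-1).
Proof.
move=> mf fK mB Bfin.
have K0 := wb_ge0 fK.
have m0 : 0 <= fine (mu B) by rewrite fine_ge0.
have H t := weak_Rintegral_le mf fK mB Bfin (t := t).
have pN1 : 1 - p^-1 != 0 by rewrite subr_eq0 eq_sym invr_eq1 gt_eqF.
move: H; set I := Rintegral _ _ _; set m := fine (mu B) => H.
have mB0 : m = 0 -> I <= 0.
  move=> m0'; rewrite /I /Rintegral.
  have mu0 : mu B = 0%E by rewrite -[LHS]fineK ?ge0_fin_numE//; congr EFin.
  rewrite null_set_integral//; apply/measurable_EFinP.
  by apply: measurableT_comp => //; exact: measurable_funTS.
have [m00|mN0] := eqVneq m 0; first by rewrite m00 powR0// mulr0 mB0.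
have mp : 0 < m by rewrite lt_neqAle eq_sym mN0.
have [K00|KN0] := eqVneq K 0.
  rewrite K00 powR0 ?invr_eq0 ?gt_eqF// mulr0 mul0r.
  apply/ler_addgt0Pl => e e0; rewrite addr0.
  have := H (e / m) (divr_gt0 e0 mp).
  by rewrite K00 mulr0 mul0r addr0 divfK// gt_eqF.
have Kp : 0 < K by rewrite lt_neqAle eq_sym KN0.
have t0 : 0 < (K / m) `^ p^-1 by rewrite powR_gt0// divr_gt0.
apply: le_trans (H _ t0) _.
rewrite -powRrM mulrBr mulr1 mulVf ?gt_eqF//.
have e1 : (K / m) `^ p^-1 * m = K `^ p^-1 * m `^ (1 - p^-1).
  rewrite powRM ?invr_ge0 1?ltW// powRD_gt0// powRr1 1?ltW//.
  by rewrite -[m^-1]powR_inv1 1?ltW// -powRrM mulN1r -mulrA (mulrC m).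
have e2 : K * (K / m) `^ (p^-1 - 1) = K `^ p^-1 * m `^ (1 - p^-1).
  rewrite powRM ?invr_ge0 1?ltW// powRD_gt0// powR_inv1 1?ltW//.
  rewrite -[m^-1]powR_inv1 1?ltW// -powRrM mulN1r opprB.
  by field.
by rewrite e1 -[X in _ + X]mulrA e2 -[leRHS]mulrA mulrDl mul1r.
Qed.

End weak_integral.

(** * The decomposition method *)

Lemma addr_rearrange (V : zmodType) (a b c d e f : V) :
  a + b + (c + d - (e + f)) = a + (c - e) + (b + (d - f)).
Proof.
rewrite opprD (addrACA c).
exact: addrACA.
Qed.

Section quasi_seminormed.
Context {R : realType}.
Variables (A : R) (s : R -> R).

(* [bd v K] plays the role of "the [p]-th power of the quasi-norm of [v] is at
   most [K]"; vectors without any bound do not belong to the space, and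
   vectors bounded by [0] are identified with [0]. *)
Structure qspace := Qspace {
  qcar :> lmodType R;
  bd : qcar -> R -> Prop;
  bd_ge0 : forall v K, bd v K -> 0 <= K;
  bdW : forall v K L, K <= L -> bd v K -> bd v L;
  bd00 : bd 0 0;
  bdD : forall v w K L, bd v K -> bd w L -> bd (v + w) (A * (K + L));
  bdZ : forall a v K, bd v K -> bd (a *: v) (s a * K) }.

Definition mem_q (X : qspace) (v : X) := exists K, bd v K.
Definition eqv (X : qspace) (v w : X) := bd (v - w) 0.

Section theory.
Variable X : qspace.
Implicit Types v w z : X.

Lemma eqv_refl v : eqv v v. Proof. by rewrite /eqv subrr; exact: bd00. Qed.

Lemma eqv_eq v w : v = w -> eqv v w. Proof. by move=> ->; exact: eqv_refl. Qed.

Lemma eqvZ a v w : eqv v w -> eqv (a *: v) (a *: w).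
Proof. by move=> vw; have := bdZ a vw; rewrite mulr0 scalerBr. Qed.

Lemma eqvN v w : eqv v w -> eqv (- v) (- w).
Proof. by move/(eqvZ (-1)); rewrite !scaleN1r. Qed.

Lemma eqv_sym v w : eqv v w -> eqv w v.
Proof. by move=> vw; have := bdZ (-1) vw; rewrite mulr0 scaleN1r opprB. Qed.

Lemma eqvD v w v' w' : eqv v w -> eqv v' w' -> eqv (v + v') (w + w').
Proof.
by move=> vw vw'; have := bdD vw vw'; rewrite addr0 mulr0 addrACA -opprD.
Qed.

Lemma eqvB v w v' w' : eqv v w -> eqv v' w' -> eqv (v - v') (w - w').
Proof. by move=> vw /eqvN; exact: eqvD. Qed.

Lemma eqv_trans w v z : eqv v w -> eqv w z -> eqv v z.
Proof.
by move=> vw wz; have := bdD vw wz; rewrite addr0 mulr0 addrA subrK.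
Qed.

Lemma bd_eqv v w K : eqv v w -> bd v K -> bd w (A * K).
Proof.
by move/eqv_sym => vw vK; have := bdD vw vK; rewrite add0r subrK.
Qed.

Lemma mem_qD v w : mem_q v -> mem_q w -> mem_q (v + w).
Proof. by move=> [K vK] [L wL]; exists (A * (K + L)); exact: bdD. Qed.

Lemma mem_qZ a v : mem_q v -> mem_q (a *: v).
Proof. by move=> [K vK]; exists (s a * K); exact: bdZ. Qed.

Lemma mem_qN v : mem_q v -> mem_q (- v).
Proof. by rewrite -scaleN1r; exact: mem_qZ. Qed.

Lemma mem_qB v w : mem_q v -> mem_q w -> mem_q (v - w).
Proof. by move=> mv /mem_qN; exact: mem_qD. Qed.

End theory.

(** Linearity is asked only of vectors that have a bound, and only modulo [eqv]: one of the maps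
    built below picks representatives of limits by choice. *)
Definition morph (X Y : qspace) (J : X -> Y) := exists C, [/\ 0 <= C,
  forall v K, bd v K -> bd (J v) (C * K) &
  forall a v w, mem_q v -> mem_q w -> eqv (J (a *: v + w)) (a *: J v + J w)].

Section morph.
Variables (X Y : qspace) (J : X -> Y).
Hypothesis mJ : morph J.

Lemma morph_mem v : mem_q v -> mem_q (J v).
Proof. by case: mJ => C [_ bJ _] [K vK]; exists (C * K); exact: bJ. Qed.

Lemma morphP a v w : mem_q v -> mem_q w ->
  eqv (J (a *: v + w)) (a *: J v + J w).
Proof. by case: mJ => C [_ _]; apply. Qed.

Lemma morphD v w : mem_q v -> mem_q w -> eqv (J (v + w)) (J v + J w).
Proof. by move=> mv mw; have := morphP 1 mv mw; rewrite !scale1r. Qed.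

Lemma morphB v w : mem_q v -> mem_q w -> eqv (J (v - w)) (J v - J w).
Proof.
move=> mv mw; have := morphP (-1) mw mv.
by rewrite !scaleN1r (addrC v) (addrC (J v)).
Qed.

(** Compatibility with [eqv] comes from boundedness: the difference has bound 0, hence so has its
    image. *)
Lemma morph_eqv v w : mem_q v -> mem_q w -> eqv v w -> eqv (J v) (J w).
Proof.
move=> mv mw vw; apply: eqv_trans (_ : eqv (J v) (J (v - w) + J w)) _.
  have mvw := mem_qB mv mw.
  by have := morphD mvw mw; rewrite subrK.
case: mJ => C [_ bJ _]; have := bJ _ _ vw; rewrite mulr0 => J0.
by rewrite /eqv addrK.
Qed.

End morph.

Lemma morph_comp (X Y Z : qspace) (J : X -> Y) (J' : Y -> Z) :
  morph J -> morph J' -> morph (J' \o J).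
Proof.
move=> mJ mJ'; have [C [C0 bJ lJ]] := mJ; have [C' [C'0 bJ' lJ']] := mJ'.
exists (C' * C); split => [|v K vK|a v w mv mw]; first exact: mulr_ge0.
- by rewrite -mulrA; apply: bJ'; exact: bJ.
- have mJv := morph_mem mJ mv; have mJw := morph_mem mJ mw.
  apply: eqv_trans (lJ' a _ _ mJv mJw) => /=.
  apply: (morph_eqv mJ'); last exact: lJ.
    by apply: (morph_mem mJ); apply: mem_qD => //; exact: mem_qZ.
  by apply: mem_qD => //; exact: mem_qZ.
Qed.

Definition qiso (X Y : qspace) := exists (J : X -> Y) (J' : Y -> X),
  [/\ morph J, morph J', forall v, mem_q v -> eqv (J' (J v)) v &
      forall w, mem_q w -> eqv (J (J' w)) w].

Lemma qiso_sym X Y : qiso X Y -> qiso Y X.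
Proof. by move=> [J [J' [mJ mJ' h h']]]; exists J', J. Qed.

Lemma qiso_trans X Y Z : qiso X Y -> qiso Y Z -> qiso X Z.
Proof.
move=> [J [J' [mJ mJ' h h']]] [I [I' [mI mI' k k']]].
exists (I \o J), (J' \o I'); split; [exact: morph_comp..| |].
- move=> v mv /=; apply: eqv_trans (h _ mv).
  have mJv := morph_mem mJ mv.
  by apply: (morph_eqv mJ'); [exact: morph_mem mI' _ (morph_mem mI mJv)|by []|exact: k].
- move=> v mv /=; apply: eqv_trans (k' _ mv).
  have mJv := morph_mem mI' mv.
  by apply: (morph_eqv mI); [exact: morph_mem mJ _ (morph_mem mJ' mJv)|by []|exact: h'].
Qed.

Hypothesis A0 : 0 <= A.
Hypothesis s0 : forall a, 0 <= s a.

Section prod.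
Variables X Y : qspace.

Let pbd (v : X * Y) K := bd v.1 K /\ bd v.2 K.

Definition prodq : qspace.
Proof.
apply: (@Qspace (X * Y)%type pbd).
- by move=> v K [/bd_ge0].
- by move=> v K L KL [vK wK]; split; exact: bdW KL _.
- by split; exact: bd00.
- by move=> v w K L [? ?] [? ?]; split; exact: bdD.
- by move=> a v K [? ?]; split; exact: bdZ.
Defined.

Lemma eqv_prod (v w : prodq) : eqv v.1 w.1 -> eqv v.2 w.2 -> eqv v w.
Proof. by []. Qed.

Lemma mem_prod1 (v : prodq) : mem_q v -> mem_q v.1.
Proof. by move=> [K [? ?]]; exists K. Qed.

Lemma mem_prod2 (v : prodq) : mem_q v -> mem_q v.2.
Proof. by move=> [K [? ?]]; exists K. Qed.

End prod.

Lemma qiso_swap X Y : qiso (prodq X Y) (prodq Y X).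
Proof.
have sw U V : morph (fun v : prodq U V => (v.2, v.1) : prodq V U).
  exists 1; split => // [v K [? ?]|a v w _ _]; first by rewrite mul1r.
  by apply: eqv_eq.
by exists (fun v => (v.2, v.1)), (fun v => (v.2, v.1)); split => // -[v w] _;
  exact: eqv_refl.
Qed.

Section linf.
Variable X : qspace.

Let lbd (f : nat -> X) K := forall n, bd (f n) K.

Definition linf : qspace.
Proof.
apply: (@Qspace (nat -> X) lbd).
- by move=> v K /(_ 0); exact: bd_ge0.
- by move=> v K L KL vK n; exact: bdW KL _.
- by move=> n; exact: bd00.
- by move=> v w K L ? ? n; exact: bdD.
- by move=> a v K ? n; exact: bdZ.
Defined.

Lemma bd_linf (f : linf) K : (forall n, bd (f n) K) -> bd f K.
Proof. by []. Qed.

Lemma eqv_linf (f g : linf) : (forall n, eqv (f n) (g n)) -> eqv f g.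
Proof. by []. Qed.

End linf.

(* Pelczynski's decomposition method, for a space [Y] in which the sup-sum of
   countably many copies of [X] is complemented. *)
Lemma qiso_absorb (X Y : qspace) (j : linf X -> Y) (q : Y -> linf X) :
  morph j -> morph q -> (forall f, mem_q f -> eqv (q (j f)) f) ->
  qiso (prodq X Y) Y.
Proof.
move=> mj mq qj.
pose cons (x : X) (f : linf X) : linf X := fun n => if n is m.+1 then f m else x.
pose tail (f : linf X) : linf X := fun n => f n.+1.
have mem_cons x f : mem_q x -> mem_q f -> mem_q (cons x f).
  move=> [K xK] [L fL]; exists (Num.max K L); apply: bd_linf => -[|n] /=.
    by apply: bdW xK; rewrite le_max lexx.
  by apply: bdW (fL n); rewrite le_max lexx orbT.
have mem_tail f : mem_q f -> mem_q (tail f).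
  by move=> [K fK]; exists K; apply: bd_linf => n; exact: fK.
(* [Y] splits into the image of [j] and the kernel of [q]. Shifting the sequence in the first part
   by one place makes room for the new element of [X]; the second part [y - j (q y)] is kept. *)
pose phi (v : prodq X Y) : Y := j (cons v.1 (q v.2)) + (v.2 - j (q v.2)).
pose psi (y : Y) : prodq X Y := (q y 0, j (tail (q y)) + (y - j (q y))).
have [Cj [Cj0 bj lj]] := mj; have [Cq [Cq0 bq lq]] := mq.
have mphi : morph phi.
  exists (A * (Cj * (1 + Cq) + A * (1 + s (-1) * (Cj * Cq)))); split.
  - by rewrite !(mulr_ge0, addr_ge0).
  - move=> v K [vK wK]; have K0 := bd_ge0 vK.
    have bc : bd (cons v.1 (q v.2)) ((1 + Cq) * K).
      apply: bd_linf => -[|n] /=.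
        by apply: bdW vK; rewrite mulrDl mul1r lerDl mulr_ge0.
      by apply: bdW (bq _ _ wK n); rewrite mulrDl mul1r lerDr.
    have h2 : bd (v.2 - j (q v.2)) (A * (K + s (-1) * (Cj * (Cq * K)))).
      rewrite -scaleN1r; apply: bdD => //; apply: bdZ; apply: bj; exact: bq.
    have := bdD (bj _ _ bc) h2; apply: bdW.
    by rewrite le_eqVlt; apply/orP; left; apply/eqP; ring.
  - move=> a v w mv mw.
    have mv1 := mem_prod1 mv; have mv2 := mem_prod2 mv.
    have mw1 := mem_prod1 mw; have mw2 := mem_prod2 mw.
    have mqv := morph_mem mq mv2; have mqw := morph_mem mq mw2.
    have mqa : mem_q (q (a *: v.2 + w.2)).
      by apply: (morph_mem mq); apply: mem_qD => //; exact: mem_qZ.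
    have mc1 : mem_q (cons v.1 (q v.2)) by exact: mem_cons.
    have mc2 : mem_q (cons w.1 (q w.2)) by exact: mem_cons.
    have e1 : eqv (j (cons (a *: v.1 + w.1) (q (a *: v.2 + w.2))))
                  (a *: j (cons v.1 (q v.2)) + j (cons w.1 (q w.2))).
      apply: eqv_trans (lj a _ _ mc1 mc2).
      apply: (morph_eqv mj).
      + by apply: mem_cons => //; apply: mem_qD => //; exact: mem_qZ.
      + by apply: mem_qD => //; exact: mem_qZ.
      + apply: eqv_linf => -[|n] /=; first exact: eqv_refl.
        exact: (lq a _ _ mv2 mw2 n).
    have e2 : eqv (j (q (a *: v.2 + w.2))) (a *: j (q v.2) + j (q w.2)).
      exact: (morphP (morph_comp mq mj)).
    apply: eqv_trans (eqvD e1 (eqvB (eqv_refl (a *: v.2 + w.2)) e2)) _.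
    apply: eqv_eq; rewrite /phi !scalerDr scalerN.
    exact: addr_rearrange.
have mpsi : morph psi.
  exists (Cq + A * (Cj * Cq + A * (1 + s (-1) * (Cj * Cq)))); split.
  - by rewrite !(mulr_ge0, addr_ge0).
  - move=> y K yK; have K0 := bd_ge0 yK.
    have bt : bd (tail (q y)) (Cq * K) by move=> n; exact: bq.
    split => /=.
      apply: bdW (bq _ _ yK 0); rewrite [leRHS]mulrDl lerDl.
      by rewrite !(mulr_ge0, addr_ge0).
    have h2 : bd (y - j (q y)) (A * (K + s (-1) * (Cj * (Cq * K)))).
      rewrite -scaleN1r; apply: bdD => //; apply: bdZ; apply: bj; exact: bq.
    have := bdD (bj _ _ bt) h2; apply: bdW.
    rewrite [leRHS]mulrDl -[leLHS]add0r lerD ?mulr_ge0//.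
    by rewrite le_eqVlt; apply/orP; left; apply/eqP; ring.
  - move=> a v w mv mw.
    have mqv := morph_mem mq mv; have mqw := morph_mem mq mw.
    have mqa : mem_q (q (a *: v + w)).
      by apply: (morph_mem mq); apply: mem_qD => //; exact: mem_qZ.
    have e0 := lq a v w mv mw.
    have mt1 := mem_tail _ mqv; have mt2 := mem_tail _ mqw.
    apply: eqv_prod => /=; first exact: (e0 0).
    have e1 : eqv (j (tail (q (a *: v + w))))
                  (a *: j (tail (q v)) + j (tail (q w))).
      apply: eqv_trans (lj a _ _ mt1 mt2).
      apply: (morph_eqv mj).
      + exact: mem_tail.
      + by apply: mem_qD => //; exact: mem_qZ.
      + by move=> n; exact: (e0 n.+1).
    have e2 : eqv (j (q (a *: v + w))) (a *: j (q v) + j (q w)).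
      exact: (morphP (morph_comp mq mj)).
    apply: eqv_trans (eqvD e1 (eqvB (eqv_refl (a *: v + w)) e2)) _.
    apply: eqv_eq; rewrite !scalerDr scalerN.
    exact: addr_rearrange.
exists phi, psi; split => //.
- move=> v mv; have mv1 := mem_prod1 mv; have mv2 := mem_prod2 mv.
  have mqv := morph_mem mq mv2; have mjq := morph_mem mj mqv.
  have mc : mem_q (cons v.1 (q v.2)) by exact: mem_cons.
  have mjc := morph_mem mj mc.
  have mpv := morph_mem mphi mv.
  have qphi : eqv (q (phi v)) (cons v.1 (q v.2)).
    apply: eqv_trans (morphD mq mjc (mem_qB mv2 mjq)) _.
    rewrite -[X in eqv _ X]addr0; apply: eqvD; first exact: qj.
    rewrite -(subrr (q v.2)).
    apply: eqv_trans (morphB mq mv2 mjq) _.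
    by apply: eqvB; [exact: eqv_refl|exact: qj].
  have mqp := morph_mem mq mpv.
  apply: eqv_prod => /=; first exact: (qphi 0).
  have e1 : eqv (j (tail (q (phi v)))) (j (q v.2)).
    by apply: (morph_eqv mj) => //; [exact: mem_tail|move=> n; exact: (qphi n.+1)].
  have e2 : eqv (j (q (phi v))) (j (cons v.1 (q v.2))).
    exact: (morph_eqv mj).
  apply: eqv_trans (eqvD e1 (eqvB (eqv_refl _) e2)) _.
  by apply: eqv_eq; rewrite /phi addrAC subrr add0r addrC subrK.
- move=> y my; have mqy := morph_mem mq my; have mjq := morph_mem mj mqy.
  have mt := mem_tail _ mqy; have mjt := morph_mem mj mt.
  have mpsi2 : mem_q (psi y).2 by apply: mem_prod2; exact: (morph_mem mpsi).
  have q2 : eqv (q (psi y).2) (tail (q y)).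
    apply: eqv_trans (morphD mq mjt (mem_qB my mjq)) _.
    rewrite -[X in eqv _ X]addr0; apply: eqvD; first exact: qj.
    rewrite -(subrr (q y)).
    apply: eqv_trans (morphB mq my mjq) _.
    by apply: eqvB; [exact: eqv_refl|exact: qj].
  have mq2 := morph_mem mq mpsi2.
  have e1 : eqv (j (cons (psi y).1 (q (psi y).2))) (j (q y)).
    apply: (morph_eqv mj) => //.
      by apply: mem_cons => //; apply: mem_prod1; exact: (morph_mem mpsi).
    by apply: eqv_linf => -[|n] /=; [exact: eqv_refl|exact: q2].
  have e2 : eqv (j (q (psi y).2)) (j (tail (q y))) by exact: (morph_eqv mj).
  apply: eqv_trans (eqvD e1 (eqvB (eqv_refl _) e2)) _.
  by apply: eqv_eq => /=; rewrite addrAC subrr add0r addrC subrK.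
Qed.

(** X is isomorphic to Y x X, by swapping to X x Y, and this to Y. *)
Lemma qiso_mutual X Y : qiso (prodq X Y) Y -> qiso (prodq Y X) X -> qiso X Y.
Proof.
move=> h1 h2; apply: qiso_trans (qiso_sym h2) _.
exact: qiso_trans (qiso_swap Y X) h1.
Qed.

End quasi_seminormed.

(** * Complemented sup-sums *)

Section ultra_limit.
Context {R : realType} {U : set_system nat} {UF : UltraFilter U}.

Lemma ultra_bounded_cvg (u : nat -> R) (M : R) : (forall n, `|u n| <= M) ->
  cvg (u n @[n --> U]).
Proof.
move=> uM.
have [|c [_ cu]] := @segment_compact R (- M) M (u n @[n --> U]) _.
  rewrite /fmap/=; apply: filterE => n /=.
  by rewrite in_itv/= -ler_norml; exact: uM.
apply/cvg_ex; exists c => V Vc.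
have [//|UV] := in_ultra_setVsetC (u @^-1` V) UF.
have [x [/= Vx]] := cu (~` V) V UV Vc.
by [].
Qed.

End ultra_limit.

Section weak_limit.
Context {R : realType} {d : measure_display} {T : measurableType d}.
Variables (mu : {measure set T -> \bar R}).
Context {U : set_system nat} {UF : UltraFilter U}.

(** This replaces weak compactness. The bounds make the set functions uniformly absolutely
    continuous with respect to [mu] on [E], so their limit along the ultrafilter, at first only
    finitely additive, is countably additive and has a density. *)
Lemma weak_limit (E : set T) (K th : R) (m : nat -> set T -> R) :
  measurable E -> (mu E < +oo)%E -> 0 <= K -> 0 < th ->
  (forall n A B, measurable A -> measurable B -> A `&` B = set0 ->
     m n (A `|` B) = m n A + m n B) ->
  (forall n B, measurable B -> `|m n B| <= K * fine (mu (B `&` E)) `^ th) ->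
  exists f : T -> R, [/\ measurable_fun setT f, mu.-integrable E (EFin \o f) &
    forall B, measurable B -> m n B @[n --> U] --> \int[mu]_(x in B `&` E) f x].
Proof.
move=> mE Efin K0 th0 mD mK.
have finI B : measurable B -> mu (B `&` E) \is a fin_num.
  move=> mB; rewrite ge0_fin_numE//; apply: le_lt_trans Efin.
  by apply: le_measure; rewrite ?inE//; exact: measurableI.
pose l B := lim (m n B @[n --> U]).
have lcvg B : measurable B -> m n B @[n --> U] --> l B.
  by move=> mB; apply: ultra_bounded_cvg => n; exact: mK.
have lK B : measurable B -> `|l B| <= K * fine (mu (B `&` E)) `^ th.
  move=> mB; rewrite ler_norml; apply/andP; split.
    apply: limr_ge; first by apply/cvg_ex; exists (l B); exact: lcvg.
    by apply: filterE => n; have := mK n B mB; rewrite ler_norml => /andP[].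
  apply: limr_le; first by apply/cvg_ex; exists (l B); exact: lcvg.
  by apply: filterE => n; have := mK n B mB; rewrite ler_norml => /andP[].
have lD A B : measurable A -> measurable B -> A `&` B = set0 ->
    l (A `|` B) = l A + l B.
  move=> mA mB AB.
  apply: (cvg_unique _ (lcvg _ (measurableU _ _ mA mB))) => //.
  rewrite (_ : (fun n => m n (A `|` B)) = (fun n => m n A + m n B)).
    by apply: cvgD; exact: lcvg.
  by apply/funext => n; exact: mD.
have l0 : l set0 = 0.
  have := lD set0 set0 measurable0 measurable0 (set0I _).
  by rewrite setU0 => /eqP; rewrite -subr_eq subrr => /eqP.
pose nu B : \bar R := (l B)%:E.
have nu0 : nu set0 = 0%E by rewrite /nu l0.
have nusig : semi_sigma_additive nu.
  move=> F mF tF mUF; rewrite /nu.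
  under eq_fun do rewrite sumEFin.
  apply: cvg_EFin; first by apply: nearW.
  pose V n := \bigcup_(i in [set i | (n <= i)%N]) F i.
  have mV n : measurable (V n) by apply: bigcup_measurable.
  have Vn n : l (\bigcup_i F i) - \sum_(0 <= i < n) l (F i) = l (V n).
    elim: n => [|n IH].
      by rewrite big_nil subr0; congr l; apply: eq_bigcupl; split=> // i.
    rewrite big_nat_recr//= opprD addrA IH.
    have -> : V n = F n `|` V n.+1.
      apply/seteqP; split => x.
        move=> [i /= ni Fi]; have [ein|ein] := eqVneq i n.
          by left; rewrite -ein.
        by right; exists i => //=; rewrite ltn_neqAle eq_sym ein.
      move=> [Fx|[i /= ni Fi]]; first by exists n => /=.
      by exists i => //=; exact: ltnW.
    rewrite lD//; first by rewrite addrAC subrr add0r.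
    apply/seteqP; split => // x [Fx [i /= ni Fi]].
    have := tF n i I I (ex_intro _ x (conj Fx Fi)).
    by move=> e; rewrite e ltnn in ni.
  have Vto : fine (mu (V n `&` E)) @[n --> \oo] --> 0.
    have := @nonincreasing_cvg_mu _ _ _ mu (fun n => V n `&` E).
    move=> /(_ _ _ _ _).
    have -> : \bigcap_n (V n `&` E) = set0.
      apply/seteqP; split => // x h.
      have [[i _ Fi] _] := h 0%N I.
      have [[k /= ik Fk] _] := h i.+1 I.
      have e := tF i k I I (ex_intro _ x (conj Fi Fk)).
      by rewrite e ltnn in ik.
    rewrite measure0 => h.
    have : (mu (V n `&` E)) @[n --> \oo] --> 0%E.
      apply: h; first by rewrite -ge0_fin_numE// finI.
      - by move=> n; exact: measurableI.
      - exact: measurable0.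
      - move=> a b ab; apply/subsetPset; apply: setSI => x [i /= bi Fi].
        by exists i => //=; exact: leq_trans bi.
    by move/fine_cvgP => [].
  apply/cvgrPdist_le => e e0.
  (* [K + 1] in place of [K], since [K] may be 0 and is divided by. *)
  have K1 : 0 < K + 1 by rewrite ltr_wpDl.
  pose dl := (e / (K + 1)) `^ th^-1.
  have dl0 : 0 < dl by rewrite powR_gt0// divr_gt0.
  move/cvgrPdist_le : Vto => /(_ dl dl0); apply: filterS => n.
  rewrite sub0r normrN ger0_norm ?fine_ge0// => h.
  rewrite /= Vn; apply: le_trans (lK _ (mV n)) _.
  apply: (@le_trans _ _ ((K + 1) * dl `^ th)).
    apply: ler_pM => //.
      by rewrite lerDl.
    by rewrite ge0_ler_powR ?nnegrE ?fine_ge0// ltW.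
  rewrite /dl -powRrM mulVf ?gt_eqF// powRr1 ?divr_ge0 ?(ltW e0) ?(ltW K1)//.
  by rewrite mulrC divfK// gt_eqF.
have [cnu cnuE] : exists c : {charge set T -> \bar R}, forall B, c B = nu B.
  pose c : {charge set T -> \bar R} :=
    HB.pack nu (isCharge.Build _ _ _ nu nu0 (fun x _ => erefl) nusig).
  by exists c.
(* The Radon-Nikodym theorem asks for a sigma-finite measure: the restriction of [mu] to [E] is
   one. *)
have [mu' mu'E] : exists m' : {sigma_finite_measure set T -> \bar R},
    forall B, m' B = mu (B `&` E) by exists (mfrestr mE Efin).
have lnull B : measurable B -> mu (B `&` E) = 0%E -> l B = 0.
  move=> mB B0; apply/eqP; rewrite -normr_le0; apply: le_trans (lK _ mB) _.
  by rewrite B0 /= powR0 ?gt_eqF// mulr0.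
have dom : cnu `<< mu'.
  apply/null_content_dominatesP => A mA A0.
  by rewrite cnuE /nu lnull// -mu'E.
pose g := Radon_Nikodym cnu mu'.
have gfin x : g x \is a fin_num by exact: Radon_Nikodym_fin_num.
have gint := Radon_Nikodym_integrable dom.
have gE A mA := @Radon_Nikodym_integral _ _ _ cnu mu' A dom mA.
have mug (h : T -> \bar R) A : measurable A -> A `<=` E ->
    (\int[mu']_(x in A) h x = \int[mu]_(x in A) h x)%E.
  move=> mA AE; apply: eq_measure_integral => B mB BA.
  rewrite -[X in mu X](setIidl (subset_trans BA AE)); exact: mu'E.
have gf : EFin \o (fine \o g) = g.
  by apply/funext => x /=; rewrite fineK//; exact: gfin.
have mg : measurable_fun setT g by exact: measurable_int gint.
exists (fine \o g); split.
- by apply/measurable_EFinP; rewrite gf.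
- rewrite gf; apply/integrableP; split; first exact: measurable_funTS.
  rewrite -mug//; apply: le_lt_trans (_ : \int[mu']_x `|g x| < +oo)%E.
    apply: ge0_subset_integral => //; exact: measurableT_comp.
  by case/integrableP : gint.
- move=> B mB.
  have -> : \int[mu]_(x in B `&` E) (fine \o g) x = l B.
    have mBE := measurableI _ _ mB mE.
    have : nu (B `&` E) = (\int[mu']_(x in B `&` E) g x)%E by rewrite -cnuE gE.
    rewrite mug// => lB.
    rewrite /Rintegral.
    under eq_integral do rewrite -/((EFin \o (fine \o g)) _) gf.
    rewrite -lB /nu/=.
    have e : B = (B `&` E) `|` (B `\` E) by rewrite setUIDK.
    rewrite {2}e lD//.
    + rewrite (@lnull (B `\` E)) ?addr0//; first exact: measurableD.
      by rewrite setDE -setIA setICl setI0 measure0.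
    + exact: measurableD.
    + by apply/seteqP; split => // x [[_ Ex] [_]]; apply.
  exact: lcvg.
Qed.
End weak_limit.

Section real_tools.
Context {R : realType}.

(** The way back from integrals to weak bounds: [S] is the measure of a set on which a function
    exceeds [c], so that [c * S] is below its integral; dividing by S^(1-1/p) isolates [S]. *)
Lemma powR_solve (p c S D : R) : 1 < p -> 0 < c -> 0 <= S -> 0 <= D ->
  c * S <= D * S `^ (1 - p^-1) -> S <= D `^ p * c `^ (- p).
Proof.
move=> p1 c0 S0 D0 h; have p0 : 0 < p by exact: lt_trans p1.
have [->|SN0] := eqVneq S 0; first by rewrite mulr_ge0// powR_ge0.
have Sp : 0 < S by rewrite lt_neqAle eq_sym SN0.
have e : S `^ (1 - p^-1) = S * (S `^ p^-1)^-1.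
  by rewrite powRD_gt0// powRr1// powRN.
have h2 : S `^ p^-1 <= D / c.
  rewrite ler_pdivlMr// mulrC.
  move: h; rewrite e mulrA ler_pdivlMr ?powR_gt0// => h.
  by rewrite -(ler_pM2l Sp) mulrCA mulrA (mulrC S D).
have := ge0_ler_powR (ltW p0) (powR_ge0 _ _) (divr_ge0 D0 (ltW c0)) h2.
rewrite -powRrM mulVf ?gt_eqF// powRr1// powRM ?invr_ge0 ?(ltW c0)//.
by rewrite -powR_inv1 ?(ltW c0)// -powRrM mulN1r.
Qed.

Lemma sum_half_pow n : \sum_(i < n) (2^-1 : R) ^+ i.+1 <= 1.
Proof.
suff -> : \sum_(i < n) (2^-1 : R) ^+ i.+1 = 1 - 2^-1 ^+ n.
  by rewrite gerBl exprn_ge0.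
elim: n => [|n IH]; first by rewrite big_ord0 expr0 subrr.
by rewrite big_ord_recr/= IH exprS; field.
Qed.

(* At most one term can exceed [2^-(i+1) y]: of two active indices, the one
   whose cap [al] lies below the threshold [be] of the other is small. *)
Lemma separated_sum_le (t al be : nat -> R) (y : R) n : 0 <= y ->
  (forall i, t i <= y) -> (forall i, t i <= al i) ->
  (forall i, 0 < t i -> be i <= y) ->
  (forall i l, (i < l)%N -> al i <= 2^-1 ^+ i.+1 * be l \/
                            al l <= 2^-1 ^+ l.+1 * be i) ->
  \sum_(i < n) t i <= 2 * y.
Proof.
move=> y0 ty ta tb sep.
have [i0 hi0] : exists i0, forall i, i != i0 -> t i <= 2^-1 ^+ i.+1 * y.
  have [[i0 h0]|H] := pselect (exists i, ~ t i <= 2^-1 ^+ i.+1 * y); last first.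
    by exists 0%N => i _; apply: contrapT => h; apply: H; exists i.
  exists i0 => i ii0; apply: contrapT => h.
  have small i1 i2 : ~ t i1 <= 2^-1 ^+ i1.+1 * y -> ~ t i2 <= 2^-1 ^+ i2.+1 * y ->
      al i1 <= 2^-1 ^+ i1.+1 * be i2 -> False.
    move=> h1 h2 ab; apply: h1; apply: le_trans (ta _) (le_trans ab _).
    rewrite ler_wpM2l ?exprn_ge0// tb//.
    move/negP: h2; rewrite -ltNge; apply: le_lt_trans.
    by rewrite mulr_ge0// exprn_ge0.
  have [lt|lt|e] := ltngtP i i0; last by rewrite e eqxx in ii0.
    by have [] := sep _ _ lt; exact: small.
  by have [] := sep _ _ lt; exact: small.
have tle (i : nat) : t i <= 2^-1 ^+ i.+1 * y + (i == i0)%:R * y.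
  have [->|ne] := eqVneq i i0.
    by rewrite mul1r -[leLHS]add0r lerD// mulr_ge0// exprn_ge0.
  by rewrite mul0r addr0 hi0.
apply: le_trans (_ : \sum_(i < n) (2^-1 ^+ i.+1 * y + (nat_of_ord i == i0)%:R * y) <= _).
  by apply: ler_sum => i _; exact: tle.
rewrite big_split/= -!mulr_suml mulrDl mul1r lerD// -[leRHS]mul1r ler_wpM2r//.
  exact: sum_half_pow.
have [ni0|ni0] := ltnP i0 n.
  rewrite (bigD1 (Ordinal ni0))//= eqxx big1 ?addr0// => i.
  by move=> ne; rewrite (_ : (nat_of_ord i == i0) = false)//; exact/negbTE.
rewrite big1// => i _; rewrite (_ : (nat_of_ord i == i0) = false)//.
by rewrite ltn_eqF// (leq_trans (ltn_ord i)).
Qed.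

End real_tools.

Section glue.
Context {R : realType} {d : measure_display} {T : measurableType d} {I : Type}.
Variables (B : I -> set T) (f : I -> T -> R).

Definition glue (x : T) : R :=
  if pselect (exists i, B i x) is left e then f (sval (cid e)) x else 0.

Definition disj_fam := forall i j x, B i x -> B j x -> i = j.

Lemma glueE i x : disj_fam -> B i x -> glue x = f i x.
Proof.
move=> dB Bx; rewrite /glue; case: pselect => [e|]; last by case; exists i.
by rewrite (dB _ _ _ (svalP (cid e)) Bx).
Qed.

Lemma glue0 x : (forall i, ~ B i x) -> glue x = 0.
Proof. by move=> h; rewrite /glue; case: pselect => // -[i Bi]; case: (h i). Qed.

Lemma measurable_glue : countable [set: I] -> disj_fam ->
  (forall i, measurable (B i)) -> (forall i, measurable_fun setT (f i)) ->
  measurable_fun setT glue.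
Proof.
move=> cI dB mB mf _ Y mY; rewrite setTI.
have -> : glue @^-1` Y = (\bigcup_i (B i `&` f i @^-1` Y)) `|`
    (~` (\bigcup_i B i) `&` (fun=> 0) @^-1` Y).
  apply/seteqP; split => x /=.
    have [[i Bi]|h] := pselect (exists i, B i x).
      by rewrite (glueE dB Bi) => Yx; left; exists i.
    rewrite glue0 => [Y0|i Bi]; last by apply: h; exists i.
    by right; split => // -[i _ Bi]; apply: h; exists i.
  move=> [[i _ [Bi Yi]]|[h Y0]]; first by rewrite (glueE dB Bi).
  by rewrite glue0// => i Bi; apply: h; exists i.
apply: measurableU.
  apply: countable_bigcupT_measurable => // i; apply: measurableI => //.
  by rewrite -[X in measurable X]setTI; exact: mf.
apply: measurableI.
  by apply: measurableC; exact: countable_bigcupT_measurable.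
by rewrite -[X in measurable X]setTI; exact: measurable_cst.
Qed.

End glue.

Section keys.
Context {d : measure_display} {T : measurableType d}.
Variable H : nat -> (T -> nat) -> set T.

(* Binary code of the first [n] memberships; the [m]-th test set may depend on
   the code computed so far. *)
Fixpoint key (n : nat) (x : T) : nat :=
  if n is m.+1 then (key m x).*2 + `[< H m (key m) x >] else 0.

Lemma key_lt n x : (key n x < 2 ^ n)%N.
Proof.
elim: n => //= n IH; rewrite expnS mul2n -!addnn; case: `[< _ >] => /=; lia.
Qed.

Lemma key_inj n x y : key n.+1 x = key n.+1 y ->
  key n x = key n y /\ (H n (key n) x <-> H n (key n) y).
Proof.
move=> /= e.
have ek : key n x = key n y.
  have := congr1 half e.
  rewrite !(addnC _.*2) !half_bit_double//.
split=> //; move: e; rewrite ek => /addnI.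
by case: asboolP => ?; case: asboolP.
Qed.

Lemma key_eqW n m x y : (m <= n)%N -> key n x = key n y -> key m x = key m y.
Proof.
elim: n => [|n IH]; first by rewrite leqn0 => /eqP->.
rewrite leq_eqVlt => /orP[/eqP->//|mn] /key_inj[+ _].
exact: IH.
Qed.

Lemma measurable_key n j :
  (forall m, (m < n)%N -> (forall i, measurable [set x | key m x = i]) ->
     measurable (H m (key m))) ->
  measurable [set x | key n x = j].
Proof.
elim: n j => [|n IH] j mH.
  have [->|j0] := eqVneq j 0%N.
    by rewrite (_ : [set x | _] = setT)//; apply/seteqP.
  rewrite (_ : [set x | _] = set0)//; apply/seteqP; split => // x /= /esym/eqP.
  by rewrite (negbTE j0).
have mk i : measurable [set x | key n x = i].
  by apply: IH => m mn; apply: mH; exact: ltnW.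
have mHn : measurable (H n (key n)) by exact: mH.
have -> : [set x | key n.+1 x = j] = [set x | key n x = j./2] `&`
    (if odd j then H n (key n) else ~` H n (key n)).
  apply/seteqP; split => x /=.
    move=> <-; rewrite (addnC _.*2) half_bit_double oddD odd_double addbF oddb.
    by case: asboolP.
  move=> [-> Hx]; rewrite -[RHS]odd_double_half addnC; congr (_ + _)%N.
  by case: (odd j) Hx => Hx; [rewrite asboolT|rewrite asboolF].
apply: measurableI => //; case: ifP => // _; exact: measurableC.
Qed.

End keys.

Section integral_tools.
Context {R : realType} {d : measure_display} {T : measurableType d}.
Variable mu : {measure set T -> \bar R}.

Lemma measurable_bigsetU_ord (A : nat -> set T) n :
  (forall j, measurable (A j)) -> measurable (\big[setU/set0]_(j < n) A j).
Proof. by move=> mA; apply: bigsetU_measurable. Qed.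

Lemma Rintegral_bigsetU (A : nat -> set T) n (phi : T -> R) :
  (forall j, measurable (A j)) -> disj_fam A ->
  mu.-integrable (\big[setU/set0]_(j < n) A j) (EFin \o phi) ->
  \int[mu]_(x in \big[setU/set0]_(j < n) A j) phi x =
  \sum_(j < n) \int[mu]_(x in A j) phi x.
Proof.
move=> mA dA; elim: n => [|n IH]; first by rewrite !big_ord0 Rintegral_set0.
rewrite !big_ord_recr/= => iphi.
have mU := measurable_bigsetU_ord n mA.
rewrite Rintegral_setU//.
  rewrite IH//; apply: integrableS iphi => //; exact: measurableU.
apply/disj_setPS => x [+ Anx].
rewrite -bigcup_mkord => -[i /= ilt Aix].
by move: ilt; rewrite (dA _ _ _ Aix Anx) ltnn.
Qed.

Lemma Rintegral_null (A : set T) (phi : T -> R) : measurable A ->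
  measurable_fun setT phi -> mu A = 0%E -> \int[mu]_(x in A) phi x = 0.
Proof.
move=> mA mphi A0; rewrite /Rintegral null_set_integral//.
by apply/measurable_EFinP; exact: measurable_funTS.
Qed.

Lemma Rintegral_ae_zero (D : set T) (phi : T -> R) : measurable D ->
  measurable_fun setT phi -> mu.-integrable D (EFin \o phi) ->
  (forall B, measurable B -> B `<=` D -> \int[mu]_(x in B) phi x = 0) ->
  {ae mu, forall x, D x -> phi x = 0}.
Proof.
move=> mD mphi iphi h.
have : ae_eq mu D (EFin \o phi) (cst 0%E).
  apply: integral_ae_eq => // B BD mB; rewrite integral0.
  rewrite -[0%E]/(0%:E) -(h B mB BD) /Rintegral fineK//.
  by apply: integrable_fin_num => //; exact: integrableS iphi.
by apply: filterS => x h' Dx; have := h' Dx => /= -[].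
Qed.

(* Dynkin's theorem; a finite intersection involving a null set is null, so
   only intersections of generators have to be tested. *)
Lemma generates_integral_zero (O D : set T) (G : nat -> set T) (phi : T -> R) :
  generates_on mu O (range G) -> measurable D -> D `<=` O -> measurable O ->
  measurable_fun setT phi -> mu.-integrable D (EFin \o phi) ->
  (forall s : seq nat,
     \int[mu]_(x in foldr (fun l B => G l `&` B) O s `&` D) phi x = 0) ->
  forall B, measurable B -> B `<=` D -> \int[mu]_(x in B) phi x = 0.
Proof.
move=> [GO genO] mD DO mO mphi iphi h.
have iS B : measurable B -> mu.-integrable (B `&` D) (EFin \o phi).
  by move=> mB; apply: integrableS iphi => //; exact: measurableI.
pose cap s := foldr (fun l B => G l `&` B) O s.
have mG l : measurable (G l).
  by have [] : trace_sigma O (G l) by apply: GO; exists l.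
have GlO l : G l `<=` O.
  by have [] : trace_sigma O (G l) by apply: GO; exists l.
have mcap s : measurable (cap s) by elim: s => //= l s IH; exact: measurableI.
have capO s : cap s `<=` O.
  by elim: s => //= l s IH x [_ /IH].
pose P := [set B | null_sets_in mu O B \/ exists s, B = cap s].
have capI s t : cap s `&` cap t = cap (s ++ t).
  elim: s => [|l s IH] /=; first by rewrite setIC setIidl.
  by rewrite -setIA IH.
have PI : setI_closed P.
  have nullI A B : null_sets_in mu O A -> measurable B -> null_sets_in mu O (A `&` B).
    move=> [mA AO A0] mB; split; first exact: measurableI.
      by move=> x [/AO].
    apply/eqP; rewrite eq_le measure_ge0 andbT -A0.
    by apply: le_measure; rewrite ?inE//; exact: measurableI.
  move=> A B [nA|[s ->]] [nB|[t ->]].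
  - by left; apply: nullI => //; case: nB.
  - by left; apply: nullI.
  - by left; rewrite setIC; apply: nullI.
  - by right; exists (s ++ t); rewrite capI.
pose L := [set B | [/\ measurable B, B `<=` O & \int[mu]_(x in B `&` D) phi x = 0]].
have LSD : setSD_closed L.
  move=> A B BA [mA AO A0] [mB BO B0]; split; first exact: measurableD.
    by move=> x [/AO].
  have e : A `&` D = (A `\` B) `&` D `|` B `&` D by rewrite -setIUl setUC setDUK.
  have iA := iS _ mA.
  move: A0; rewrite e Rintegral_setU//; last 4 first.
  - by apply: measurableI => //; exact: measurableD.
  - exact: measurableI.
  - by rewrite -e.
  - by apply/disj_setPS => x [[[_ nB] _] [/nB]].
  by rewrite B0 addr0.
have phiD : \int[mu]_(x in D) phi x = 0.
  by have := h [::]; rewrite /= setIidr.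
have lamL : lambda_system O L.
  split.
  - by move=> A [].
  - by split => //; rewrite setIidr.
  - exact: LSD.
  - move=> F ndF LF.
    have mF n : measurable (F n) by case: (LF n).
    have mUF : measurable (\bigcup_n F n) by exact: bigcup_measurable.
    split => //; first by move=> x [n _]; case: (LF n) => _ + _; apply.
    have LS n : L (seqD F n).
      case: n => [|n] /=; first exact: LF.
      by apply: LSD => //; apply/subsetPset/ndF.
    have := @integral_bigcup _ _ _ mu (fun n => seqD F n `&` D) (EFin \o phi).
    have -> : \bigcup_k (seqD F k `&` D) = \bigcup_n F n `&` D.
      by rewrite -setI_bigcupl; congr (_ `&` _); exact: eq_bigcup_seqD.
    rewrite /Rintegral => ->; last 3 first.
    - by apply: trivIset_setIr; exact: trivIset_seqD.
    - by move=> k; apply: measurableI => //; case: (LS k).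
    - exact: iS.
    rewrite eseries0// => k _ _.
    have [mk _] := LS k; rewrite /Rintegral => h0.
    rewrite -[RHS]/(0%:E) -h0 fineK//.
    apply: integrable_fin_num; last exact: iS.
    exact: measurableI.
have PL : P `<=` L.
  move=> A [[mA AO A0]|[s ->]].
    split => //; apply: Rintegral_null => //; first exact: measurableI.
    apply/eqP; rewrite eq_le measure_ge0 andbT -A0.
    by apply: le_measure; rewrite ?inE//; exact: measurableI.
  by split => //; exact: h.
have sPO : <<s O, P >> `<=` trace_sigma O.
  apply: smallest_sub.
    rewrite genO; exact: smallest_sigma_algebra.
  by move=> A [[mA AO _]|[s ->]]; split.
move=> B mB BD.
have : trace_sigma O B by split => //; exact: subset_trans DO.
rewrite genO => BG.
have : <<s O, P >> B.
  move: B BG {mB BD}; apply: smallest_sub; first exact: smallest_sigma_algebra.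
  move=> A [[l _ <-]|nA]; apply: sub_sigma_algebra.
    by right; exists [:: l]; rewrite /= setIidl.
  by left.
move/(lambda_system_subset PI lamL PL (fun X hX => (sPO X hX).2)).
by move=> [_ _]; rewrite setIidl.
Qed.
End integral_tools.

Section averages.
Context {R : realType} {d : measure_display} {T : measurableType d}.
Variables (mu : {measure set T -> \bar R}) (p : R).
Hypothesis p1 : 1 < p.

Let p0 : 0 < p. Proof. by apply: lt_trans p1. Qed.

(* [0] when [mu A] is [0] or [+oo], since then [(fine (mu A))^-1 = 0]. *)
Definition avg (A : set T) (f : T -> R) : R :=
  \int[mu]_(x in A) f x / fine (mu A).

Lemma avg_neq0 A f : avg A f != 0 -> 0 < fine (mu A) /\ (mu A < +oo)%E.
Proof.
rewrite /avg mulf_eq0 negb_or invr_eq0 => /andP[_ h].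
have A0 : 0 < fine (mu A) by rewrite lt_neqAle eq_sym h fine_ge0.
split => //; rewrite -ge0_fin_numE//.
by move: h; case: (mu A) => //=; rewrite eqxx.
Qed.

Definition cavg : R := (1 + cI p) `^ p.

(** Averaging over disjoint cells is bounded in weak L^p. On the union of the cells whose average
    exceeds c, the integral of |f| is at least c times the measure; [weak_Rintegral_powR] bounds it
    from above, and [powR_solve] yields the constant [cavg]. *)
Lemma avg_distribution f K (A : nat -> set T) N c :
  measurable_fun setT f -> wb mu p f K ->
  (forall j, measurable (A j)) -> disj_fam A -> 0 < c ->
  \sum_(j < N) (if c < `|avg (A j) f| then fine (mu (A j)) else 0) <=
  cavg * K * c `^ (- p).
Proof.
move=> mf fK mA dA c0.
have K0 := wb_ge0 fK.
pose A' j := if c < `|avg (A j) f| then A j else set0.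
have mA' j : measurable (A' j) by rewrite /A'; case: ifP.
have dA' : disj_fam A'.
  by move=> i j x; rewrite /A'; do 2 case: ifP => // _; exact: dA.
have A'fin j : (mu (A' j) < +oo)%E.
  rewrite /A'; case: ifPn => [h|_]; last by rewrite measure0.
  have /avg_neq0[] // : avg (A j) f != 0.
  by rewrite -normr_gt0; exact: lt_trans h.
pose E := \big[setU/set0]_(j < N) A' j.
have mE : measurable E by exact: measurable_bigsetU_ord.
have tA' : trivIset setT A'.
  by move=> i j _ _ [x [Ai Aj]]; exact: dA' Ai Aj.
have muE : mu E = (\sum_(j < N) fine (mu (A' j)))%:E.
  rewrite /E measure_bigsetU// -sumEFin; apply: eq_bigr => i _.
  by rewrite fineK// ge0_fin_numE.
have -> : \sum_(j < N) (if c < `|avg (A j) f| then fine (mu (A j)) else 0) =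
    fine (mu E).
  rewrite muE /=; apply: eq_bigr => j _; rewrite /A'.
  by case: ifP => //; rewrite measure0.
have Efin : (mu E < +oo)%E by rewrite muE ltry.
have ifE := weak_integrable p1 mf fK mE Efin.
have inE_ : mu.-integrable E (EFin \o (fun x => `|f x|)) by exact: integrable_norm.
rewrite /cavg; set D := (1 + cI p).
have D0 : 0 <= D by rewrite addr_ge0// ltW// cI_gt0.
have <- : (D * K `^ p^-1) `^ p = D `^ p * K.
  by rewrite powRM ?powR_ge0// -powRrM mulVf ?gt_eqF// powRr1.
apply: powR_solve => //; rewrite ?fine_ge0 ?mulr_ge0 ?powR_ge0//.
apply: le_trans (weak_Rintegral_powR p1 mf fK mE Efin).
rewrite Rintegral_bigsetU// muE/= mulr_sumr; apply: ler_sum => j _.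
have ij : mu.-integrable (A' j) (EFin \o f) by exact: weak_integrable fK _ _.
apply: le_trans (le_normr_Rintegral _ ij) => //.
rewrite /A' in ij *; case: ifPn => [h|_]; last first.
  by rewrite measure0 mulr0.
have /avg_neq0[m0 _] : avg (A j) f != 0.
  by rewrite -normr_gt0; exact: lt_trans h.
have -> : \int[mu]_(x in A j) f x = avg (A j) f * fine (mu (A j)).
  by rewrite /avg divfK// gt_eqF.
by rewrite normrM (ger0_norm (ltW m0)) ler_pM2r// ltW.
Qed.

Definition step (A : nat -> set T) (b : nat -> R) (N : nat) : T -> R :=
  glue A (fun j _ => if (j < N)%N then b j else 0).

Lemma stepE A b N j x : disj_fam A -> A j x ->
  step A b N x = if (j < N)%N then b j else 0.
Proof. by move=> dA Ax; rewrite /step (glueE _ dA Ax). Qed.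

Lemma measurable_step A b N : disj_fam A -> (forall j, measurable (A j)) ->
  measurable_fun setT (step A b N).
Proof. by move=> dA mA; apply: measurable_glue. Qed.

Lemma wb_step (A : nat -> set T) (b : nat -> R) N (K : R) :
  disj_fam A -> (forall j, measurable (A j)) ->
  (forall j, b j != 0 -> (mu (A j) < +oo)%E) ->
  (forall c : R, 0 < c ->
    \sum_(j < N) (if c < `|b j| then fine (mu (A j)) else 0) <= K * c `^ (- p)) ->
  wb mu p (step A b N) K.
Proof.
move=> dA mA bfin h c c0.
pose A' j := if c < `|b j| then A j else set0.
have mA' j : measurable (A' j) by rewrite /A'; case: ifP.
have A'fin j : (mu (A' j) < +oo)%E.
  rewrite /A'; case: ifPn => [cb|_]; last by rewrite measure0.
  by apply: bfin; rewrite -normr_gt0; exact: lt_trans cb.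
apply: (@le_trans _ _ (mu (\big[setU/set0]_(j < N) A' j))).
  apply: le_measure; rewrite ?inE.
  - by apply: measurable_gt_norm; exact: measurable_step.
  - exact: measurable_bigsetU_ord.
  - move=> x /= cx.
    have [[j Aj]|nA] := pselect (exists j, A j x); last first.
      move: cx; rewrite /step glue0 ?normr0 ?(ltNge c) ?(ltW c0)// => j Aj.
      by apply: nA; exists j.
    move: cx; rewrite (stepE _ _ dA Aj); case: ifPn => [jN cb|_]; last first.
      by rewrite normr0 ltNge (ltW c0).
    rewrite -bigcup_mkord; exists j => //=.
    by rewrite /A' cb.
apply: le_trans (le_mu_bigsetU _ _) _; first by move=> i _; exact: mA'.
apply: (@le_trans _ _ (\sum_(j < N) (if c < `|b j| then fine (mu (A j)) else 0))%:E).
  rewrite -sumEFin; apply: lee_sum => j _; have := A'fin j; rewrite /A'.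
  case: ifP => [_ fin|_ _]; last by rewrite measure0.
  by rewrite fineK// ge0_fin_numE.
by rewrite lee_fin h.
Qed.

End averages.

Section weak_Lp_space.
Context {R : realType} {d : measure_display} {T : measurableType d}.
Variables (mu : {measure set T -> \bar R}) (p : R).
Hypothesis p1 : 1 < p.

Definition wbd (f : T -> R) K := measurable_fun setT f /\ wb mu p f K.

(** The constants of the quasi-seminormed space are those of [wbD] and [wbZ], as bounds refer to the
    p-th power of the quasi-norm. *)
Definition wLp : qspace (2 `^ p) (fun a : R => `|a| `^ p).
Proof.
apply: (@Qspace _ _ _ (T -> R) wbd).
- by move=> v K [_ /wb_ge0].
- by move=> v K L KL [mv vK]; split => //; exact: wbW KL vK.
- by split; [exact: measurable_cst|exact: wb0].
- move=> v w K L [mv vK] [mw wL]; split; first exact: measurable_funD.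
  exact: wbD.
- move=> a v K [mv vK]; split; first exact: measurable_funM.
  exact: wbZ.
Defined.

Lemma wb_null_ae (f : T -> R) : measurable_fun setT f -> wb mu p f 0 ->
  {ae mu, forall x, f x = 0}.
Proof.
move=> mf f0.
have mA n : measurable [set x | n.+1%:R^-1 < `|f x|] by exact: measurable_gt_norm.
apply: (@negligibleS _ _ _ _ (\bigcup_n [set x | n.+1%:R^-1 < `|f x|])); last first.
  apply: negligible_bigcup => n; exists [set x | n.+1%:R^-1 < `|f x|]; split => //.
  apply/eqP; rewrite eq_le measure_ge0 andbT.
  by have := f0 n.+1%:R^-1 (_ : 0 < _); rewrite mul0r; apply; rewrite invr_gt0.
- move=> x /= /eqP fx0.
  have n0 : 0 < `|f x| by rewrite normr_gt0.
  have [n hn] : exists n, n.+1%:R^-1 < `|f x|.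
    by exists (Num.bound `|f x|^-1); rewrite invf_plt ?posrE//; apply: lt_trans (archi_boundP _) _ => //; rewrite ?ltr_nat// invr_ge0 ltW.
  by exists n.
Qed.

Lemma ae_wb_null (f : T -> R) : measurable_fun setT f ->
  {ae mu, forall x, f x = 0} -> wb mu p f 0.
Proof.
move=> mf [N [mN N0 fN]] c c0; rewrite mul0r.
apply: (@le_trans _ _ (mu N)); last by rewrite N0.
apply: le_measure; rewrite ?inE//; first exact: measurable_gt_norm.
move=> x /= cx; apply: fN => /= fx0.
by move: cx; rewrite fx0 normr0 ltNge (ltW c0).
Qed.

End weak_Lp_space.

Lemma weakLp_isomorphic_qiso (R : realType) d (T : measurableType d)
    (mu : {measure set T -> \bar R}) d' (T' : measurableType d')
    (nu : {measure set T' -> \bar R}) (p : R) (p1 : 1 < p) :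
  qiso (wLp mu p) (wLp nu p) -> weakLp_isomorphic mu nu p.
Proof.
have p0 : 0 < p by exact: lt_trans p1.
move=> [J [J' [mJ mJ' JJ' J'J]]].
have memE d1 (S : measurableType d1) (la : {measure set S -> \bar R}) (f : S -> R) :
    weakLp la p f <-> mem_q (f : wLp la p).
  split; first by move/(weakLp_wb la p1) => [mf [K _ fK]]; exists K.
  move=> [K [mf fK]]; apply/(weakLp_wb la p1); split => //.
  by exists K => //; exact: wb_ge0 fK.
have aeE d1 (S : measurableType d1) (la : {measure set S -> \bar R}) (f g : S -> R) :
    measurable_fun setT f -> measurable_fun setT g ->
    ae_eq_fun la f g <-> eqv (f : wLp la p) g.
  move=> mf mg; have mfg : measurable_fun setT (f \- g) by exact: measurable_funB.
  split.
    move=> [N [mN N0 fN]]; split => //; apply: ae_wb_null => //.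
    exists N; split => // x /= h; apply: fN => /= fg; apply: h.
    by rewrite -[LHS]/(f x - g x) fg subrr.
  move=> [_ /wb_null_ae] => /(_ mfg) [N [mN N0 fN]]; exists N; split => // x /= h.
  by apply: fN => /= /eqP; rewrite subr_eq0 => /eqP.
have mm d1 (S : measurableType d1) (la : {measure set S -> \bar R}) (f : wLp la p) :
    mem_q f -> measurable_fun setT f.
  by move=> [K []].
have [C [C0 bJ lJ]] := mJ; have [C' [C'0 bJ' lJ']] := mJ'.
exists J; split; last first.
  move=> h /memE mh; have mJh := morph_mem mJ' mh.
  exists (J' h); split; first exact/memE.
  apply: (aeE _ _ nu _ h _ _).2; [exact: (mm _ _ _ _ (morph_mem mJ mJh))|exact: (mm _ _ nu h mh)|exact: J'J].
split.
- by move=> f /memE mf; apply/memE; exact: (morph_mem mJ mf).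
- move=> f g /memE mf /memE mg fg; apply: (aeE _ _ nu _ _ _ _).2.
  + exact: (mm _ _ _ _ (morph_mem mJ mf)).
  + exact: (mm _ _ _ _ (morph_mem mJ mg)).
  + apply: (morph_eqv mJ) => //; apply: (aeE _ _ mu _ _ _ _).1 => //; [exact: (mm _ _ mu f mf)|exact: (mm _ _ mu g mg)].
- move=> a f g /memE mf /memE mg.
  have mJf := morph_mem mJ mf; have mJg := morph_mem mJ mg.
  apply: (aeE _ _ nu _ _ _ _).2.
  + apply: (mm _ _ nu _ _); apply: (morph_mem mJ).
    by apply: mem_qD => //; exact: mem_qZ.
  + by apply: (mm _ _ nu _ _); apply: mem_qD => //; exact: mem_qZ.
  + exact: lJ.
- have bnd d1 (S : measurableType d1) (la : {measure set S -> \bar R})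
      d2 (S' : measurableType d2) (la' : {measure set S' -> \bar R})
      (f : S -> R) (g : S' -> R) D :
      0 <= D -> weakLp la p f -> (forall K, wb la p f K -> wb la' p g (D * K)) ->
      (weak_norm la' p g <= (D `^ p^-1)%:E * weak_norm la p f)%E.
    move=> D0 wf h.
    have /(weakLp_wb la p1)[mf [K K0 fK]] := wf.
    have n0 : (0 <= weak_norm la p f)%E.
      apply: (@le_trans _ _ (1%:E * poweR (la [set x | (1 < `|f x|)%R]) p^-1)%E).
        by rewrite mul1e poweR_ge0.
      by apply: ereal_sup_ubound; exists 1 => //=.
    have nfin : weak_norm la p f = (fine (weak_norm la p f))%:E.
      by rewrite fineK// ge0_fin_numE//; case: wf.
    have m0 : 0 <= fine (weak_norm la p f) by rewrite fine_ge0.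
    have := h _ (weak_norm_wb p1 m0 (_ : (weak_norm la p f <= _)%E)).
    rewrite -nfin => /(_ (lexx _)) /wb_weak_norm.
    move=> /(_ p1 (mulr_ge0 D0 (powR_ge0 _ _))) /le_trans; apply.
    rewrite [in leRHS]nfin -EFinM lee_fin powRM ?powR_ge0// -powRrM mulfV ?gt_eqF//.
    by rewrite powRr1.
  (* The lower bound goes through [J'], and [J' \o J] is the identity only modulo null vectors,
     whence the extra quasi-triangle constant 2^p; the 1 keeps [D] positive. *)
  pose D := Num.max 1 (Num.max (C `^ p^-1) ((2 `^ p * C') `^ p^-1)).
  have D0 : 0 < D by rewrite lt_max ltr01.
  exists D; split => // f /memE mf.
  have wf : weakLp mu p f by exact/memE.
  have wJf : weakLp nu p (J f) by apply/memE; exact: (morph_mem mJ mf).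
  have nn d1 (S : measurableType d1) (la : {measure set S -> \bar R}) (g : S -> R) :
      (0 <= weak_norm la p g)%E.
    apply: (@le_trans _ _ (1%:E * poweR (la [set x | (1 < `|g x|)%R]) p^-1)%E).
      by rewrite mul1e poweR_ge0.
    by apply: ereal_sup_ubound; exists 1 => //=.
  split.
    apply: (@le_trans _ _ ((C `^ p^-1)%:E * weak_norm mu p f)%E).
      apply: bnd => // K fK; exact: (bJ f K (conj (mm _ _ _ _ mf) fK)).2.
    by rewrite lee_wpmul2r// lee_fin !le_max lexx orbT.
  apply: (@le_trans _ _ (((2 `^ p * C') `^ p^-1)%:E * weak_norm nu p (J f))%E).
    apply: bnd => // [|K JfK]; first by rewrite mulr_ge0// powR_ge0.
    have h1 := bJ' (J f) K (conj (mm _ _ _ _ (morph_mem mJ mf)) JfK).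
    by have [_] := bd_eqv (JJ' f mf) h1; rewrite mulrA.
  by rewrite lee_wpmul2r// lee_fin !le_max lexx !orbT.
Qed.

(** Room for countably many rescaled copies of finite families of masses. The factor 2 in the masses
    leaves space for rounding to integers. Of any two copies, one has a total mass that is
    negligible against the threshold [dl] of the other, scaled; [dl] will be the least positive mass
    of a copy. *)
Definition rich {R : realType} {d} {T : measurableType d} (mu : set T -> \bar R) :=
  forall (N : nat -> nat) (m : nat -> nat -> R) (dl : nat -> R),
  (forall i j, 0 <= m i j) -> (forall i j, (N i <= j)%N -> m i j = 0) ->
  (forall i, 0 < dl i) ->
  exists (s : nat -> R) (B : nat -> nat -> set T), [/\
    forall i, 0 < s i,
    forall i j, measurable (B i j),
    forall i j i' j' x, B i j x -> B i' j' x -> i = i' /\ j = j',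
    forall i j, ((s i * m i j)%:E <= mu (B i j) <= (2 * s i * m i j)%:E)%E &
    forall i l, (i < l)%N ->
      s i * (\sum_(j < N i) m i j) <= 2^-1 ^+ i.+1 * (s l * dl l) \/
      s l * (\sum_(j < N l) m l j) <= 2^-1 ^+ l.+1 * (s i * dl i)].

(* Statement (3) of the theorem for [O] and its complement. *)
Definition essentially_separable {R : realType} {d} {T : measurableType d}
    (mu : set T -> \bar R) (O : set T) := [/\ measurable O,
  countably_generated_on mu O, sigma_finite O mu &
  forall s, measurable s -> s `<=` ~` O -> mu s = 0%E \/ mu s = +oo%E].

Section measure_tools.
Context {R : realType} {d : measure_display} {T : measurableType d}.
Variables (mu : {measure set T -> \bar R}) (p : R).
Hypothesis p1 : 1 < p.
Let p0 : 0 < p. Proof. by apply: lt_trans p1. Qed.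

Lemma mu_bigcup_le (F : (set T)^nat) (x : \bar R) :
  (forall n, measurable (F n)) -> nondecreasing_seq F ->
  (forall n, (mu (F n) <= x)%E) -> (mu (\bigcup_n F n) <= x)%E.
Proof.
move=> mF ndF Fx.
have h := nondecreasing_cvg_mu (mu := mu) mF (bigcup_measurable (fun n _ => mF n)) ndF.
by rewrite -(cvg_lim _ h)//; apply: lime_le;
  [apply/cvg_ex; eexists; exact: h|exact: nearW].
Qed.

Lemma avgP a (f g : T -> R) K L A :
  measurable A -> measurable_fun setT f -> measurable_fun setT g ->
  wb mu p f K -> wb mu p g L ->
  avg mu A (fun x => a * f x + g x) = a * avg mu A f + avg mu A g.
Proof.
move=> mA mf mg fK gL; rewrite /avg.
have [Afin|] := ltP (mu A) +oo%E; last first.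
  by rewrite leye_eq => /eqP ->; rewrite /= invr0 !mulr0 addr0.
have iF := weak_integrable p1 mf fK mA Afin.
have iG := weak_integrable p1 mg gL mA Afin.
rewrite RintegralD//; last first.
  rewrite (_ : EFin \o _ = (fun x => a%:E * (EFin \o f) x)%E)//.
  exact: integrableZl.
by rewrite RintegralZl// mulrDl mulrA.
Qed.

Lemma integrable_lin a (f g : T -> R) A : measurable A ->
  mu.-integrable A (EFin \o f) -> mu.-integrable A (EFin \o g) ->
  mu.-integrable A (EFin \o (fun x => a * f x + g x)).
Proof.
move=> mA iF iG.
rewrite (_ : EFin \o _ = ((fun x => a%:E * (EFin \o f) x) \+ (EFin \o g))%E)//.
by apply: integrableD => //; exact: integrableZl.
Qed.

Lemma Rintegral_lin a (f g : T -> R) A : measurable A ->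
  mu.-integrable A (EFin \o f) -> mu.-integrable A (EFin \o g) ->
  \int[mu]_(x in A) (a * f x + g x) =
  a * \int[mu]_(x in A) f x + \int[mu]_(x in A) g x.
Proof.
move=> mA iF iG; rewrite RintegralD//; first by rewrite RintegralZl.
rewrite (_ : EFin \o _ = (fun x => a%:E * (EFin \o f) x)%E)//.
exact: integrableZl.
Qed.

Lemma integrable_bigsetU (A : nat -> set T) n (phi : T -> R) :
  (forall j, measurable (A j)) -> disj_fam A -> measurable_fun setT phi ->
  (forall j, mu.-integrable (A j) (EFin \o phi)) ->
  mu.-integrable (\big[setU/set0]_(j < n) A j) (EFin \o phi).
Proof.
move=> mA dA mphi iphi; elim: n => [|n IH].
  by rewrite big_ord0; exact: integrable_set0.
have mU := measurable_bigsetU_ord n mA.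
rewrite big_ord_recr/=; apply/integrableP; split.
  by apply: measurable_funTS; exact/measurable_EFinP.
rewrite ge0_integral_setU//.
- by rewrite lte_add_pinfty//; [case/integrableP : IH|case/integrableP : (iphi n)].
- apply: measurableT_comp => //; apply: measurable_funTS.
  exact/measurable_EFinP.
- apply/disj_setPS => x [+ Anx]; rewrite -bigcup_mkord => -[i /= ilt Aix].
  by move: ilt; rewrite (dA _ _ _ Aix Anx) ltnn.
Qed.

Lemma Rintegral_partition E (A : nat -> set T) n (phi : T -> R) :
  E = \big[setU/set0]_(j < n) A j -> (forall j, measurable (A j)) ->
  disj_fam A -> mu.-integrable E (EFin \o phi) ->
  \int[mu]_(x in E) phi x = \sum_(j < n) \int[mu]_(x in A j) phi x.
Proof. by move=> ->; exact: Rintegral_bigsetU. Qed.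

Lemma avg_cst A a (f : T -> R) : measurable A -> 0 < fine (mu A) ->
  (forall x, A x -> f x = a) -> avg mu A f = a.
Proof.
move=> mA A0 fa; rewrite /avg.
rewrite (@eq_Rintegral _ _ _ _ _ (fun=> a)); last first.
  by move=> x /set_mem Ax; rewrite fa.
by rewrite Rintegral_cst// mulfK// gt_eqF.
Qed.

(** Level sets of [f] at positive heights have finite measure, and off [O] finite measure means
    measure 0. *)
Lemma wb_ae_zero_off (O : set T) (f : T -> R) K : measurable O ->
  (forall s, measurable s -> s `<=` ~` O -> mu s = 0%E \/ mu s = +oo%E) ->
  measurable_fun setT f -> wb mu p f K ->
  {ae mu, forall x, ~ O x -> f x = 0}.
Proof.
move=> mO O2 mf fK.
have mA n : measurable ([set x | n.+1%:R^-1 < `|f x|] `\` O).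
  by apply: measurableD => //; exact: measurable_gt_norm.
apply: (@negligibleS _ _ _ _ (\bigcup_n ([set x | n.+1%:R^-1 < `|f x|] `\` O))).
  move=> x /= /not_implyP[nO /eqP fx0].
  have n0 : 0 < `|f x| by rewrite normr_gt0.
  have [n hn] : exists n, n.+1%:R^-1 < `|f x|.
    by exists (Num.bound `|f x|^-1); rewrite invf_plt ?posrE//; apply: lt_trans (archi_boundP _) _ => //; rewrite ?ltr_nat// invr_ge0 ltW.
  by exists n.
apply: negligible_bigcup => n; eexists; split; [exact: mA| |exact: subset_refl].
have [//|] := O2 _ (mA n) (fun x => @proj2 _ _).
have : (mu ([set x | (n.+1%:R^-1 < `|f x|)%R] `\` O) <= (K * (n.+1%:R^-1) `^ (- p))%:E)%E.
  apply: le_trans (fK _ _); last by rewrite invr_gt0.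
  by apply: le_measure; rewrite ?inE//; exact: measurable_gt_norm.
by move=> h e; move: h; rewrite e leye_eq.
Qed.

Lemma le_normr_Rintegral_lb (A : set T) (phi : T -> R) c : measurable A ->
  (mu A < +oo)%E -> mu.-integrable A (EFin \o phi) ->
  (forall x, A x -> c <= phi x) \/ (forall x, A x -> c <= - phi x) ->
  c * fine (mu A) <= `|\int[mu]_(x in A) phi x|.
Proof.
move=> mA Afin ih h.
have ic : mu.-integrable A (EFin \o cst c).
  by apply: measurable_bounded_integrable => //; exact: bounded_cst.
rewrite -Rintegral_cst//; case: h => h.
  by apply: le_trans (ler_norm _); exact: le_Rintegral.
rewrite -normrN; apply: le_trans (ler_norm _).
have -> : - (\int[mu]_(x in A) phi x) = \int[mu]_(x in A) (- phi x).
  rewrite -mulN1r -RintegralZl//; apply: eq_Rintegral => x _.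
  by rewrite mulN1r.
apply: le_Rintegral => //.
rewrite (_ : EFin \o _ = (fun x => (-1)%:E * (EFin \o phi) x)%E); last first.
  by apply/funext => x /=; rewrite -EFinM mulN1r.
exact: integrableZl.
Qed.

End measure_tools.

Lemma cvg_sum_ord {R : realType} (U : set_system nat) {FU : Filter U}
    (u : nat -> nat -> R) (l : nat -> R) n :
  (forall j, u j i @[i --> U] --> l j) ->
  \sum_(j < n) u j i @[i --> U] --> \sum_(j < n) l j.
Proof.
move=> ul; elim: n => [|n IH].
  rewrite big_ord0 (_ : (fun i => _) = (fun=> 0)); first exact: cvg_cst.
  by apply/funext => i; rewrite big_ord0.
rewrite big_ord_recr/= (_ : (fun i => _) = (fun i => \sum_(j < n) u j i + u n i)).
  by apply: cvgD.
by apply/funext => i; rewrite big_ord_recr.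
Qed.

(** * The complemented embedding built from cell averages *)

Section embedding.
Context {R : realType} {d1 : measure_display} {T1 : measurableType d1}
  {d2 : measure_display} {T2 : measurableType d2}.
Variables (mu1 : {measure set T1 -> \bar R}) (mu2 : {measure set T2 -> \bar R}).
Variables (p : R) (p1 : 1 < p).
Variables (O : set T1) (G D : nat -> set T1).
Hypothesis mO : measurable O.
Hypothesis genO : generates_on mu1 O (range G).
Hypothesis mD : forall n, measurable (D n).
Hypothesis Dfin : forall n, (mu1 (D n) < +oo)%E.
Hypothesis dD : disj_fam D.
Hypothesis OD : O = \bigcup_n D n.
Hypothesis O2 : forall s, measurable s -> s `<=` ~` O ->
  mu1 s = 0%E \/ mu1 s = +oo%E.
Hypothesis rich2 : rich mu2.

Let p0 : 0 < p. Proof. by apply: lt_trans p1. Qed.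

Let mG l : measurable (G l).
Proof. by have [+ _] := genO => /(_ (G l)) []//; exists l. Qed.

Let DO n : D n `<=` O. Proof. by rewrite OD => x Dx; exists n. Qed.

(** Even tests run through the generators, odd tests through the pieces of finite measure, so that
    the cells eventually resolve every finite intersection of generators inside a piece. *)
Let H (m : nat) (_ : T1 -> nat) : set T1 := if odd m then D m./2 else G m./2.

Let A n j := O `&` [set x | key H n x = j].

Let mA n j : measurable (A n j).
Proof.
apply: measurableI => //; apply: measurable_key => m _ _.
by rewrite /H; case: ifP.
Qed.

Let dA n : disj_fam (A n).
Proof. by move=> i j x [_ <-] [_ <-]. Qed.

(** Block [i] serves the pair (copy k, partition n) coded by [i], so each copy is represented on all
    partitions at once. Numbers that code no pair fall back on (0, 0). *)
Let kk (i : nat) : nat := (odflt (0%N, 0%N) (unpickle i)).1.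
Let nn (i : nat) : nat := (odflt (0%N, 0%N) (unpickle i)).2.
Let ii (k n : nat) : nat := pickle (k, n).

Let kkE k n : kk (ii k n) = k. Proof. by rewrite /kk /ii pickleK. Qed.
Let nnE k n : nn (ii k n) = n. Proof. by rewrite /nn /ii pickleK. Qed.

Let N i := (2 ^ nn i)%N.
Let m i j := fine (mu1 (A (nn i) j)).
Let dl i : R := \big[Num.min/1]_(j < N i | 0 < m i j) m i j.

Let m_ge0 i j : 0 <= m i j. Proof. exact: fine_ge0. Qed.

Let A0 n j : (2 ^ n <= j)%N -> A n j = set0.
Proof.
move=> h; apply/seteqP; split => // x [_ /= e].
by have := key_lt H n x; rewrite e ltnNge h.
Qed.

Let m0 i j : (N i <= j)%N -> m i j = 0.
Proof. by move=> h; rewrite /m A0// measure0. Qed.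

Let dl_gt0 i : 0 < dl i.
Proof. by apply: lt_bigmin. Qed.

Let dl_le i j : (j < N i)%N -> 0 < m i j -> dl i <= m i j.
Proof.
move=> jN mp; rewrite /dl.
exact: (@bigmin_le_cond _ _ 'I_(N i) 1 (Ordinal jN) (fun j => 0 < m i j) (fun j => m i j) mp).
Qed.

Section blocks.
Variables (s : nat -> R) (B : nat -> nat -> set T2).
Hypothesis s0 : forall i, 0 < s i.
Hypothesis mB : forall i j, measurable (B i j).
Hypothesis dB : forall i j i' j' x, B i j x -> B i' j' x -> i = i' /\ j = j'.
Hypothesis sB :
  forall i j, ((s i * m i j)%:E <= mu2 (B i j) <= (2 * s i * m i j)%:E)%E.
Hypothesis sep : forall i l, (i < l)%N ->
      s i * (\sum_(j < N i) m i j) <= 2^-1 ^+ i.+1 * (s l * dl l) \/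
      s l * (\sum_(j < N l) m l j) <= 2^-1 ^+ l.+1 * (s i * dl i).

(** Scaling measures by [s i] scales the p-th power of the quasi-norm by [s i]; this amplitude
    compensates it. *)
Let v i := s i `^ (- p^-1).

Let v0 i : 0 < v i. Proof. by rewrite powR_gt0. Qed.

Let vp i : v i `^ p = (s i)^-1.
Proof. by rewrite /v -powRrM mulNr mulVf ?gt_eqF// powR_inv1// ltW. Qed.

Let Bfin i j : (mu2 (B i j) < +oo)%E.
Proof. by have /andP[_ /le_lt_trans] := sB i j; apply; rewrite ltry. Qed.

Let dBi i : disj_fam (B i).
Proof. by move=> j j' x Bx Bx'; have [] := dB Bx Bx'. Qed.

Let sBf i j : s i * m i j <= fine (mu2 (B i j)) <= 2 * s i * m i j.
Proof. by rewrite -!lee_fin fineK// ge0_fin_numE. Qed.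

Let BB (ij : nat * nat) := B ij.1 ij.2.

Let dBB : disj_fam BB.
Proof. by move=> [i j] [i' j'] x Bx Bx'; have [/= -> ->] := dB Bx Bx'. Qed.

(** On block [i] sits the conditional expectation of the copy [kk i] on the partition [nn i],
    transplanted to the sets [B i j]. *)
Let J (f : linf (wLp mu1 p)) : wLp mu2 p := glue BB
  (fun ij _ => v ij.1 * avg mu1 (A (nn ij.1) ij.2) (f (kk ij.1))).

Let JE (f : linf (wLp mu1 p)) i j x : B i j x ->
  J f x = v i * avg mu1 (A (nn i) j) (f (kk i)).
Proof. by move=> Bx; rewrite /J (glueE (i := (i, j)) _ dBB Bx). Qed.

Let J0 (f : linf (wLp mu1 p)) x : (forall i j, ~ B i j x) -> J f x = 0.
Proof. by move=> nB; apply: glue0 => -[i j]; exact: nB. Qed.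

Let mJ (f : linf (wLp mu1 p)) : measurable_fun setT (J f).
Proof.
by apply: measurable_glue => // -[i j]; exact: mB.
Qed.

Let sel (f : linf (wLp mu1 p)) c i j : bool :=
  c / v i < `|avg mu1 (A (nn i) j) (f (kk i))|.

(** Each block alone obeys the bound [y] by [avg_distribution]; since the scales are separated,
    [separated_sum_le] bounds all blocks together by [2 * y]. *)
Let J_sum_le (f : linf (wLp mu1 p)) K c n : bd f K -> 0 < c ->
  \sum_(i < n) (s i * \sum_(j < N i) (if sel f c i j then m i j else 0)) <=
  2 * (cavg p * K * c `^ (- p)).
Proof.
move=> fK c0; have K0 := bd_ge0 fK.
set y := cavg p * K * c `^ (- p).
have y0 : 0 <= y by rewrite !mulr_ge0 ?powR_ge0.
pose t i := s i * \sum_(j < N i) (if sel f c i j then m i j else 0).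
have ty i : t i <= y.
  have [mfk fkK] := fK (kk i).
  have := avg_distribution p1 (N i) mfk fkK (mA (nn i)) (dA (n := nn i)) (divr_gt0 c0 (v0 i)).
  rewrite -(ler_pM2l (s0 i)) => /le_trans; apply.
  rewrite powRM ?invr_ge0 ?(ltW c0) ?(ltW (v0 i))//.
  rewrite -[(v i)^-1]powR_inv1 ?(ltW (v0 i))// -powRrM mulN1r opprK vp /y.
  rewrite le_eqVlt; apply/orP; left; apply/eqP; field.
  by rewrite gt_eqF.
have ta i : t i <= s i * \sum_(j < N i) m i j.
  by rewrite ler_pM2l//; apply: ler_sum => j _; case: ifP.
(* A block that contributes at all has selected a cell of positive mass, hence mass at least
   [dl i]. *)
have tb i : 0 < t i -> s i * dl i <= y.
  move=> ti0; apply: le_trans (ty i); rewrite ler_pM2l//.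
  apply: contrapT => h; suff : t i = 0 by move=> e; rewrite e ltxx in ti0.
  rewrite /t big1 ?mulr0// => j _; case: ifPn => // cj.
  apply/eqP; rewrite eq_le m_ge0 andbT leNgt; apply/negP => mp; apply: h.
  apply: le_trans (dl_le (ltn_ord j) mp) _.
  rewrite (bigD1 j)//= cj lerDl sumr_ge0// => j' _; by case: ifP.
exact: separated_sum_le n y0 ty ta tb sep.
Qed.

(** In the factor 4, one 2 is the inaccuracy of the masses in [sB] and the other comes from
    [J_sum_le]. *)
Let bJ (f : linf (wLp mu1 p)) K : bd f K -> bd (J f : wLp mu2 p) (4 * cavg p * K).
Proof.
move=> fK; have K0 := bd_ge0 fK; split => // c c0.
pose Y i j := if sel f c i j then B i j else set0.
have mY i j : measurable (Y i j) by rewrite /Y; case: ifP.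
pose X i := \big[setU/set0]_(j < N i) Y i j.
have mX i : measurable (X i) by exact: measurable_bigsetU_ord.
have XS : [set x | c < `|J f x|] `<=` \bigcup_i X i.
  move=> x /= cx.
  have [[i [j Bx]]|nB] := pselect (exists i j, B i j x); last first.
    move: cx; rewrite J0 ?normr0 ?ltNge ?(ltW c0)// => i j Bx; apply: nB.
    by exists i, j.
  move: cx; rewrite (JE _ Bx) normrM gtr0_norm// -ltr_pdivrMl// mulrC => cx.
  exists i => //; rewrite /X -(bigcup_mkord _ (Y i)).
  exists j; last by rewrite /Y /sel cx.
  rewrite /= ltnNge; apply/negP => Nj.
  move: cx; rewrite A0// /avg measure0 invr0 mulr0 normr0 ltNge.
  by rewrite divr_ge0 ?ltW.
apply: le_trans (measure_sigma_subadditive mu2 mX (measurable_gt_norm _ (mJ f)) XS) _.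
pose t i := s i * \sum_(j < N i) (if sel f c i j then m i j else 0).
apply: (@le_trans _ _ (\sum_(0 <= i <oo) (2 * t i)%:E)%E).
  apply: lee_nneseries => // i _.
  apply: le_trans (le_mu_bigsetU mu2 (fun j _ => mY i j)) _.
  rewrite /t mulrA mulr_sumr -sumEFin; apply: lee_sum => j _.
  rewrite /Y; case: ifP => _; last by rewrite measure0 mulr0.
  by have /andP[] := sB i j.
apply: lime_le.
  apply: is_cvg_nneseries => i _ _; rewrite lee_fin mulr_ge0// mulr_ge0 ?(ltW (s0 i))//.
  by apply: sumr_ge0 => j _; case: ifP.
apply: nearW => n; rewrite sumEFin lee_fin big_mkord -mulr_sumr.
apply: le_trans (ler_wpM2l _ (J_sum_le n fK c0)) _ => //.
by rewrite le_eqVlt; apply/orP; left; apply/eqP; ring.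
Qed.

Let lJ a (f g : linf (wLp mu1 p)) : mem_q f -> mem_q g ->
  J (a *: f + g) = a *: J f + J g.
Proof.
move=> [K fK] [L gL]; apply/funext => x.
have [[i [j Bx]]|nB] := pselect (exists i j, B i j x); last first.
  have nB' i j : ~ B i j x by move=> Bx; apply: nB; exists i, j.
  rewrite -[RHS]/(a * J f x + J g x).
  by rewrite !J0// mulr0 addr0.
rewrite -[RHS]/(a * J f x + J g x) !(JE _ Bx).
have [mf fk] := fK (kk i); have [mg gk] := gL (kk i).
rewrite [avg _ _ ((a *: f + g) (kk i))](avgP p1 a (mA (nn i) j) mf mg fk gk).
by rewrite mulrDr mulrCA.
Qed.

Let morphJ : morph (J : linf (wLp mu1 p) -> wLp mu2 p).
Proof.
exists (4 * cavg p); split.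
- by rewrite mulr_ge0// powR_ge0.
- by move=> f K fK; exact: bJ.
- by move=> a f g mf mg; apply: eqv_eq; exact: lJ.
Qed.

Context {U : set_system nat} {UF : UltraFilter U}.
Hypothesis Uoo : (\oo : set_system nat) `<=` U.

Let b (g : wLp mu2 p) k n j : R := (v (ii k n))^-1 * avg mu2 (B (ii k n) j) g.

(** The averages of [g] over block (k, n), rescaled and carried back to the cells of the n-th
    partition. For [g = J f] these are the cell averages of [f k], so a limit in n should recover
    [f k]. *)
Let h g k n : T1 -> R := step (A n) (b g k n) (2 ^ n).

Let mh g k n : measurable_fun setT (h g k n).
Proof. exact: measurable_step. Qed.

Let hK (g : wLp mu2 p) k n K : bd g K -> wb mu1 p (h g k n) (cavg p * K).
Proof.
move=> [mg gK]; have K0 := wb_ge0 gK.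
pose i := ii k n.
have mi j : m i j = fine (mu1 (A n j)) by rewrite /m /i nnE.
apply: wb_step => //.
  (* A cell of infinite measure has [m i j = 0], because [fine] sends infinity to 0; its set [B i j]
     is then null and the average over it vanishes. *)
  move=> j bj; rewrite ltNge leye_eq; apply/negP => /eqP Aoo.
  have : avg mu2 (B i j) g != 0.
    by apply: contra_neq bj => e; rewrite /b e mulr0.
  case/avg_neq0 => + _; have /andP[_] := sBf i j.
  by rewrite mi Aoo/= mulr0 => h1 /lt_le_trans /(_ h1); rewrite ltxx.
move=> c c0.
have := avg_distribution p1 (2 ^ n) mg gK (mB i) (@dBi i) (mulr_gt0 c0 (v0 i)).
rewrite powRM ?(ltW c0) ?(ltW (v0 i))// powRN (powRN (v i)) vp invrK => hh.
rewrite -(ler_pM2l (s0 i)) mulr_sumr.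
apply: le_trans (_ : \sum_(j < 2 ^ n) (if c * v i < `|avg mu2 (B i j) g| then fine (mu2 (B i j)) else 0) <= _).
  apply: ler_sum => j _.
  rewrite /b normrM normfV (gtr0_norm (v0 _)) ltr_pdivlMl// (mulrC (v _)).
  case: ifP => // _; last by rewrite mulr0.
  by rewrite -mi; have /andP[] := sBf i j.
apply: le_trans hh _.
by rewrite le_eqVlt; apply/orP; left; apply/eqP; ring.
Qed.

Let lh a (f g : wLp mu2 p) k n : mem_q f -> mem_q g ->
  h (a *: f + g) k n = (fun x => a * h f k n x + h g k n x).
Proof.
move=> [K [mf fK]] [L [mg gL]]; apply/funext => x.
rewrite /h; have [[j Ax]|nA] := pselect (exists j, A n j x); last first.
  have nA' j : ~ A n j x by move=> Ax; apply: nA; exists j.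
  by rewrite /step !glue0// mulr0 addr0.
rewrite !(stepE _ _ (dA (n := n)) Ax); case: ifP => _; last by rewrite mulr0 addr0.
rewrite /b [avg _ _ (a *: f + g)](avgP p1 a (mB _ _) mf mg fK gL).
by rewrite mulrDr mulrCA.
Qed.

(** The limit of [h g k n] along the ultrafilter, tested on subsets of the pieces. Being 0 off [O]
    fixes the limit up to a null set. *)
Let isQ (g : wLp mu2 p) k (phi : T1 -> R) := [/\ measurable_fun setT phi,
  (forall x, ~ O x -> phi x = 0),
  (forall l, mu1.-integrable (D l) (EFin \o phi)) &
  forall l X, measurable X -> X `<=` D l ->
    \int[mu1]_(x in X) h g k n x @[n --> U] --> \int[mu1]_(x in X) phi x].

Let ih (g : wLp mu2 p) k n X : mem_q g -> measurable X -> (mu1 X < +oo)%E ->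
  mu1.-integrable X (EFin \o h g k n).
Proof.
by move=> [K gK] mX Xfin; exact: (weak_integrable p1 (mh _ _ _) (hK k n gK)).
Qed.

Let subfin l X : measurable X -> X `<=` D l -> (mu1 X < +oo)%E.
Proof.
by move=> mX XD; apply: le_lt_trans (Dfin l); apply: le_measure; rewrite ?inE.
Qed.

Let exQ (g : wLp mu2 p) k : mem_q g -> exists phi, isQ g k phi.
Proof.
move=> mg; have [K gK] := mg; have K0 := bd_ge0 gK.
have /choice[F FP] l : exists f : T1 -> R, [/\ measurable_fun setT f,
    mu1.-integrable (D l) (EFin \o f) &
    forall X, measurable X -> \int[mu1]_(x in X `&` D l) h g k n x @[n --> U] -->
      \int[mu1]_(x in X `&` D l) f x].
  apply: (@weak_limit _ _ _ mu1 U UF (D l) ((1 + cI p) * (cavg p * K) `^ p^-1) (1 - p^-1)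
    (fun n X => \int[mu1]_(x in X `&` D l) h g k n x)) => //.
  - by rewrite mulr_ge0 ?powR_ge0// addr_ge0// ltW// cI_gt0.
  - by rewrite subr_gt0 invf_lt1.
  - move=> n X Y mX mY XY; rewrite setIUl Rintegral_setU//; try exact: measurableI.
    + apply: ih => //; first by apply: measurableU; exact: measurableI.
      apply: (@subfin l); first by apply: measurableU; exact: measurableI.
      by rewrite -setIUl; exact: subIsetr.
    + by apply/disj_setPS => x [[Xx _] [Yx _]]; rewrite -XY.
  - move=> n X mX.
    have mXD := measurableI _ _ mX (mD l).
    have XDfin := subfin mXD (@subIsetr _ _ _).
    apply: le_trans (le_normr_Rintegral mXD (ih k n mg mXD XDfin)) _.
    exact: (weak_Rintegral_powR p1 (mh g k n) (hK _ _ gK)).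
pose phi := glue D F.
have phiE l x : D l x -> phi x = F l x by move=> Dx; rewrite /phi (glueE _ dD Dx).
exists phi; split.
- by apply: measurable_glue => // l; have [] := FP l.
- by move=> x nO; apply: glue0 => l Dx; apply: nO; exact: DO Dx.
- move=> l; have [_ + _] := FP l; apply: eq_integrable => //.
  by move=> x /set_mem Dx /=; rewrite (phiE l).
- move=> l X mX XD; have [_ _ /(_ X mX)] := FP l; rewrite setIidl// => hF.
  rewrite (@eq_Rintegral _ _ _ _ _ (F l))// => x /set_mem Xx.
  by rewrite (phiE l)//; exact: XD.
Qed.

Let q (g : wLp mu2 p) : linf (wLp mu1 p) := fun k =>
  if pselect (exists phi, isQ g k phi) is left e then sval (cid e) else 0.

Let qP (g : wLp mu2 p) k : mem_q g -> isQ g k (q g k).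
Proof.
move=> mg; rewrite /q; case: pselect => [e|]; first exact: svalP (cid e).
by case; exact: exQ.
Qed.

Let DUfin n : (mu1 (\big[setU/set0]_(l < n) D l) < +oo)%E.
Proof.
apply: le_lt_trans (le_mu_bigsetU _ _) _ => //.
by apply: lte_sum_pinfty => l _; exact: Dfin.
Qed.

(** One sign at a time, because the limit controls integrals of [phi] and not of its absolute value.
    On [P] the integral of [phi] dominates c times the measure, its upper bound is inherited from
    the functions [h], and [powR_solve] concludes; the pieces [D l] exhaust [P]. *)
Let isQ_half (g : wLp mu2 p) k phi K c P : bd g K -> isQ g k phi -> 0 < c ->
  measurable P -> P `<=` O ->
  (forall x, P x -> c <= phi x) \/ (forall x, P x -> c <= - phi x) ->
  (mu1 P <= ((1 + cI p) `^ p * (cavg p * K) * c `^ (- p))%:E)%E.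
Proof.
move=> gK [mphi phi0 iphi lim_phi] c0 mP PO Pphi; have K0 := bd_ge0 gK.
have mg : mem_q g by exists K.
have -> : P = \bigcup_n (P `&` \big[setU/set0]_(l < n) D l).
  apply/seteqP; split => [x Px|x [n _ []//]].
  have : O x by exact: PO.
  rewrite OD => -[l _ Dx].
  by exists l.+1 => //; split => //; rewrite big_ord_recr/=; right.
have mPn n : measurable (P `&` \big[setU/set0]_(l < n) D l).
  by apply: measurableI => //; exact: measurable_bigsetU_ord.
apply: mu_bigcup_le => //.
  move=> n n' nn'; apply/subsetPset; apply: setIS.
  exact: subset_bigsetU.
move=> n; set Pn := P `&` _.
have Pnfin : (mu1 Pn < +oo)%E.
  apply: le_lt_trans (DUfin n); apply: le_measure; rewrite ?inE//.
  - exact: mPn.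
  - exact: measurable_bigsetU_ord.
  - exact: subIsetr.
have mPD l : measurable (P `&` D l) by exact: measurableI.
have dPD : disj_fam (fun l => P `&` D l).
  by move=> i j x [_ Di] [_ Dj]; exact: dD Di Dj.
have PnE : Pn = \big[setU/set0]_(l < n) (P `&` D l).
  by rewrite /Pn big_distrr.
have iPn : mu1.-integrable Pn (EFin \o phi).
  apply: integrableS (integrable_bigsetU n mD dD mphi iphi).
  - exact: measurable_bigsetU_ord.
  - exact: mPn.
  - exact: subIsetr.
have lim_n : \int[mu1]_(x in Pn) h g k i x @[i --> U] --> \int[mu1]_(x in Pn) phi x.
  rewrite (Rintegral_partition PnE mPD dPD iPn).
  rewrite (_ : (fun i => _) = (fun i => \sum_(l < n) \int[mu1]_(x in P `&` D l) h g k i x)).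
    apply: (@cvg_sum_ord _ U _ (fun l i => \int[mu1]_(x in P `&` D l) h g k i x)
      (fun l => \int[mu1]_(x in P `&` D l) phi x)) => l.
    exact: (lim_phi l _ (mPD l) (@subIsetr _ _ _)).
  apply/funext => i.
  exact: (Rintegral_partition PnE mPD dPD (ih k i mg (mPn n) Pnfin)).
have le1 : `|\int[mu1]_(x in Pn) phi x| <=
    (1 + cI p) * (cavg p * K) `^ p^-1 * fine (mu1 Pn) `^ (1 - p^-1).
  have lim_n' : `|\int[mu1]_(x in Pn) h g k i x| @[i --> U] -->
      `|\int[mu1]_(x in Pn) phi x| by exact: cvg_norm.
  rewrite -(cvg_lim _ lim_n')//; apply: limr_le.
    by apply/cvg_ex; eexists; exact: lim_n'.
  apply: nearW => i.
  apply: le_trans (le_normr_Rintegral (mPn n) (ih k i mg (mPn n) Pnfin)) _.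
  exact: (weak_Rintegral_powR p1 (mh g k i) (hK _ _ gK)).
have le2 := le_trans (le_normr_Rintegral_lb (mPn n) Pnfin iPn _) le1.
have {le2} : c * fine (mu1 Pn) <= (1 + cI p) * (cavg p * K) `^ p^-1 * fine (mu1 Pn) `^ (1 - p^-1).
  by apply: le2; case: Pphi => Pphi; [left|right] => x [Px _]; exact: Pphi.
move/(powR_solve p1 c0 (fine_ge0 (measure_ge0 _ _))).
rewrite mulr_ge0 ?powR_ge0// ?addr_ge0 ?(ltW (cI_gt0 _))// => /(_ isT).
rewrite powRM ?powR_ge0 ?addr_ge0 ?(ltW (cI_gt0 _))// -powRrM mulVf ?gt_eqF// powRr1 ?mulr_ge0 ?powR_ge0//.
by rewrite -lee_fin fineK// ge0_fin_numE.
Qed.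

Let bQ (g : wLp mu2 p) k phi K : bd g K -> isQ g k phi ->
  wb mu1 p phi (2 * ((1 + cI p) `^ p * (cavg p * K))).
Proof.
move=> gK Qphi c c0; have [mphi phi0 iphi lim_phi] := Qphi.
have mgt (u : T1 -> R) : measurable_fun setT u -> measurable [set x | c < u x].
  move=> mu_; rewrite -[X in measurable X]setTI.
  rewrite (_ : [set x | _] = u @^-1` `]c, +oo[); last first.
    by apply/seteqP; split => x /=; rewrite in_itv/= andbT.
  exact: mu_.
have m1 := mgt _ mphi.
have m2 := mgt _ (measurable_funN mphi).
apply: (@le_trans _ _ (mu1 ([set x | c < phi x] `|` [set x | c < - phi x]))).
  apply: le_measure; rewrite ?inE; [exact: measurable_gt_norm|exact: measurableU|].
  by move=> x /=; rewrite ltr_normr => /orP[]; [left|right].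
apply: le_trans (measureU2 _ m1 m2) _.
rewrite -mulrA mulrDl mul1r EFinD; apply: leeD.
- apply: (isQ_half gK Qphi c0 m1); last by left => x /ltW.
  by move=> x /=; apply: contraPP => /phi0 ->; rewrite ltNge (ltW c0).
- apply: (isQ_half gK Qphi c0 m2); last by right => x /ltW.
  by move=> x /=; apply: contraPP => /phi0 ->; rewrite oppr0 ltNge (ltW c0).
Qed.

Let isQ_uniq (g : wLp mu2 p) k phi psi : isQ g k phi -> isQ g k psi ->
  eqv (phi : wLp mu1 p) psi.
Proof.
move=> [mphi phi0 iphi lphi] [mpsi psi0 ipsi lpsi].
have mpp : measurable_fun setT (phi \- psi) by exact: measurable_funB.
split => //; apply: ae_wb_null => //.
have ae l : {ae mu1, forall x, D l x -> phi x - psi x = 0}.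
  apply: Rintegral_ae_zero => //.
    rewrite (_ : EFin \o _ = ((EFin \o phi) \- (EFin \o psi))%E)//.
    exact: integrableB.
  move=> X mX XD; rewrite RintegralB//; [|exact: integrableS (iphi l)|exact: integrableS (ipsi l)].
  by apply/eqP; rewrite subr_eq0; apply/eqP; apply: (cvg_unique _ (lphi l X mX XD) (lpsi l X mX XD)).
apply: negligibleS (negligible_bigcup ae) => x /= ne.
have [[l Dx]|nD] := pselect (exists l, D l x).
  by exists l => //= /(_ Dx).
exfalso; apply: ne; rewrite -[LHS]/(phi x - psi x) phi0 ?psi0 ?subrr//;
  by rewrite OD => -[l _ Dx]; apply: nD; exists l.
Qed.

Let hP (f : linf (wLp mu1 p)) k n j x : (j < 2 ^ n)%N -> mem_q f ->
  (mu1 (A n j) < +oo)%E -> A n j x -> 0 < fine (mu1 (A n j)) ->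
  h (J f) k n x = avg mu1 (A n j) (f k).
Proof.
move=> jn mf Afin Ax A0p; rewrite /h (stepE _ _ (dA (n := n)) Ax) jn /b.
set i := ii k n.
have mi : m i j = fine (mu1 (A n j)) by rewrite /m /i nnE.
rewrite (@avg_cst _ _ _ mu2 (B i j) (v i * avg mu1 (A n j) (f k))) ?mulKf ?gt_eqF//.
  have /andP[+ _] := sBf i j; apply: lt_le_trans.
  by rewrite mulr_gt0// mi.
by move=> y By; rewrite (JE _ By) nnE kkE.
Qed.

(* Once [n] is large, the test set [E] is a union of cells, on which [h] has
   the same integrals as [f k]. *)
Let h_integral (f : linf (wLp mu1 p)) k n E : mem_q f -> measurable E ->
  E `<=` O -> (mu1 E < +oo)%E ->
  (forall x y, O x -> O y -> key H n x = key H n y -> E x -> E y) ->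
  \int[mu1]_(x in E) h (J f) k n x = \int[mu1]_(x in E) f k x.
Proof.
move=> mf mE EO Efin sat.
have [K fK] := mf; have [mfk fkK] := fK k.
have mJf : mem_q (J f : wLp mu2 p) by exact: (morph_mem morphJ).
have EE : E = \big[setU/set0]_(j < 2 ^ n) (E `&` A n j).
  rewrite -(bigcup_mkord _ (fun j => E `&` A n j)) -setI_bigcupr setIidl// => x Ex.
  by exists (key H n x); [exact: key_lt|split => //; exact: EO].
have mEA j : measurable (E `&` A n j) by exact: measurableI.
have dEA : disj_fam (fun j => E `&` A n j).
  by move=> i j x [_ Ai] [_ Aj]; exact: dA Ai Aj.
have iE := ih k n mJf mE Efin.
have ifE := weak_integrable p1 mfk fkK mE Efin.
have IE phi : mu1.-integrable E (EFin \o phi) ->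
    \int[mu1]_(x in E) phi x = \sum_(j < 2 ^ n) \int[mu1]_(x in E `&` A n j) phi x.
  exact: (Rintegral_partition EE mEA dEA).
rewrite !IE//; apply: eq_bigr => j _.
have [[x [Ex Ax]]|ne] := pselect (exists x, (E `&` A n j) x); last first.
  rewrite (_ : E `&` A n j = set0) ?Rintegral_set0//.
  by apply/seteqP; split => // x EAx; apply: ne; exists x.
have AE : A n j `<=` E.
  move=> y [Oy ky]; apply: (sat x) => //; first by case: Ax.
  by rewrite ky; case: Ax.
rewrite (setIidr AE).
have Afin : (mu1 (A n j) < +oo)%E.
  by apply: le_lt_trans Efin; apply: le_measure; rewrite ?inE.
have [A00|Ane] := eqVneq (fine (mu1 (A n j))) 0.
  have A00' : mu1 (A n j) = 0%E by rewrite -[LHS]fineK ?ge0_fin_numE// A00.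
  by rewrite !Rintegral_null.
have Ap : 0 < fine (mu1 (A n j)) by rewrite lt_neqAle eq_sym Ane fine_ge0.
rewrite (@eq_Rintegral _ _ _ _ _ (fun=> avg mu1 (A n j) (f k))); last first.
  by move=> y /set_mem Ay; apply: hP.
by rewrite Rintegral_cst// /avg divfK.
Qed.

(** A finite intersection of generators inside [D l] is a union of cells for all large n, so there
    [h] and [f k] have the same integral, and so has the limit. [generates_integral_zero] extends
    this to all measurable subsets of [D l]. *)
Let qJ (f : linf (wLp mu1 p)) : mem_q f -> eqv (q (J f)) f.
Proof.
move=> mf; apply: eqv_linf => k.
have mJf : mem_q (J f : wLp mu2 p) by exact: (morph_mem morphJ).
have [mphi phi0 iphi lphi] := qP k mJf.
have [K fK] := mf; have [mfk fkK] := fK k.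
set phi := q (J f) k in mphi phi0 iphi lphi *.
have mpp : measurable_fun setT (phi \- f k) by exact: measurable_funB.
split => //; apply: ae_wb_null => //.
have ae0 := wb_ae_zero_off mO O2 mfk fkK.
have ifD l : mu1.-integrable (D l) (EFin \o f k) by exact: weak_integrable fkK _ _.
have ipp l : mu1.-integrable (D l) (EFin \o (phi \- f k)).
  rewrite (_ : EFin \o _ = ((EFin \o phi) \- (EFin \o f k))%E)//.
  exact: integrableB.
have ae l : {ae mu1, forall x, D l x -> phi x - f k x = 0}.
  apply: Rintegral_ae_zero => //.
  apply: (generates_integral_zero genO) => // s'.
  set E := foldr _ _ _ `&` D l.
  have mcap : measurable (foldr (fun l B => G l `&` B) O s').
    by elim: s' {E} => //= a s' IH; exact: measurableI.
  have mE : measurable E by exact: measurableI.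
  have ED : E `<=` D l by exact: subIsetr.
  rewrite RintegralB//; [|exact: integrableS (iphi l)|exact: integrableS (ifD l)].
  apply/eqP; rewrite subr_eq0; apply/eqP.
  apply: (cvg_unique _ (lphi l E mE ED)) => //.
  (* From [n0] on, the code has recorded the tests [a.*2] for all generators in [s'] and the test
     [l.*2.+1] for [D l]. *)
  pose n0 := (\max_(a <- s') a.*2.+1 + l.*2.+2)%N.
  apply: cvg_near_cst; apply: Uoo; exists n0 => // n /= n0n.
  apply: h_integral => //.
  - by move=> x /ED /DO.
  - exact: subfin mE ED.
  move=> x y Ox Oy kxy [cx Dx].
  have keyH a : (a < n)%N -> (H a (key H a) x <-> H a (key H a) y).
    by move=> an; have [] := @key_inj _ _ H a x y (key_eqW an kxy).
  split; last first.
    have := @keyH l.*2.+1; rewrite /H/= odd_double/= uphalf_double => -[|+ _]; last exact.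
    by apply: leq_trans n0n; rewrite /n0; lia.
  have sn a : a \in s' -> (a.*2 < n)%N.
    move=> as'; apply: leq_trans n0n.
    rewrite /n0 (big_rem a)//=; apply: leq_trans (leq_addr _ _).
    exact: leq_maxl.
  elim: s' sn cx {E mcap mE ED n0 n0n} => //= a s' IH sn [Gx cx]; split.
    have := @keyH a.*2; rewrite /H/= odd_double/= doubleK => -[|+ _]; last exact.
    by apply: sn; rewrite inE eqxx.
  by apply: IH => // a' as'; apply: sn; rewrite inE as' orbT.
apply: negligibleS (negligibleU (negligible_bigcup ae) ae0) => x /= ne.
have [[l Dx]|nD] := pselect (exists l, D l x).
  by left; exists l => //= /(_ Dx).
have nO : ~ O x by rewrite OD => -[l _ Dx]; apply: nD; exists l.
right => /(_ nO) f0; apply: ne; rewrite -[LHS]/(phi x - f k x) f0 phi0// subrr.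
by [].
Qed.

Let lq a (g g' : wLp mu2 p) : mem_q g -> mem_q g' ->
  eqv (q (a *: g + g')) (a *: q g + q g').
Proof.
move=> mg mg'; apply: eqv_linf => k.
have mgg : mem_q (a *: g + g') by apply: mem_qD => //; exact: mem_qZ.
apply: (isQ_uniq (qP k mgg)).
have [mphi phi0 iphi lphi] := qP k mg.
have [mphi' phi'0 iphi' lphi'] := qP k mg'.
split.
- by apply: measurable_funD => //; exact: measurable_funM.
- move=> x nO; rewrite -[LHS]/(a * q g k x + q g' k x) phi0// phi'0//.
  by rewrite mulr0 addr0.
- by move=> l; exact: (integrable_lin a (mD l) (iphi l) (iphi' l)).
- move=> l X mX XD.
  have Xfin := subfin mX XD.
  have iX := integrableS (mD l) mX XD (iphi l).
  have iX' := integrableS (mD l) mX XD (iphi' l).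
  rewrite [X in _ --> X](Rintegral_lin a mX iX iX').
  rewrite (_ : (fun n => _) = (fun n => a * \int[mu1]_(x in X) h g k n x + \int[mu1]_(x in X) h g' k n x)); last first.
    apply/funext => n; rewrite lh//.
    exact: (Rintegral_lin a mX (ih k n mg mX Xfin) (ih k n mg' mX Xfin)).
  apply: cvgD; last exact: (lphi' l X mX XD).
  by apply: cvgM; [exact: cvg_cst|exact: (lphi l X mX XD)].
Qed.

Lemma blocks_complemented : exists (j : linf (wLp mu1 p) -> wLp mu2 p)
    (q : wLp mu2 p -> linf (wLp mu1 p)),
  [/\ morph j, morph q & forall f, mem_q f -> eqv (q (j f)) f].
Proof.
exists J, q; split; [exact: morphJ| |exact: qJ].
exists (2 * ((1 + cI p) `^ p * cavg p)); split.
- by rewrite !mulr_ge0 ?powR_ge0.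
- move=> g K gK; apply: bd_linf => k.
  have Q : isQ g k (q g k) by apply: qP; exists K.
  split; first by case: Q.
  by have := bQ gK Q; rewrite !mulrA.
- by move=> a g g' mg mg'; exact: lq.
Qed.

End blocks.

Lemma linf_complemented : exists (j : linf (wLp mu1 p) -> wLp mu2 p)
    (q : wLp mu2 p -> linf (wLp mu1 p)),
  [/\ morph j, morph q & forall f, mem_q f -> eqv (q (j f)) f].
Proof.
have [s [B [s0 mB dB sB sep]]] := rich2 m_ge0 m0 dl_gt0.
have [U [UF Uoo]] := ultraFilterLemma eventually_filter.
exact: (@blocks_complemented s B s0 mB dB sB sep U UF Uoo).
Qed.

End embedding.

Lemma essentially_separable_absorb (R : realType) (p : R) (p1 : 1 < p)
    d1 (T1 : measurableType d1) (mu1 : {measure set T1 -> \bar R})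
    d2 (T2 : measurableType d2) (mu2 : {measure set T2 -> \bar R}) O :
  essentially_separable mu1 O -> rich mu2 ->
  qiso (prodq (wLp mu1 p) (wLp mu2 p)) (wLp mu2 p).
Proof.
move=> [mO [G genO] [F OF mF] O2] r2.
have mFn n : measurable (F n) by have [] := mF n.
have mD n : measurable (seqDU F n).
  by apply: measurableD => //; exact: bigsetU_measurable.
have Dfin n : (mu1 (seqDU F n) < +oo)%E.
  have [_] := mF n; apply: le_lt_trans; apply: le_measure; rewrite ?inE//.
  exact: subset_seqDU.
have dD : disj_fam (seqDU F).
  by move=> i j x Di Dj; apply: (@trivIset_seqDU _ F i j I I); exists x.
have OD : O = \bigcup_n seqDU F n by rewrite -seqDU_bigcup_eq.
have [j [q [mj mq qj]]] := linf_complemented p1 mO genO mD Dfin dD OD O2 r2.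
apply: qiso_absorb mj mq qj; first exact: powR_ge0.
by move=> a; exact: powR_ge0.
Qed.

(** * Spaces with room for separated copies *)

Section nonatomic.
Context {R : realType} {d : measure_display} {T : measurableType d}.
Variable mu : {measure set T -> \bar R}.
Hypothesis na : purely_non_atomic mu.

Lemma fin_subset (A E : set T) : measurable A -> measurable E -> A `<=` E ->
  (mu E < +oo)%E -> (mu A < +oo)%E.
Proof.
by move=> mA mE AE; apply: le_lt_trans; apply: le_measure; rewrite ?inE.
Qed.

Lemma fine_muD (A E : set T) : measurable A -> measurable E -> A `<=` E ->
  (mu E < +oo)%E -> fine (mu (E `\` A)) = fine (mu E) - fine (mu A).
Proof.
move=> mA mE AE Efin; have Afin := fin_subset mA mE AE Efin.
rewrite measureD// setIidr// fineB// ge0_fin_numE//.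
Qed.

Lemma fine_muU (A B : set T) : measurable A -> measurable B ->
  A `&` B = set0 -> (mu A < +oo)%E -> (mu B < +oo)%E ->
  fine (mu (A `|` B)) = fine (mu A) + fine (mu B).
Proof.
by move=> mA mB AB Af Bf; rewrite measureU// fineD// ge0_fin_numE.
Qed.

Lemma fine_mu_le (A B : set T) : measurable A -> measurable B -> A `<=` B ->
  (mu B < +oo)%E -> fine (mu A) <= fine (mu B).
Proof.
move=> mA mB AB Bf; rewrite fine_le// ?ge0_fin_numE//; first exact: fin_subset Bf.
by apply: le_measure; rewrite ?inE.
Qed.

Lemma nonatomic_split (E : set T) : measurable E -> (mu E < +oo)%E ->
  0 < fine (mu E) -> exists A, [/\ measurable A, A `<=` E,
    0 < fine (mu A) & fine (mu A) <= fine (mu E) / 2].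
Proof.
move=> mE Efin E0.
have muE0 : (0 < mu E)%E by rewrite -[ltRHS]fineK ?ge0_fin_numE// lte_fin.
have [A [mA AE A0 EA0]] : exists A, [/\ measurable A, A `<=` E,
    mu A <> 0%E & mu (E `\` A) <> 0%E].
  apply: contrapT => h; have : ~ is_atom mu E by exact: na.
  apply; split => // s ms sE.
  apply: contrapT => /not_orP[s0 Es0]; apply: h; by exists s.
have pos B : measurable B -> B `<=` E -> mu B <> 0%E -> 0 < fine (mu B).
  move=> mB BE B0; rewrite lt_neqAle fine_ge0// andbT eq_sym; apply/eqP => h.
  by apply: B0; rewrite -[LHS]fineK ?h// ge0_fin_numE//; exact: fin_subset Efin.
have mEA := measurableD mE mA.
have := fine_muD mA mE AE Efin.
have [h|h] := leP (fine (mu A)) (fine (mu E) / 2).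
  by move=> _; exists A; split => //; exact: pos.
move=> e; exists (E `\` A); split => //; last by rewrite e; lra.
by apply: pos => //; exact: subDsetl.
Qed.

Lemma nonatomic_small (E : set T) e : measurable E -> (mu E < +oo)%E ->
  0 < fine (mu E) -> 0 < e -> exists A, [/\ measurable A, A `<=` E,
    0 < fine (mu A) & fine (mu A) <= e].
Proof.
move=> mE Efin E0 e0.
have H n : exists A, [/\ measurable A, A `<=` E,
    0 < fine (mu A) & fine (mu A) <= fine (mu E) / 2 ^+ n].
  elim: n => [|n [A [mA AE A0 An]]].
    by exists E; split => //; rewrite expr0 divr1.
  have [B [mB BA B0 BAle]] := nonatomic_split mA (fin_subset mA mE AE Efin) A0.
  exists B; split => //; first exact: subset_trans AE.
  apply: le_trans BAle _; rewrite exprSr invfM mulrA.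
  by rewrite ler_pM2r ?invr_gt0.
have [n hn] := exists_pow2_ge (fine (mu E) / e).
have [A [mA AE A0 An]] := H n; exists A; split => //.
apply: le_trans An _.
by rewrite ler_pdivrMr ?exprn_gt0// mulrC -ler_pdivrMr.
Qed.

(** Sierpinski's theorem by greedy exhaustion. Each stage adds an admissible set of at least half
    the largest possible measure (the supremum need not be attained). If the union fell short of t,
    a small set in its complement would be admissible at every stage, so every stage would add at
    least half its measure. *)
Theorem nonatomic_intermediate (E : set T) t : measurable E ->
  (mu E < +oo)%E -> 0 <= t <= fine (mu E) ->
  exists A, [/\ measurable A, A `<=` E & mu A = t%:E].
Proof.
move=> mE Efin /andP[t0 tE].
pose adm B C := [/\ measurable C, C `<=` E `\` B & fine (mu B) + fine (mu C) <= t].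
have /choice[C hC] (B : set T) : exists C, measurable B -> B `<=` E ->
    fine (mu B) <= t ->
    adm B C /\ forall C', adm B C' -> fine (mu C') <= 2 * fine (mu C).
  have [[mB BE Bt]|h] := pselect [/\ measurable B, B `<=` E & fine (mu B) <= t]; last first.
    by exists set0 => ? ? ?; case: h.
  have adm0 : adm B set0 by split => //; rewrite measure0 addr0.
  pose X := [set x | exists2 C, adm B C & x = fine (mu C)].
  have X0 : X 0 by exists set0 => //; rewrite measure0.
  have Xs : has_sup X.
    split; first by exists 0.
    by exists t => x [C [_ _ h] ->]; apply: le_trans h; rewrite lerDr fine_ge0.
  have [s0|s0] := leP (sup X) 0.
    exists set0 => _ _ _; split => // C' aC'; rewrite measure0 mulr0.
    by apply: le_trans s0; apply: sup_upper_bound => //; exists C'.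
  have s2 : 0 < sup X / 2 by rewrite divr_gt0.
  have [x [C aC ->] Cx] := sup_adherent s2 Xs.
  exists C => _ _ _; split => // C' aC'.
  have : fine (mu C') <= sup X by apply: sup_upper_bound => //; exists C'.
  by lra.
pose B := fix B n := if n is m.+1 then B m `|` C (B m) else set0.
have HB n : [/\ measurable (B n), B n `<=` E & fine (mu (B n)) <= t].
  elim: n => [|n [mB BE Bt]] /=; first by split => //; rewrite measure0.
  have [[mC CE Ct] _] := hC _ mB BE Bt.
  have CE' : C (B n) `<=` E by move=> x /CE[].
  split; [exact: measurableU|by move=> x [/BE|/CE']|].
  rewrite fine_muU//; [|exact: fin_subset Efin|exact: fin_subset Efin].
  by apply/seteqP; split => // x [Bx /CE[]].
have mB n : measurable (B n) by case: (HB n).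
have BE n : B n `<=` E by case: (HB n).
have Bt n : fine (mu (B n)) <= t by case: (HB n).
have Bfin n : (mu (B n) < +oo)%E by exact: fin_subset Efin.
have ndB : nondecreasing_seq B.
  by apply/nondecreasing_seqP => n; apply/subsetPset => x Bx; left.
pose A := \bigcup_n B n.
have mA : measurable A by exact: bigcup_measurable.
have AE : A `<=` E by move=> x [n _ /BE].
have Afin : (mu A < +oo)%E by exact: fin_subset Efin.
have At : fine (mu A) <= t.
  rewrite -lee_fin fineK ?ge0_fin_numE//; apply: mu_bigcup_le => // n.
  by rewrite -[X in (X <= _)%E]fineK ?ge0_fin_numE// lee_fin.
exists A; split => //; rewrite -[LHS]fineK ?ge0_fin_numE//; congr EFin.
apply/eqP; rewrite eq_le At/= leNgt; apply/negP => ltA.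
have EA0 : 0 < fine (mu (E `\` A)) by rewrite fine_muD//; lra.
have mEA := measurableD mE mA.
have EAfin : (mu (E `\` A) < +oo)%E by apply: fin_subset Efin => //; exact: subDsetl.
have [C' [mC' C'E C'0 C't]] : exists C', [/\ measurable C', C' `<=` E `\` A,
    0 < fine (mu C') & fine (mu C') <= t - fine (mu A)].
  by apply: nonatomic_small => //; rewrite subr_gt0.
have grow n : n%:R * (fine (mu C') / 2) <= fine (mu (B n)).
  elim: n => [|n IH]; first by rewrite mul0r fine_ge0.
  have [[mC CE Ct] best] := hC _ (mB n) (BE n) (Bt n).
  have CE' : C (B n) `<=` E by move=> x /CE[].
  rewrite /= fine_muU//; last 2 first.
  - by apply/seteqP; split => // x [Bx /CE[]].
  - exact: fin_subset Efin.
  have : fine (mu C') <= 2 * fine (mu (C (B n))).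
    apply: best; split => //.
      by move=> x /C'E[Ex nA]; split => // Bx; apply: nA; exists n.
    have : fine (mu (B n)) <= fine (mu A).
      by apply: fine_mu_le => // x Bx; exists n.
    lra.
  by move=> h; rewrite -natr1 mulrDl mul1r; lra.
have := archi_boundP (divr_ge0 t0 (ltW (divr_gt0 C'0 (ltr0n R 2)))).
rewrite ltr_pdivrMr ?divr_gt0// => h.
by have := lt_le_trans h (grow _); rewrite ltNge Bt.
Qed.

Lemma nonatomic_disjoint_seq (E : set T) (x : nat -> R) : measurable E ->
  (mu E < +oo)%E -> (forall k, 0 <= x k) ->
  (forall n, \sum_(k < n) x k <= fine (mu E)) ->
  exists D : nat -> set T, [/\ forall k, measurable (D k), disj_fam D,
    forall k, D k `<=` E & forall k, mu (D k) = (x k)%:E].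
Proof.
move=> mE Efin x0 xE.
have /choice[pick hp] (Uv : set T * R) : exists A, measurable Uv.1 -> Uv.1 `<=` E ->
    0 <= Uv.2 <= fine (mu E) - fine (mu Uv.1) ->
    [/\ measurable A, A `<=` E `\` Uv.1 & mu A = Uv.2%:E].
  case: Uv => U v /=.
  have [[mU UE vle]|h] := pselect [/\ measurable U, U `<=` E & 0 <= v <= fine (mu E) - fine (mu U)]; last first.
    by exists set0 => ? ? ?; case: h.
  have := @nonatomic_intermediate (E `\` U) v (measurableD mE mU).
  rewrite fine_muD// => /(_ (fin_subset (measurableD mE mU) mE (@subDsetl _ _ _) Efin) vle).
  by move=> [A hA]; exists A.
pose U := fix U n := if n is m.+1 then U m `|` pick (U m, x m) else set0.
pose D n := pick (U n, x n).
have HU n : [/\ measurable (U n), U n `<=` E & fine (mu (U n)) = \sum_(k < n) x k].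
  elim: n => [|n [mU UE Ux]] /=; first by split => //; rewrite measure0 big_ord0.
  have [|mA AE Ax] := hp (U n, x n) mU UE.
    by rewrite x0/= Ux; have := xE n.+1; rewrite big_ord_recr/=; lra.
  have AE' : pick (U n, x n) `<=` E by move=> z /AE[].
  split; [exact: measurableU|by move=> z [/UE|/AE']|].
  rewrite fine_muU//; last 3 first.
  - by apply/seteqP; split => // z [Bx /AE[]].
  - exact: fin_subset Efin.
  - exact: fin_subset Efin.
  by rewrite big_ord_recr/= Ux Ax.
have HD n : [/\ measurable (D n), D n `<=` E `\` U n & mu (D n) = (x n)%:E].
  have [mU UE Ux] := HU n; apply: (hp (U n, x n)) => //=.
  by rewrite x0/= Ux; have := xE n.+1; rewrite big_ord_recr/=; lra.
have DU i j z : (i < j)%N -> D i z -> U j z.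
  elim: j => // j IH; rewrite ltnS leq_eqVlt => /orP[/eqP <- Di|ij Di]; first by right.
  by left; exact: IH.
exists D; split.
- by move=> k; have [] := HD k.
- move=> i j z Di Dj; have [ij|ij|//] := ltngtP i j.
    by have [_ /(_ _ Dj)[_ []]] := HD j; exact: DU Di.
  by have [_ /(_ _ Di)[_ []]] := HD i; exact: DU Dj.
- by move=> k z; have [_ + _] := HD k => /[apply] -[].
- by move=> k; have [] := HD k.
Qed.

End nonatomic.

Section rich.
Context {R : realType}.

(** Partial products of factors [e k <= 1], each chosen below the finitely many constraints of stage
    k. *)
Lemma rapidly_decreasing (g : nat -> nat -> R) (h : nat -> R) :
  (forall i l, 0 < g i l) -> (forall l, 0 < h l) ->
  exists s : nat -> R, [/\ forall l, 0 < s l, forall l, s l <= h l &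
    forall i l, (i < l)%N -> s l <= g i l * s i].
Proof.
move=> g0 h0.
pose e k := Num.min (Num.min 1 (h k)) (\big[Num.min/1]_(i < k) g i k).
have e0 k : 0 < e k.
  by rewrite /e !lt_min ltr01 h0/=; apply: lt_bigmin.
have e1 k : e k <= 1 by rewrite /e !ge_min lexx.
have eh k : e k <= h k by rewrite /e !ge_min lexx orbT.
have eg i k : (i < k)%N -> e k <= g i k.
  move=> ik; rewrite /e ge_min; apply/orP; right.
  exact: (@bigmin_le_cond _ _ 'I_k 1 (Ordinal ik) xpredT (fun j => g j k) isT).
pose s l := \prod_(k < l.+1) e k.
have p0 n : 0 < \prod_(k < n) e k by exact: prodr_gt0.

have pS i n : (i <= n)%N -> \prod_(k < n) e k <= \prod_(k < i) e k.
  elim: n => [|n IH]; first by rewrite leqn0 => /eqP ->.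
  rewrite leq_eqVlt => /orP[/eqP -> //|]; rewrite ltnS => i_n; rewrite big_ord_recr/=.
  by apply: le_trans (IH i_n); rewrite ler_piMr ?e1 ?(ltW (p0 _)).
have p1 n : \prod_(k < n) e k <= 1 by have := pS 0%N n isT; rewrite big_ord0.
exists s; split => [l|l|i l il]; first exact: p0.
  by rewrite /s big_ord_recr/=; apply: le_trans (eh l); rewrite ler_piMl ?p1 ?(ltW (e0 _)).
rewrite /s big_ord_recr/= mulrC; by apply: ler_pM; [exact: ltW (e0 _)|exact: ltW (p0 _)|exact: eg|exact: pS].
Qed.

(** Copies are shrunk. The bound [h] gives the set with code k at most the fraction 2^-(k+1) of [E],
    so all fit into [E], and a later copy is negligible against any earlier one. *)
Lemma rich_nonatomic d (T : measurableType d) (mu : {measure set T -> \bar R}) :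
  purely_non_atomic mu -> nontrivial_ms mu -> rich mu.
Proof.
move=> na [E [mE E0 Efin]] N m dl m0 mN dl0.
have muE : 0 < fine (mu E) by rewrite -lte_fin fineK// ge0_fin_numE.
pose W l := \sum_(j < N l) m l j.
have W0 l : 0 <= W l by exact: sumr_ge0.
pose g i l : R := 2^-1 ^+ l.+1 * dl i / (W l + 1).
pose h l : R := \big[Num.min/1]_(j < N l)
  (2^-1 ^+ (pickle (l, nat_of_ord j)).+1 * fine (mu E) / (m l j + 1)).
have [i l|l|s [s0 sh sg]] := @rapidly_decreasing g h.
- by rewrite divr_gt0 ?mulr_gt0 ?exprn_gt0// ltr_wpDl.
- by apply: lt_bigmin => // j _; rewrite divr_gt0 ?mulr_gt0 ?exprn_gt0// ltr_wpDl.
pose x k : R := if @pickle_inv (nat * nat)%type k is Some lj then s lj.1 * m lj.1 lj.2 else 0.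
have x0 k : 0 <= x k.
  by rewrite /x; case: pickle_inv => // lj; rewrite mulr_ge0// ltW.
have xE k : x k <= 2^-1 ^+ k.+1 * fine (mu E).
  rewrite /x; case E1 : (pickle_inv k) => [[l j]|]; last first.
    by rewrite mulr_ge0 ?exprn_ge0// ltW.
  have kE : k = pickle (l, j).
    by have := @pickle_invK (nat * nat)%type k; rewrite E1/=.
  have [jN|/mN ->] := ltnP j (N l); last first.
    by rewrite mulr0 mulr_ge0 ?exprn_ge0// ltW.
  have : s l <= 2^-1 ^+ (pickle (l, j)).+1 * fine (mu E) / (m l j + 1).
    apply: le_trans (sh l) _.
    exact: (@bigmin_le_cond _ _ 'I_(N l) 1 (Ordinal jN) xpredT
      (fun j => 2^-1 ^+ (pickle (l, nat_of_ord j)).+1 * fine (mu E) / (m l j + 1)) isT).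
  rewrite ler_pdivlMr ?ltr_wpDl// -kE; apply: le_trans.
  by rewrite /= ler_pM2l// lerDl.
have [D [mD dD DE DX]] : exists D : nat -> set T, [/\ forall k, measurable (D k), disj_fam D,
    forall k, D k `<=` E & forall k, mu (D k) = (x k)%:E].
  apply: nonatomic_disjoint_seq => // n.
  apply: (@le_trans _ _ (\sum_(k < n) 2^-1 ^+ k.+1 * fine (mu E))).
    by apply: ler_sum => k _; exact: xE.
  by rewrite -mulr_suml -[leRHS]mul1r ler_wpM2r ?sum_half_pow// ltW.
exists s, (fun i j => D (pickle (i, j))); split => //.
- move=> i j i' j' z Di Dj; have := dD _ _ _ Di Dj.
  by move/(pcan_inj pickleK) => -[-> ->].
- move=> i j; rewrite DX /x pickleK_inv/= !lee_fin lexx/=.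
  by rewrite -mulrA mulr_natl mulr2n lerDl mulr_ge0// ltW.
- move=> i l il; right.
  have := sg i l il; rewrite /g mulrAC ler_pdivlMr ?ltr_wpDl//.
  rewrite -mulrA (mulrC (dl i)); apply: le_trans.
  by rewrite ler_pM2l// lerDl.
Qed.

(** Copies are blown up instead: with scales [(t l)^-1] every positive mass becomes at least 1, so
    passing to the next larger integer costs at most a factor 2, and an earlier copy is negligible
    against any later one. *)
Lemma rich_counting : rich (@counting nat R).
Proof.
move=> N m dl m0 mN dl0.
pose W l := \sum_(j < N l) m l j.
have W0 l : 0 <= W l by exact: sumr_ge0.
pose g i l : R := 2^-1 ^+ i.+1 * dl l / (W i + 1).
pose h l : R := \big[Num.min/1]_(j < N l | 0 < m l j) m l j.
have [i l|l|t [t0 th tg]] := @rapidly_decreasing g h.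
- by rewrite divr_gt0 ?mulr_gt0 ?exprn_gt0// ltr_wpDl.
- by apply: lt_bigmin.
pose s l := (t l)^-1.
have s0 l : 0 < s l by rewrite invr_gt0.
pose cnt l j : nat := if 0 < m l j then (Num.truncn (s l * m l j)).+1 else 0%N.
pose B l j := (fun k : nat => pickle (l, (j, k))) @` `I_(cnt l j).
have countB l j : @counting nat R (B l j) = ((cnt l j)%:R)%:E.
  have cB : (B l j #= `I_(cnt l j))%card.
    by apply: inj_card_eq => k k' _ _ /(pcan_inj pickleK) [].
  have fB : finite_set (B l j) by exists (cnt l j).
  by rewrite /counting asboolT// (card_fset_set cB).
exists s, B; split => //.
- move=> i j i' j' z [k _ <-] [k' _]; move/(pcan_inj pickleK) => [-> -> _] //.
- move=> l j; rewrite countB !lee_fin /cnt.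
  have [mp|mp] := ltP 0 (m l j); last first.
    have -> : m l j = 0 by apply/eqP; rewrite eq_le mp m0.
    by rewrite !mulr0 lexx.
  have jN : (j < N l)%N by rewrite ltnNge; apply/negP => /mN e; rewrite e ltxx in mp.
  have hm : t l <= m l j.
    apply: le_trans (th l) _.
    exact: (@bigmin_le_cond _ _ 'I_(N l) 1 (Ordinal jN) (fun j => 0 < m l j) (fun j => m l j) mp).
  have sm : 1 <= s l * m l j by rewrite /s mulrC ler_pdivlMr// mul1r.
  have sm0 : 0 <= s l * m l j by rewrite mulr_ge0// ltW.
  have /andP[h1 h2] := truncn_itv sm0.
  apply/andP; split; first exact: ltW.
  by rewrite -mulrA -natr1; lra.
- move=> i l il; left.
  have := tg i l il; rewrite /g mulrAC ler_pdivlMr ?ltr_wpDl// => h1.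
  rewrite -/(W i) /s.
  rewrite ler_pdivrMl// mulrCA.
  have -> : 2^-1 ^+ i.+1 * (t i * ((t l)^-1 * dl l)) = 2^-1 ^+ i.+1 * dl l * t i / t l.
    by ring.
  rewrite ler_pdivlMr//; apply: le_trans h1; rewrite mulrC ler_pM2l//.
  by rewrite lerDl.
Qed.

End rich.

Section counting_nat.
Context {R : realType}.

Lemma counting_set1 (n : nat) : @counting nat R [set n] = 1%E.
Proof.
by rewrite /counting/= asboolT; [rewrite fset_set1 finmap.cardfs1|exact: finite_set1].
Qed.

Lemma bigcup_set1_smallest (S : set (set nat)) (A : set nat) :
  (forall n, S [set n]) -> <<s S >> (\bigcup_(i in A) [set i]).
Proof.
move=> hS; pose F n : set nat := if n \in A then [set n] else set0.
have -> : \bigcup_(i in A) [set i] = \bigcup_n F n.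
  apply/seteqP; split => [x [i Ai ->]|x [i _]]; first by exists i => //; rewrite /F mem_set.
  by rewrite /F; case: ifP => //; rewrite inE => Ai ->; exists i.
apply: sigma_algebra_bigcup => n; rewrite /F; case: ifP => _; last exact: sigma_algebra0.
exact: sub_sigma_algebra.
Qed.

Lemma bigcup_set1_id (A : set nat) : A = \bigcup_(i in A) [set i].
Proof. by apply/seteqP; split => [x Ax|x [i Ai ->]//]; exists x. Qed.

Lemma counting_separable : essentially_separable (@counting nat R) setT.
Proof.
split => //.
- exists (fun n : nat => [set n]); split => //.
  apply/seteqP; split => [A _|A _ //]; rewrite (bigcup_set1_id A).
  by apply: bigcup_set1_smallest => n; left; exists n.
- exists (fun n : nat => [set n]).
    by apply/seteqP; split => // x _; exists x.
  by move=> n; split => //; rewrite counting_set1 ltry.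
- move=> s _ s0; left; have -> : s = set0 by apply/seteqP; split => // x /s0 /=; apply.
  by rewrite measure0.
Qed.

Lemma counting_purely_atomic : purely_atomic (@counting nat R).
Proof.
split; first by move=> A [].
apply/seteqP; split => [A _|A _ //]; rewrite (bigcup_set1_id A).
apply: bigcup_set1_smallest => n; left; split => //; first by rewrite counting_set1 lte01.
move=> s _ sn; have [sn'|sn'] := pselect (s n); [right|left].
  by have -> : [set n] `\` s = set0; [apply/seteqP; split => // x [->]|rewrite measure0].
by have -> : s = set0; [apply/seteqP; split => // x sx; case: sn'; rewrite -(sn _ sx)|rewrite measure0].
Qed.

Lemma counting_nontrivial : nontrivial_ms (@counting nat R).
Proof. by exists [set 0%N]; rewrite counting_set1 lte_fin ltr01 ltry. Qed.

End counting_nat.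

Theorem essentially_separable_isomorphic {R : realType} {d} {T : measurableType d}
  (mu : {measure set T -> \bar R}) (p : R) (O : set T) :
  purely_non_atomic mu -> nontrivial_ms mu -> 1 < p ->
  essentially_separable mu O -> weakLp_isomorphic mu (@counting nat R) p.
Proof.
move=> na nt p1 sep; apply: weakLp_isomorphic_qiso => //.
apply: qiso_mutual.
- exact: essentially_separable_absorb sep (rich_counting (R:=R)).
- exact: essentially_separable_absorb counting_separable (rich_nonatomic na nt).
Qed.

(** * Embeddings into atomic spaces *)

Section embedding.
Context {R : realType} {d : measure_display} {T : measurableType d}
  {d' : measure_display} {T' : measurableType d'}.
Variables (mu : {measure set T -> \bar R}) (nu : {measure set T' -> \bar R}).
Variables (p : R) (J : (T -> R) -> (T' -> R)).
Hypotheses (p1 : 1 < p) (emb : weakLp_embedding mu nu p J).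

Lemma embedding_measurable f : weakLp mu p f -> measurable_fun setT (J f).
Proof. by case: emb => h _ _ _ /h[]. Qed.

Lemma embedding_wb : exists2 C : R, 0 < C & forall f K, weakLp mu p f -> 0 <= K ->
  (wb mu p f K -> wb nu p (J f) (C * K)) /\ (wb nu p (J f) K -> wb mu p f (C * K)).
Proof.
case: emb => _ _ _ [C [C0 hC]]; exists (C `^ p); first exact: powR_gt0.
have p0 : p != 0 by rewrite gt_eqF// (lt_trans _ p1).
have e K : 0 <= K -> C `^ p * K = (C * K `^ p^-1) `^ p.
  by move=> K0; rewrite powRM ?powR_ge0 ?(ltW C0)// -powRrM mulVf// powRr1.
move=> f K fL K0; have [h1 h2] := hC _ fL; rewrite e//.
have CK : 0 <= C * K `^ p^-1 by rewrite mulr_ge0 ?powR_ge0 ?ltW.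
split => /(wb_weak_norm p1 K0) h; apply: weak_norm_wb => //.
  by apply: le_trans h1 _; rewrite EFinM lee_pmul2l.
by apply: le_trans h2 _; rewrite EFinM lee_pmul2l.
Qed.

Lemma ae_eq_fun_trans (f g h : T' -> R) :
  ae_eq_fun nu f g -> ae_eq_fun nu g h -> ae_eq_fun nu f h.
Proof.
move=> [A [mA A0 fg]] [B [mB B0 gh]]; exists (A `|` B); split.
- exact: measurableU.
- by rewrite measureU0.
- move=> x /= fh; have [e|e] := pselect (f x = g x); last by left; exact: fg.
  by right; apply: gh => /= e'; apply: fh; rewrite e.
Qed.

Lemma weakLpD f g a : weakLp mu p f -> weakLp mu p g -> weakLp mu p (fun t => a * f t + g t).
Proof.
move=> /(weakLp_wb mu p1)[mf [K K0 fK]] /(weakLp_wb mu p1)[mg [L L0 gL]].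
have mZ : measurable_fun setT (fun t => a * f t) by exact: measurable_funM.
apply/(weakLp_wb mu p1); split; first exact: measurable_funD.
exists (2 `^ p * (`|a| `^ p * K + L)).
  by rewrite mulr_ge0 ?addr_ge0 ?mulr_ge0 ?powR_ge0.
by apply: wbD => //; exact: wbZ.
Qed.

Lemma weakLp0 : weakLp mu p (fun=> 0).
Proof.
apply/(weakLp_wb mu p1); split; first exact: measurable_cst.
by exists 0 => //; exact: wb0.
Qed.

Lemma weakLp_sum (h : nat -> T -> R) (a : nat -> R) n :
  (forall k, weakLp mu p (h k)) -> weakLp mu p (fun t => \sum_(k < n) a k * h k t).
Proof.
move=> hL; elim: n => [|n IH].
  by under eq_fun do rewrite big_ord0; exact: weakLp0.
rewrite (_ : (fun t => _) = (fun t => a n * h n t + \sum_(k < n) a k * h k t)).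
  exact: weakLpD.
by apply/funext => t; rewrite big_ord_recr addrC.
Qed.

Lemma embedding_sum (h : nat -> T -> R) (a : nat -> R) n :
  (forall k, weakLp mu p (h k)) ->
  ae_eq_fun nu (J (fun t => \sum_(k < n) a k * h k t))
    (fun t => \sum_(k < n) a k * J (h k) t).
Proof.
move=> hL; case: (emb) => _ _ Jlin _; elim: n => [|n IH].
  (* Linearity with coefficient -1 gives J 0 = - J 0 + J 0 almost everywhere, so J 0 is a null
     function. *)
  have [N [mN N0 hN]] := Jlin (-1) _ _ weakLp0 weakLp0.
  exists N; split => // t /=; rewrite !big_ord0 => ne; apply: hN => /= e; apply: ne.
  under eq_fun do rewrite big_ord0.
  rewrite (_ : -1 \*: (fun=> 0) \+ (fun=> 0) = (fun=> 0)) in e; last first.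
    by apply/funext => z /=; rewrite scaler0 addr0.
  by rewrite e scaleN1r addNr.
apply: (ae_eq_fun_trans (g := fun t => a n * J (h n) t + J (fun t => \sum_(k < n) a k * h k t) t)).
  have := Jlin (a n) _ _ (hL n) (weakLp_sum a n hL).
  rewrite (_ : (a n \*: h n \+ _) = fun t => \sum_(k < n.+1) a k * h k t)//.
  by apply/funext => t /=; rewrite big_ord_recr addrC.
case: IH => N [mN N0 hN]; exists N; split => // t /= ne; apply: hN => /= e; apply: ne.
by rewrite e big_ord_recr/= addrC.
Qed.

Lemma measure_le_ae (A B N : set T') : measurable A -> measurable B -> measurable N ->
  nu N = 0%E -> A `<=` B `|` N -> (nu A <= nu B)%E.
Proof.
move=> mA mB mN N0 AB; rewrite -(measureU0 mB mN N0).
by apply: le_measure; rewrite ?inE//; exact: measurableU.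
Qed.

End embedding.

Section atoms.
Context {R : realType} {d : measure_display} {T : measurableType d}.
Variable nu : {measure set T -> \bar R}.
Hypothesis pa : purely_atomic nu.

(** If every atom meets [Y] in a null set, the sets that are null or conull in [Y] form a
    sigma-algebra containing the atoms and the null sets, hence all measurable sets. Then [Y] is
    itself an atom, which meets [Y]. *)
Lemma atom_meets Y : measurable Y -> nu Y <> 0%E ->
  exists2 g, is_atom nu g & nu (g `&` Y) <> 0%E.
Proof.
move=> mY Y0; apply: contrapT => h.
pose DD := [set A | measurable A /\ (nu (A `&` Y) = 0%E \/ nu (Y `\` A) = 0%E)].
have sub0 A B : measurable A -> measurable B -> A `<=` B -> nu B = 0%E -> nu A = 0%E.
  move=> mA mB AB B0; apply/eqP; rewrite eq_le measure_ge0 andbT -B0.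
  by apply: le_measure; rewrite ?inE.
have sDD : sigma_algebra setT DD.
  split.
  - by split => //; left; rewrite set0I.
  - move=> A [mA hA]; rewrite setTD; split; first exact: measurableC.
    by case: hA => hA; [right|left]; rewrite ?setDE ?setCK setIC.
  - move=> F hF; have mF i : measurable (F i) by case: (hF i).
    split; first exact: bigcup_measurable.
    have [[i hi]|none] := pselect (exists i, nu (Y `\` F i) = 0%E).
      right; apply: sub0 hi; [|exact: measurableD|].
        by apply: measurableD => //; exact: bigcup_measurable.
      by move=> x [Yx nF]; split => // Fx; apply: nF; exists i.
    left; rewrite setI_bigcupl.
    have mI i : measurable (F i `&` Y) by exact: measurableI.
    apply/negligibleP; first exact: bigcup_measurable.
    apply: negligible_bigcup => i; apply/negligibleP => //.
    by case: (hF i) => _ [//|hi]; case: none; exists i.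
have := smallest_sub sDD; rewrite /=.
have [_ e] := pa.
move=> /(_ (is_atom nu `|` null_sets_in nu setT)) hsub.
have all s : measurable s -> DD s.
  move=> ms; have : trace_sigma setT s by split.
  rewrite e; apply: hsub => A [[mA A0 hA]|[mA _ A0]].
    split => //; left; apply: contrapT => AY; apply: h; by exists A.
  by split => //; left; apply: sub0 A0 => //; exact: measurableI.
apply: h; exists Y; last by rewrite setIid.
split => //; first by rewrite lt0e measure_ge0 andbT; apply/eqP.
move=> s ms sY; have [_] := all _ ms.
by rewrite setIidl.
Qed.

Definition atom_or_empty (g : set T) := is_atom nu g \/ g = set0.

Lemma atom_or_empty_measurable g : atom_or_empty g -> measurable g.
Proof. by move=> [[]|->]. Qed.

Lemma atoms_cover Y : measurable Y -> (nu Y < +oo)%E ->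
  exists g : nat -> set T, (forall n, atom_or_empty (g n)) /\
    nu (Y `\` \bigcup_n g n) = 0%E.
Proof.
move=> mY Yfin.
pose C Z := exists g : nat -> set T, (forall n, atom_or_empty (g n)) /\ Z = \bigcup_n g n.
have mC Z : C Z -> measurable Z.
  by move=> [g [hg ->]]; apply: bigcup_measurable => n _; exact: atom_or_empty_measurable.
have Cbig (Z : nat -> set T) : (forall n, C (Z n)) -> C (\bigcup_n Z n).
  move=> /choice[g hg].
  exists (fun k => if @unpickle (nat * nat)%type k is Some ij then g ij.1 ij.2 else set0).
  split=> [k|]; first by case: unpickle => [ij|]; [case: (hg ij.1) => + _; apply|right].
  apply/seteqP; split => t.
    move=> [i _]; case: (hg i) => _ -> [j _ gt]; exists (pickle (i, j)) => //.
    by rewrite pickleK.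
  move=> [k _]; case: unpickle => [ij gt|//]; exists ij.1 => //.
  by case: (hg ij.1) => _ ->; exists ij.2.
have fI Z : C Z -> (nu (Y `&` Z) < +oo)%E.
  by move=> CZ; apply: fin_subset Yfin => //; apply: measurableI => //; exact: mC.
pose X := [set x | exists2 Z, C Z & x = fine (nu (Y `&` Z))].
have C0 : C set0.
  by exists (fun=> set0); split; [by right|rewrite bigcup0].
have Xs : has_sup X.
  split; first by exists (fine (nu (Y `&` set0))), set0.
  exists (fine (nu Y)) => x [Z CZ ->]; apply: fine_mu_le => //.
  by apply: measurableI => //; exact: mC.
have /choice[Z hZ] n : exists Z, C Z /\ sup X - n.+1%:R^-1 < fine (nu (Y `&` Z)).
  have [|x [Z CZ ->] h] := @sup_adherent _ X n.+1%:R^-1 _ Xs; first by rewrite invr_gt0.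
  by exists Z.
have CZ := Cbig _ (fun n => (hZ n).1); set U := \bigcup_n Z n in CZ.
have mU := mC _ CZ; case: (CZ) => g [hg eU]; exists g; split => //; rewrite -eU.
have Usup : sup X <= fine (nu (Y `&` U)).
  apply/ler_addgt0Pr => e e0.
  have [n ne] : exists n, n.+1%:R^-1 < e.
    exists (Num.truncn e^-1); rewrite -[ltRHS]invrK ltf_pV2 ?posrE ?invr_gt0//.
    exact: truncnS_gt.
  have [CZn hn] := hZ n.
  have : fine (nu (Y `&` Z n)) <= fine (nu (Y `&` U)).
    apply: fine_mu_le; [| |by apply: setIS => t ?; exists n|exact: fI].
      by apply: measurableI => //; exact: mC.
    exact: measurableI.
  move=> h; apply: le_trans (_ : _ <= fine (nu (Y `&` Z n)) + e) _; last by rewrite lerD2r.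
  rewrite -lerBlDr; apply: le_trans (ltW hn); by rewrite lerD2l lerN2 ltW.
apply: contrapT => pos.
have mYU := measurableD mY mU.
have [a ha aYU] := atom_meets mYU pos.
have ma : measurable a by case: ha.
have CUa : C (U `|` a).
  rewrite -bigcup2E; apply: Cbig => -[|[|n]] //=.
  by exists (fun=> a); split; [by left|rewrite bigcup_const].
have : fine (nu (Y `&` (U `|` a))) <= sup X.
  by apply: sup_upper_bound => //; exists (U `|` a).
have e : Y `&` (U `|` a) = (Y `&` U) `|` (a `&` (Y `\` U)).
  apply/seteqP; split => t.
    by move=> [Yt [Ut|at_]]; [left|have [Ut|Ut] := pselect (U t); [left|right]].
  by move=> [[Yt Ut]|[at_ [Yt _]]]; split => //; [left|right].
rewrite e fine_muU; last 5 first.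
- exact: measurableI.
- exact: measurableI.
- by apply/seteqP; split => // t [[_ Ut] [_ [_]]].
- exact: fI.
- by apply: fin_subset Yfin => //; [exact: measurableI|move=> t [_ []]].
have : 0 < fine (nu (a `&` (Y `\` U))).
  rewrite lt_neqAle fine_ge0// andbT eq_sym; apply/eqP => h; apply: aYU.
  rewrite -[LHS]fineK ?h// ge0_fin_numE//.
  by apply: fin_subset Yfin => //; [exact: measurableI|move=> t [_ []]].
lra.
Qed.

Lemma atoms_cover_fin Y e : measurable Y -> (nu Y < +oo)%E -> 0 < e ->
  exists (g : nat -> set T) n, (forall n, atom_or_empty (g n)) /\
    (nu (Y `\` \big[setU/set0]_(k < n) g k) < e%:E)%E.
Proof.
move=> mY Yfin e0; have [g [hg Y0]] := atoms_cover mY Yfin.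
exists g.
have mg k : measurable (g k) by exact: atom_or_empty_measurable.
pose F n := Y `\` \big[setU/set0]_(k < n) g k.
have mF n : measurable (F n).
  by apply: measurableD => //; exact: measurable_bigsetU_ord.
have capF : \bigcap_n F n = Y `\` \bigcup_n g n.
  apply/seteqP; split => t.
    move=> h; split; first by case: (h 0%N I).
    move=> [k _ gt]; case: (h k.+1 I) => _; apply.
    by rewrite big_ord_recr; right.
  move=> [Yt nt] n _; split => //; rewrite -bigcup_mkord => -[k _ gt].
  by apply: nt; exists k.
have : nu \o F @ \oo --> nu (\bigcap_n F n).
  apply: nonincreasing_cvg_mu => //.
  - by apply: fin_subset Yfin => //; move=> t [].
  - by rewrite capF; apply: measurableD => //; exact: bigcup_measurable.
  - apply/nonincreasing_seqP => n; apply/subsetPset => t [Yt nt]; split => // h.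
    by apply: nt; rewrite big_ord_recr; left.
rewrite capF Y0 => /fine_cvgP[_].
move=> /cvgrPdist_lt /(_ _ e0)[n _ /(_ n (leqnn n))] /=.
rewrite sub0r normrN ger0_norm ?fine_ge0// => h; exists n; split => //.
rewrite -[X in (X < _)%E]fineK ?lte_fin// ge0_fin_numE//.
by apply: (fin_subset (mF n) mY _ Yfin) => t [].
Qed.

End atoms.

(** * Choosing sequences along a filter *)

Section extraction.
Context {I : Type} (FF : set_system I) {FFf : Filter FF}.

(** The sets that are not small for the filter, that is, whose complement does not belong to it. *)
Definition positive_set (P : set I) := forall Q, FF Q -> exists2 i, P i & Q i.

Lemma not_positive (P : set I) : ~ positive_set P -> FF (~` P).
Proof.
move=> h; have [Q [FQ hQ]] : exists Q, FF Q /\ forall i, Q i -> ~ P i.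
  apply: contrapT => h2; apply: h => Q FQ; apply: contrapT => h3; apply: h2.
  by exists Q; split => // i Qi Pi; apply: h3; exists i.
exact: filterS FQ.
Qed.

Definition initial_dep (Q : (nat -> I) -> nat -> set I) :=
  forall x y n, (forall k, (k < n)%N -> x k = y k) -> Q x n = Q y n.

(** Dependent choice: the constraint at stage n is a filter set determined by the points already
    chosen, and a positive set meets it. *)
Lemma extract (P : nat -> set I) (Q : (nat -> I) -> nat -> set I) :
  initial_dep Q -> (forall n, positive_set (P n)) -> (forall x n, FF (Q x n)) ->
  exists x : nat -> I, forall n, P n (x n) /\ Q x n (x n).
Proof.
move=> Qdep Ppos QF; have [i0 _ _] := Ppos 0%N setT filterT.
have /choice[pick hpick] (s : seq I) : exists i, P (size s) i /\ Q (nth i0 s) (size s) i.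
  by have [i Pi Qi] := Ppos (size s) _ (QF (nth i0 s) (size s)); exists i.
pose L := fix L n := if n is m.+1 then rcons (L m) (pick (L m)) else [::].
have sL n : size (L n) = n by elim: n => //= n IH; rewrite size_rcons IH.
pose x n := nth i0 (L n.+1) n.
have xE n : x n = pick (L n) by rewrite /x /= nth_rcons sL ltnn eqxx.
have nthL n k : (k < n)%N -> nth i0 (L n) k = x k.
  elim: n => // n IH; rewrite ltnS leq_eqVlt => /orP[/eqP -> //|kn].
  by rewrite /= nth_rcons sL kn IH.
exists x => n; have := hpick (L n); rewrite sL xE => -[Pn Qn]; split => //.
by rewrite (Qdep x (nth i0 (L n))) // => k kn; rewrite nthL.
Qed.

End extraction.

Section near.
Context {R : realType} {d : measure_display} {T : measurableType d}
  {d' : measure_display} {T' : measurableType d'}.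
Variables (mu : {measure set T -> \bar R}) (nu : {measure set T' -> \bar R}).
Variables (p : R) (J : (T -> R) -> (T' -> R)).
Hypotheses (p1 : 1 < p) (emb : weakLp_embedding mu nu p J) (pa : purely_atomic nu).
Context {I : Type} (phi : I -> T -> R) (FF : set_system I) {FFf : Filter FF}.
(** [adm] expresses orthogonality to, or disjointness from, the functions already chosen; the filter
    grants it for free. For admissible sequences, signed sums of n functions have a bound [om n] of
    smaller order than n^p. *)
Variables (adm : (nat -> I) -> nat -> set I) (om : nat -> R).
Hypothesis phiL : forall i, weakLp mu p (phi i).
Hypothesis adm_dep : initial_dep adm.
Hypothesis adm_FF : forall x n, FF (adm x n).
Hypothesis om_wb : forall x n (a : nat -> R),
  (forall k, adm x k (x k)) -> (forall k, `|a k| = 1) ->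
  wb mu p (fun t => \sum_(k < n) a k * phi (x k) t) (om n).
Hypothesis om_o : forall e, 0 < e -> exists2 n, (0 < n)%N & om n < e * n%:R `^ p.

(* Up to a sign, a [J (phi i)] that is not small on the atom exceeds [dl] a.e. on
   it; sums of such functions with these signs grow linearly there. *)
Lemma near_atom (g : set T') (dl : R) : is_atom nu g -> 0 < dl ->
  FF [set i | nu (g `&` [set y | dl < `|J (phi i) y|]) = 0%E].
Proof.
move=> [mg g0 hg] dl0; apply: contrapT => nF.
pose P := [set i | nu (g `&` [set y | dl < `|J (phi i) y|]) <> 0%E].
have Ppos : positive_set FF P.
  apply: contrapT => /not_positive h; apply: nF; apply: filterS h => i /= h.
  exact: contrapT.
have [x hx] := @extract _ FF _ (fun=> P) adm adm_dep (fun=> Ppos) adm_FF.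
have mJ i : measurable_fun setT (J (phi i)) by exact: embedding_measurable emb _ _.
have mgt (f : T' -> R) : measurable_fun setT f -> measurable [set y | dl < f y].
  move=> mf; rewrite -[X in measurable X]setTI (_ : [set y | _] = f @^-1` `]dl, +oo[).
    exact: mf.
  by apply/seteqP; split => y /=; rewrite in_itv/= andbT.
have /choice[a ha] k : exists a : R, `|a| = 1 /\
    nu (g `\` [set y | dl < a * J (phi (x k)) y]) = 0%E.
  have [Pk _] := hx k.
  have sgn (a : R) : `|a| = 1 -> nu (g `&` [set y | dl < a * J (phi (x k)) y]) <> 0%E ->
      exists a : R, `|a| = 1 /\ nu (g `\` [set y | dl < a * J (phi (x k)) y]) = 0%E.
    move=> a1 ne; exists a; split => //.
    have ma : measurable (g `&` [set y | dl < a * J (phi (x k)) y]).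
      by apply: measurableI => //; apply: mgt; exact: measurable_funM.
    have [//|] := hg _ ma (@subIsetl _ _ _).
    by rewrite setDIr setDv set0U.
  have [h1|h1] := pselect (nu (g `&` [set y | dl < 1 * J (phi (x k)) y]) = 0%E); last first.
    by apply: (sgn 1) => //; rewrite normr1.
  have [h2|h2] := pselect (nu (g `&` [set y | dl < (-1) * J (phi (x k)) y]) = 0%E); last first.
    by apply: (sgn (-1)) => //; rewrite normrN normr1.
  exfalso; apply: Pk.
  rewrite (_ : _ `&` _ = (g `&` [set y | dl < 1 * J (phi (x k)) y]) `|`
      (g `&` [set y | dl < (-1) * J (phi (x k)) y])).
    rewrite measureU0//; apply: measurableI => //; apply: mgt; exact: measurable_funM.
  apply/seteqP; split => y /=.
    by rewrite ltr_normr mul1r mulN1r => -[gy /orP[h|h]]; [left|right].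
  by rewrite ltr_normr mul1r mulN1r => -[[gy ->]|[gy ->]]; rewrite ?orbT.
have [C C0 hC] := embedding_wb p1 emb.
(* The atom may have infinite measure; any positive real below it will do. *)
have [e e0 eg] : exists2 e : R, 0 < e & (e%:E <= nu g)%E.
  move: g0; case: (nu g) => [r| |]//= r0.
    by exists r => //; rewrite -lte_fin.
  by exists 1 => //; rewrite leey.
have dl2 : 0 < dl / 2 by rewrite divr_gt0.
have [n n0 on] := om_o (divr_gt0 (mulr_gt0 e0 (powR_gt0 p dl2)) C0).
pose S t := \sum_(k < n) a k * phi (x k) t.
have SL : weakLp mu p S by apply: (@weakLp_sum _ _ _ mu p p1 (fun k => phi (x k))) => k.
have wS : wb mu p S (om n).
  by apply: om_wb => k; [case: (hx k)|case: (ha k)].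
have [wJ _] := hC S (om n) SL (wb_ge0 wS).
have ndl : 0 < n%:R * (dl / 2) by rewrite mulr_gt0// ltr0n.
have := wJ wS _ ndl.
have [N [mN N0 hN]] := embedding_sum p1 emb a n (fun k => phiL (x k)).
have mA k : measurable (g `\` [set y | dl < a k * J (phi (x k)) y]).
  by apply: measurableD => //; apply: mgt; exact: measurable_funM.
pose A := \bigcup_k (g `\` [set y | dl < a k * J (phi (x k)) y]).
have A0 : nu (A `|` N) = 0%E.
  rewrite measureU0//; last by exact: bigcup_measurable.
  apply/negligibleP; first exact: bigcup_measurable.
  by apply: negligible_bigcup => k; apply/negligibleP => //; case: (ha k).
have le1 : (nu g <= nu [set y | (n%:R * (dl / 2) < `|J S y|)%R])%E.
  apply: (@measure_le_ae _ _ _ nu _ _ (A `|` N)) => //.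
  - by apply: measurable_gt_norm; exact: embedding_measurable emb _ _.
  - by apply: measurableU => //; exact: bigcup_measurable.
  - move=> y gy; have [Ay|nAy] := pselect (A y); first by right; left.
    have [Ny|nNy] := pselect (N y); first by right; right.
    have eJ : J S y = \sum_(k < n) a k * J (phi (x k)) y.
      by apply: contrapT => ne; apply: nNy; exact: hN.
    left; rewrite /= eJ; apply: lt_le_trans (ler_norm _).
    apply: (@lt_le_trans _ _ (\sum_(k < n) dl)).
      rewrite sumr_const card_ord -[ltRHS]mulr_natl ltr_pM2l ?ltr0n//.
      by rewrite ltr_pdivrMr// ltr_pMr// ltr1n.
    apply: ler_sum => k _; apply: ltW; apply: contrapT => h; apply: nAy.
    by exists k.
move=> le2; have := le_trans eg (le_trans le1 le2); rewrite lee_fin.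
apply/negP; rewrite -ltNge.
have n0' : 0 < n%:R :> R by rewrite ltr0n.
rewrite powRN ltr_pdivrMr ?powR_gt0// -ltr_pdivlMl//.
rewrite (_ : C^-1 * _ = e * (dl / 2) `^ p / C * n%:R `^ p)//.
by rewrite (powRM _ (ltW n0') (ltW dl2)); ring.
Qed.

(** Up to measure [e], [Y] lies in a finite union of atoms, and [near_atom] yields one filter set
    for each of them. *)
Lemma near (Y : set T') (dl e : R) : measurable Y -> (nu Y < +oo)%E -> 0 < dl -> 0 < e ->
  FF [set i | (nu (Y `&` [set y | (dl < `|J (phi i) y|)%R]) < e%:E)%E].
Proof.
move=> mY Yfin dl0 e0; have [g [n [hg hY]]] := atoms_cover_fin pa mY Yfin e0.
have mg k : measurable (g k) := atom_or_empty_measurable (hg k).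
have FFk (m : nat) : FF [set i | forall k, (k < m)%N -> nu (g k `&` [set y | dl < `|J (phi i) y|]) = 0%E].
  elim: m => [|m IH]; first by apply: filterS filterT.
  have : FF [set i | nu (g m `&` [set y | dl < `|J (phi i) y|]) = 0%E].
    have [|->] := hg m; first by move=> /near_atom; exact.
    by apply: filterS filterT => i _ /=; rewrite set0I measure0.
  move=> h; apply: filterS (filterI IH h) => i /= [h1 h2] k.
  by rewrite ltnS leq_eqVlt => /orP[/eqP ->|/h1].
apply: filterS (FFk n) => i /= hi; apply: le_lt_trans hY.
set D := [set y | _].
have mD : measurable D by apply: measurable_gt_norm; exact: embedding_measurable emb _ _.
pose N := \bigcup_(k in `I_n) (g k `&` D).
have mN : measurable N by apply: bigcup_measurable => k _; exact: measurableI.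
apply: (@measure_le_ae _ _ _ nu _ _ N) => //.
- exact: measurableI.
- by apply: measurableD => //; exact: measurable_bigsetU_ord.
- apply/negligibleP => //; apply: (@negligibleS _ _ _ _ (\bigcup_k (g k `&` D `&` [set _ | (k < n)%N]))).
    by move=> y [k kn h]; exists k.
  apply: negligible_bigcup => k; have [kn|kn] := ltnP k n.
    apply: (@negligibleS _ _ _ _ (g k `&` D)); first by move=> y [].
    by apply/negligibleP; [exact: measurableI|exact: hi].
  apply: (@negligibleS _ _ _ _ set0); last exact: negligible_set0.
  by move=> y [].
- move=> y [Yy Dy]; rewrite -bigcup_mkord.
  have [[k kn gy]|ng] := pselect ((\bigcup_(k in `I_n) g k) y); last by left.
  by right; exists k.
Qed.

Lemma near_extract (P : nat -> set I) (dl e : R) :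
  (forall n, positive_set FF (P n)) -> 0 < dl -> 0 < e ->
  exists x, (forall n, P n (x n)) /\ (forall n, adm x n (x n)) /\
    forall k n, (k < n)%N ->
    (nu ([set y | (dl < `|J (phi (x k)) y|)%R] `&` [set y | (dl < `|J (phi (x n)) y|)%R]) < e%:E)%E.
Proof.
move=> Ppos dl0 e0.
pose D i := [set y | dl < `|J (phi i) y|].
pose Q x n := adm x n `&` [set i | forall k, (k < n)%N -> (nu (D (x k) `&` D i) < e%:E)%E].
have mD i : measurable (D i) by apply: measurable_gt_norm; exact: embedding_measurable emb _ _.
have Dfin i : (nu (D i) < +oo)%E.
  have [_ [K K0 wK]] : measurable_fun setT (J (phi i)) /\ exists2 K, 0 <= K & wb nu p (J (phi i)) K.
    by apply/(weakLp_wb nu p1); case: emb => + _ _ _; apply.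
  by apply: le_lt_trans (wK _ dl0) _; rewrite ltry.
have [||x hx] := @extract _ FF _ P Q _ Ppos.
- move=> x y n xy; rewrite /Q (adm_dep xy); congr (_ `&` _).
  by apply/seteqP; split => i h k kn /=; [rewrite -xy|rewrite xy] => //; exact: h.
- move=> x n; apply: filterI => //.
  suff h m : FF [set i | forall k, (k < m)%N -> (nu (D (x k) `&` D i) < e%:E)%E] by exact: h.
  elim: m => [|m IH]; first by apply: filterS filterT.
  apply: filterS (filterI IH (near (mD (x m)) (Dfin _) dl0 e0)) => i /= [h1 h2] k.
  by rewrite ltnS leq_eqVlt => /orP[/eqP ->|/h1].
exists x; split; first by move=> n; case: (hx n).
split; first by move=> n; case: (hx n) => _ [].
by move=> k n kn; case: (hx n) => _ [_ /(_ _ kn)].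
Qed.

End near.

(** * Orthogonal systems *)

Lemma powRN_ge1 {R : realType} (c q : R) : 0 < c -> c <= 1 -> 0 <= q ->
  1 <= c `^ (- q).
Proof.
move=> c0 c1 q0; rewrite powRN invf_ge1 ?powR_gt0//.
rewrite -[leRHS](congr1 (@^~ q) (@powR1 R)).
by apply: ge0_ler_powR => //; rewrite nnegrE ltW.
Qed.

Section bounded_functions.
Context {R : realType} {d : measure_display} {T : measurableType d}.
Variables (mu : {measure set T -> \bar R}) (E : set T).
Hypotheses (mE : measurable E) (Efin : (mu E < +oo)%E).

Definition bdd (f : T -> R) :=
  measurable_fun setT f /\ exists M, forall t, `|f t| <= M.

Lemma bdd_cst c : bdd (fun=> c).
Proof. by split; [exact: measurable_cst|exists `|c|]. Qed.

Lemma bddD f g : bdd f -> bdd g -> bdd (fun t => f t + g t).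
Proof.
move=> [mf [M hM]] [mg [L hL]]; split; first exact: measurable_funD.
by exists (M + L) => t; apply: le_trans (ler_normD _ _) _; exact: lerD.
Qed.

Lemma bddM f g : bdd f -> bdd g -> bdd (fun t => f t * g t).
Proof.
move=> [mf [M hM]] [mg [L hL]]; split; first exact: measurable_funM.
by exists (M * L) => t; rewrite normrM; apply: ler_pM.
Qed.

Lemma bddZ a f : bdd f -> bdd (fun t => a * f t).
Proof. by apply: bddM; exact: bdd_cst. Qed.

Lemma bddX f n : bdd f -> bdd (fun t => f t ^+ n).
Proof.
move=> bf; elim: n => [|n IH]; first by under eq_fun do rewrite expr0; exact: bdd_cst.
by under eq_fun do rewrite exprS; exact: bddM.
Qed.

Lemma bdd_norm f : bdd f -> bdd (fun t => `|f t|).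
Proof.
move=> [mf [M hM]]; split; first exact: measurableT_comp.
by exists M => t; rewrite normr_id.
Qed.

Lemma bdd_sum (h : nat -> T -> R) n : (forall k, (k < n)%N -> bdd (h k)) ->
  bdd (fun t => \sum_(k < n) h k t).
Proof.
elim: n => [_|n IH hh]; first by under eq_fun do rewrite big_ord0; exact: bdd_cst.
under eq_fun do rewrite big_ord_recr/=.
by apply: bddD; [apply: IH => k kn; apply: hh; exact: ltnW|exact: hh].
Qed.

Lemma bdd_integrable f : bdd f -> mu.-integrable E (EFin \o f).
Proof.
move=> [mf [M hM]]; apply: measurable_bounded_integrable => //.
  exact: measurable_funTS.
by exists M; split; [exact: num_real|move=> x Mx y Ey /=; exact: le_trans (hM y) (ltW Mx)].
Qed.

Lemma bdd_intD f g : bdd f -> bdd g ->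
  \int[mu]_(x in E) (f x + g x) = \int[mu]_(x in E) f x + \int[mu]_(x in E) g x.
Proof. by move=> bf bg; rewrite RintegralD//; exact: bdd_integrable. Qed.

Lemma bdd_intZ a f : bdd f ->
  \int[mu]_(x in E) (a * f x) = a * \int[mu]_(x in E) f x.
Proof. by move=> bf; rewrite RintegralZl//; exact: bdd_integrable. Qed.

Lemma bdd_int_le f g : bdd f -> bdd g -> (forall t, E t -> f t <= g t) ->
  \int[mu]_(x in E) f x <= \int[mu]_(x in E) g x.
Proof. by move=> bf bg fg; apply: le_Rintegral => //; exact: bdd_integrable. Qed.

Lemma bdd_markov f c : bdd f -> (forall t, 0 <= f t) -> 0 <= c ->
  c * fine (mu (E `&` [set t | c < f t])) <= \int[mu]_(x in E) f x.
Proof.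
move=> bf f0 c0; have mD : measurable (E `&` [set t | c < f t]).
  apply: measurableI => //; rewrite -[X in measurable X]setTI.
  rewrite (_ : [set t | _] = f @^-1` `]c, +oo[); first by case: bf => mf _; exact: mf.
  by apply/seteqP; split => y /=; rewrite in_itv/= andbT.
have Dfin := fin_subset mD mE (@subIsetl _ _ _) Efin.
rewrite -Rintegral_cst//.
apply: (@le_trans _ _ (\int[mu]_(x in E `&` [set t | c < f t]) f x)).
  apply: le_Rintegral => //.
  - apply: integrableS (bdd_integrable (bdd_cst c)) => //; exact: subIsetl.
  - apply: integrableS (bdd_integrable bf) => //; exact: subIsetl.
  - by move=> t [_ /= /ltW].
rewrite /Rintegral; apply: fine_le.
- apply: integrable_fin_num => //; apply: integrableS (bdd_integrable bf) => //; exact: subIsetl.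
- by apply: integrable_fin_num => //; exact: bdd_integrable.
- apply: ge0_subset_integral => //.
  + by apply/measurable_EFinP; case: bf => mf _; exact: measurable_funTS.
  + by move=> t _; rewrite lee_fin.
Qed.

Definition unit_on (f : T -> R) := [/\ measurable_fun setT f,
  forall t, `|f t| <= 1 & forall t, ~ E t -> f t = 0].

Lemma unit_on_bdd f : unit_on f -> bdd f.
Proof. by move=> [mf f1 _]; split => //; exists 1. Qed.

(** The first condition makes variances additive, the second removes the cubic term from the fourth
    moment. Arbitrary coefficients are allowed because signs are chosen only after the functions. *)
Definition orth (x : nat -> T -> R) n (f : T -> R) := forall a : nat -> R,
  \int[mu]_(t in E) (f t * \sum_(k < n) a k * x k t) = 0 /\
  \int[mu]_(t in E) (f t * (\sum_(k < n) a k * x k t) ^+ 3) = 0.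

Section moments.
Variables (x : nat -> T -> R) (a : nat -> R).
Hypotheses (x1 : forall k, unit_on (x k)) (xo : forall n, orth x n (x n)).
Hypothesis a1 : forall k, `|a k| <= 1.

Let S n t := \sum_(k < n) a k * x k t.
Let m := fine (mu E).
Let m0 : 0 <= m. Proof. exact: fine_ge0. Qed.

Lemma bdd_S n : bdd (S n).
Proof.
apply: (@bdd_sum (fun k t => a k * x k t)) => k _.
by apply: bddZ; exact: unit_on_bdd.
Qed.

Lemma SS n t : S n.+1 t = S n t + a n * x n t.
Proof. by rewrite /S big_ord_recr. Qed.

Lemma moment2 n : \int[mu]_(t in E) (S n t ^+ 2) =
  \sum_(k < n) a k ^+ 2 * \int[mu]_(t in E) (x k t ^+ 2).
Proof.
have bx := unit_on_bdd (x1 _); have bS := bdd_S.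
elim: n => [|n IH].
  rewrite big_ord0; under eq_Rintegral do rewrite /S big_ord0 expr0n.
  by rewrite Rintegral_cst// mul0r.
rewrite big_ord_recr/= -IH.
rewrite (_ : (fun t => S n.+1 t ^+ 2) = fun t => (S n t ^+ 2 + 2 * a n * (x n t * S n t)) + a n ^+ 2 * x n t ^+ 2); last first.
  by apply/funext => t; rewrite SS; ring.
rewrite bdd_intD; [|by apply: bddD; [exact: bddX|apply: bddZ; exact: bddM]|by apply: bddZ; exact: bddX].
rewrite bdd_intD; [|exact: bddX|by apply: bddZ; exact: bddM].
rewrite bdd_intZ; last exact: bddM.
rewrite bdd_intZ; last exact: bddX.
by rewrite (xo n a).1 mulr0 addr0.
Qed.

Lemma int_sq_le f : unit_on f -> \int[mu]_(t in E) (f t ^+ 2) <= m.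
Proof.
move=> uf; rewrite -[leRHS]mul1r -Rintegral_cst//.
apply: bdd_int_le; [by apply: bddX; exact: unit_on_bdd|exact: bdd_cst|].
by move=> t _; case: uf => _ f1 _; rewrite -real_normK ?num_real// expr_le1.
Qed.

Lemma moment2_le n : \int[mu]_(t in E) (S n t ^+ 2) <= n%:R * m.
Proof.
rewrite moment2 mulr_natl -[X in _ *+ X](card_ord n) -sumr_const.
apply: ler_sum => k _; apply: le_trans (int_sq_le (x1 k)).
rewrite ler_piMl ?Rintegral_ge0//; first by move=> t _; exact: sqr_ge0.
by rewrite -real_normK ?num_real// expr_le1.
Qed.

Let cnt n := \sum_(k < n) a k ^+ 2.

Lemma moment2_count n : \int[mu]_(t in E) (S n t ^+ 2) <= cnt n * m.
Proof.
rewrite moment2 /cnt mulr_suml; apply: ler_sum => k _.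
by apply: ler_wpM2l; [exact: sqr_ge0|exact: int_sq_le (x1 k)].
Qed.

Hypothesis a01 : forall k, a k = 0 \/ a k ^+ 2 = 1.

(** [cnt n] counts the nonzero coefficients. In (S + u)^4 with |u| <= 1 the term 4 u S^3 integrates
    to 0; the others beyond S^4 are at most 8 S^2 + 3, using 4 S u^3 <= 2 (S^2 + 1). A further
    function adds at most (8 cnt + 3) m, while the right side grows by (22 cnt + 11) m. *)
Lemma moment4_le n : \int[mu]_(t in E) (S n t ^+ 4) <= 11 * cnt n ^+ 2 * m.
Proof.
have bx := unit_on_bdd (x1 _); have bS := bdd_S.
elim: n => [|n IH].
  under eq_Rintegral do rewrite /S big_ord0 expr0n.
  by rewrite Rintegral_cst// mul0r /cnt big_ord0 expr0n mulr0 mul0r.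
have [a0|a2] := a01 n.
  rewrite (_ : cnt n.+1 = cnt n); last by rewrite /cnt big_ord_recr/= a0 expr0n addr0.
  by under eq_Rintegral do rewrite SS a0 mul0r addr0.
have cS : cnt n.+1 = cnt n + 1 by rewrite /cnt big_ord_recr/= a2.
pose Q t := S n t ^+ 4 + 4 * a n * (x n t * S n t ^+ 3) + 8 * S n t ^+ 2 + 3.
have bQ : bdd Q.
  apply: bddD; last exact: bdd_cst.
  by do 2 (apply: bddD; last by apply: bddZ; do ?[apply: bddM|exact: bddX|exact: bx]); exact: bddX.
apply: (@le_trans _ _ (\int[mu]_(t in E) Q t)).
  apply: bdd_int_le => //; first exact: bddX.
  move=> t _; rewrite SS /Q; have [_ /(_ t) h _] := x1 n.
  set s := S n t; set y := x n t in h *.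
  have : `|a n * y| <= 1 by rewrite normrM -[1]mulr1; apply: ler_pM.
  set u := a n * y; rewrite ler_norml => /andP[u1 u2].
  have -> : 4 * a n * (y * s ^+ 3) = 4 * u * s ^+ 3 by rewrite /u; ring.
  have v0 : u ^+ 2 <= 1 by nra.
  have v3 : `|u ^+ 3| <= 1 by rewrite normrX expr_le1// ler_norml u1.
  have w : 4 * s * u ^+ 3 <= 2 * (s ^+ 2 + 1).
    have v6 : (u ^+ 3) ^+ 2 <= 1 by rewrite -[_ ^+ 2]real_normK ?num_real// expr_le1.
    have := sqr_ge0 (s - u ^+ 3); rewrite sqrrB; lra.
  have w4 : u ^+ 4 <= 1 by rewrite (_ : u ^+ 4 = (u ^+ 2) ^+ 2); [rewrite expr_le1// sqr_ge0|ring].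
  have w2 : 6 * s ^+ 2 * u ^+ 2 <= 6 * s ^+ 2 by have := sqr_ge0 s; nra.
  rewrite (_ : (s + u) ^+ 4 = s ^+ 4 + 4 * u * s ^+ 3 + 6 * s ^+ 2 * u ^+ 2 + 4 * s * u ^+ 3 + u ^+ 4); last by ring.
  by lra.
rewrite /Q bdd_intD; [|by do 2 (apply: bddD; last by apply: bddZ; do ?[apply: bddM|exact: bddX|exact: bx]); exact: bddX|exact: bdd_cst].
rewrite bdd_intD; [|by apply: bddD; [exact: bddX|apply: bddZ; apply: bddM; [exact: bx|exact: bddX]]|by apply: bddZ; exact: bddX].
rewrite bdd_intD; [|exact: bddX|by apply: bddZ; apply: bddM; [exact: bx|exact: bddX]].
rewrite bdd_intZ; last by apply: bddM; [exact: bx|exact: bddX].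
rewrite bdd_intZ; last exact: bddX.
rewrite (xo n a).2 mulr0 addr0 Rintegral_cst//.
have h := moment2_count n; have nm : 0 <= cnt n * m.
  by rewrite mulr_ge0// sumr_ge0// => k _; exact: sqr_ge0.
rewrite cS (_ : 11 * (cnt n + 1) ^+ 2 * m = 11 * cnt n ^+ 2 * m + 22 * (cnt n * m) + 11 * m); last by ring.
by have := m0; rewrite /m in IH h nm *; lra.
Qed.

Lemma S_off n t : ~ E t -> S n t = 0.
Proof.
by move=> nE; apply: big1 => k _; case: (x1 k) => _ _ ->//; rewrite mulr0.
Qed.

Lemma S_bound n t : `|S n t| <= n%:R.
Proof.
apply: le_trans (ler_norm_sum _ _ _) _.
rewrite -[n in leRHS]card_ord -sumr_const; apply: ler_sum => k _.
by rewrite normrM -[1]mulr1; case: (x1 k) => _ h _; apply: ler_pM.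
Qed.

Lemma S_tail q n c : 0 < c -> (0 < q)%N ->
  (mu [set t | (c < `|S n t|)%R] <=
   ((c ^+ q)^-1 * \int[mu]_(t in E) (`|S n t| ^+ q))%:E)%E.
Proof.
move=> c0 q0; have [mS _] := bdd_S n.
have e : [set t | c < `|S n t|] = E `&` [set t | c ^+ q < `|S n t| ^+ q].
  apply/seteqP; split => t /=; rewrite ltr_pXn2r ?nnegrE ?(ltW c0)//; last by case.
  move=> h; split => //; apply: contrapT => nE; move: h.
  by rewrite S_off// normr0 ltNge ltW.
have bq : bdd (fun t => `|S n t| ^+ q).
  apply: bddX; split; first exact: measurableT_comp.
  by exists n%:R => t; rewrite normr_id; exact: S_bound.
have mD : measurable [set t | c < `|S n t|] by exact: measurable_gt_norm.
rewrite -[X in (X <= _)%E]fineK; last first.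
  by rewrite ge0_fin_numE//; apply: fin_subset Efin => //; rewrite e; exact: subIsetl.
rewrite lee_fin ler_pdivlMl ?exprn_gt0// e.
by apply: bdd_markov => //; exact: exprn_ge0 (ltW c0).
Qed.

Lemma S_tail2 n c : 0 < c ->
  (mu [set t | (c < `|S n t|)%R] <= (n%:R * m * (c ^+ 2)^-1)%:E)%E.
Proof.
move=> c0; apply: le_trans (S_tail n c0 (isT : (0 < 2)%N)) _.
rewrite lee_fin mulrC ler_pM2r ?invr_gt0 ?exprn_gt0//.
apply: le_trans (moment2_le n); under eq_Rintegral do rewrite real_normK ?num_real//.
exact: lexx.
Qed.

Lemma S_tail4 n c : 0 < c ->
  (mu [set t | (c < `|S n t|)%R] <= (11 * (\sum_(k < n) a k ^+ 2) ^+ 2 * m * (c ^+ 4)^-1)%:E)%E.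
Proof.
move=> c0; apply: le_trans (S_tail n c0 (isT : (0 < 4)%N)) _.
rewrite lee_fin mulrC ler_pM2r ?invr_gt0 ?exprn_gt0//.
apply: le_trans (moment4_le n).
under eq_Rintegral do rewrite (_ : 4 = 2 * 2)%N// exprM real_normK ?num_real// -exprM.
exact: lexx.
Qed.

Lemma S_tail0 n c : 0 < c -> (mu [set t | (c < `|S n t|)%R] <= m%:E)%E.
Proof.
move=> c0; rewrite fineK ?ge0_fin_numE//; apply: le_measure; rewrite ?inE//.
  by apply: measurable_gt_norm; case: (bdd_S n).
move=> t /= h; apply: contrapT => nE; move: h.
by rewrite S_off// normr0 ltNge ltW.
Qed.

(** For c <= 1 the measure of [E] suffices and for c >= n the level set is empty. In between,
    Chebyshev gives n m c^-2 = n c^(p-2) m c^-p, where c^(p-2) is at most 1 if p <= 2 and at most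
    n^(p-2) otherwise. *)
Lemma S_wb p n : 1 < p -> wb mu p (S n) (n%:R `^ Num.max 1 (p - 1) * m).
Proof.
move=> p1 c c0; have [->|n0] := posnP n.
  apply: (le_trans (S_tail2 0 c0)); rewrite !mul0r lee_fin.
  by rewrite !mulr_ge0 ?powR_ge0.
have n1 : 1 <= n%:R :> R by rewrite ler1n.
have cp : 0 < c `^ (- p) by exact: powR_gt0.
have [c1|c1] := leP c 1.
  apply: le_trans (S_tail0 n c0) _; rewrite lee_fin mulrAC ler_peMl//.
  rewrite -[leLHS]mulr1; apply: ler_pM => //.
    by rewrite -[leLHS](powRr0 n%:R); apply: ler_powR => //; rewrite le_max ler01.
  by apply: powRN_ge1 => //; apply: ltW; exact: lt_trans p1.
have [nc|cn] := leP n%:R c.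
  rewrite (_ : [set t | _] = set0) ?measure0 ?lee_fin.
    by rewrite !mulr_ge0 ?powR_ge0.
  apply/seteqP; split => // t /=; apply/negP; rewrite -leNgt.
  exact: le_trans (S_bound n t) nc.
apply: le_trans (S_tail2 n c0) _; rewrite lee_fin mulrAC -[leRHS]mulrAC ler_wpM2r//.
have -> : (c ^+ 2)^-1 = c `^ (p - 2) * c `^ (- p).
  by rewrite -powRD ?(gt_eqF c0) ?implybT// addrAC subrr add0r powRN powR_mulrn ?ltW.
rewrite mulrA ler_pM2r//.
have [p2|p2] := leP p 2.
  rewrite max_l; last by lra.
  rewrite powRr1// ler_piMr//.
  by rewrite -[leRHS](powRr0 c) ler_powR ?(ltW c1)//; lra.
rewrite max_r; last by lra.
rewrite -[X in X * _]powRr1// (_ : p - 1 = 1 + (p - 2)); last by lra.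
rewrite [leRHS]powRD_gt0 ?ltr0n// ler_pM2l ?powR_gt0 ?ltr0n//.
by apply: ge0_ler_powR => //; rewrite ?nnegrE ?ltW//; lra.
Qed.

(** The square of a weak L^p function is in weak L^(p/2) with the same bound, and p/2 > 1 allows
    integration over [E]. *)
Lemma moment2_weak p n K : 2 < p -> wb mu p (S n) K ->
  \int[mu]_(t in E) (S n t ^+ 2) <=
    (1 + cI (p / 2)) * K `^ (p / 2)^-1 * m `^ (1 - (p / 2)^-1).
Proof.
move=> p2 wS; have p1 : 1 < p / 2 by lra.
have [mS _] := bddX 2 (bdd_S n).
have w : wb mu (p / 2) (fun t => S n t ^+ 2) K.
  move=> c c0; have := wS (Num.sqrt c); rewrite sqrtr_gt0 => /(_ c0).
  rewrite (_ : [set t | Num.sqrt c < `|S n t|] = [set t | c < `|S n t ^+ 2|]).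
    by rewrite -(powR12_sqrt (ltW c0)) -powRrM (_ : 2^-1 * - p = - (p / 2))//; ring.
  have e t : (Num.sqrt c < `|S n t|) = (c < `|S n t ^+ 2|).
    by rewrite normrX -[in RHS](sqr_sqrtr (ltW c0)) ltr_pXn2r// ?nnegrE ?sqrtr_ge0.
  by apply/seteqP; split => t /=; rewrite e.
apply: le_trans (weak_Rintegral_powR p1 mS w mE Efin).
have b2 : bdd (fun t => S n t ^+ 2) by apply: bddX; exact: bdd_S.
by apply: bdd_int_le => // [|t _]; [exact: bdd_norm|exact: ler_norm].
Qed.

End moments.

(* The exponent [2 * p] (any exponent larger than [p] would do) makes copies of
   these functions at well separated amplitudes almost independent in weak L^p; [11] is the constant of [moment4_le]. *)
Definition tame p (u : T -> R) := [/\ measurable_fun setT u, forall t, ~ E t -> u t = 0 &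
  forall c, 0 < c -> (mu [set t | (c < `|u t|)%R] <=
    (11 * fine (mu E) * c `^ (- (2 * p)))%:E)%E].

Lemma tame_le p (u : T -> R) : 0 < p -> measurable_fun setT u -> (forall t, ~ E t -> u t = 0) ->
  (forall c, 1 < c -> (mu [set t | (c < `|u t|)%R] <=
    (11 * fine (mu E) * c `^ (- (2 * p)))%:E)%E) -> tame p u.
Proof.
move=> p0 mu_ u0 h; split => // c c0; have [c1|/h//] := leP c 1.
apply: (@le_trans _ _ (mu E)).
  apply: le_measure; rewrite ?inE//; first exact: measurable_gt_norm.
  move=> t /= ht; apply: contrapT => nE; move: ht.
  by rewrite u0// normr0 ltNge ltW.
rewrite -[leLHS]fineK ?ge0_fin_numE// lee_fin mulrAC ler_peMl ?fine_ge0//.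
rewrite -[leLHS]mulr1; apply: ler_pM => //; first by rewrite ler1n.
by apply: powRN_ge1 => //; rewrite mulr_ge0 ?ltW.
Qed.

Lemma unit_on_tame p u : 0 < p -> unit_on u -> tame p u.
Proof.
move=> p0 [mf u1 u0]; apply: tame_le => // c c1.
rewrite (_ : [set t | _] = set0) ?measure0 ?lee_fin.
  by rewrite !mulr_ge0 ?powR_ge0 ?fine_ge0.
apply/seteqP; split => // t /=; apply/negP; rewrite -leNgt.
by apply: le_trans (u1 t) _; exact: ltW.
Qed.

Lemma tame_wb p u : 0 < p -> tame p u -> wb mu p u (11 * fine (mu E)).
Proof.
move=> p0 [mf u0 ut] c c0; have [c1|c1] := leP c 1.
  apply: (@le_trans _ _ (mu E)).
    apply: le_measure; rewrite ?inE//; first exact: measurable_gt_norm.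
    move=> t /= ht; apply: contrapT => nE; move: ht.
    by rewrite u0// normr0 ltNge ltW.
  rewrite -[leLHS]fineK ?ge0_fin_numE// lee_fin mulrAC ler_peMl ?fine_ge0//.
  rewrite -[leLHS]mulr1; apply: ler_pM => //; first by rewrite ler1n.
  by apply: powRN_ge1 => //; exact: ltW.
apply: le_trans (ut c c0) _; rewrite lee_fin ler_wpM2l ?mulr_ge0 ?fine_ge0//.
by rewrite ler_powR ?(ltW c1)//; lra.
Qed.

(** The fourth moment bound at the level c sqrt n gives 11 m c^-4, and c^-4 <= c^(-2p) for c > 1
    because p <= 2. *)
Lemma tame_normalized_sum p (x : nat -> T -> R) n :
  1 < p <= 2 -> (0 < n)%N -> (forall k, unit_on (x k)) ->
  (forall n, orth x n (x n)) ->
  tame p (fun t => (Num.sqrt n%:R)^-1 * \sum_(k < n) 1 * x k t).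
Proof.
move=> /andP[p1 p2] n0 x1 xo; pose a := fun _ : nat => 1 : R.
have a1 k : `|a k| <= 1 by rewrite /a normr1.
have a01 k : a k = 0 \/ a k ^+ 2 = 1 by right; rewrite /a expr1n.
have ca : \sum_(k < n) a k ^+ 2 = n%:R.
  by rewrite (eq_bigr (fun=> 1)) ?sumr_const ?card_ord// => k _; rewrite /a expr1n.
have [mS _] := bdd_S a x1 n.
have s0 : 0 < Num.sqrt n%:R :> R by rewrite sqrtr_gt0 ltr0n.
apply: tame_le; [exact: lt_trans p1|exact: measurable_funM| |].
  by move=> t nE; rewrite (S_off a x1 n nE) mulr0.
move=> c c1; have c0 : 0 < c by exact: lt_trans c1.
have := S_tail4 x1 xo a1 a01 n (mulr_gt0 c0 s0); rewrite ca.
rewrite (_ : [set t | c * _ < _] = [set t | c < `|(Num.sqrt n%:R)^-1 * \sum_(k < n) 1 * x k t|]).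
  move/le_trans; apply; rewrite lee_fin exprMn.
  rewrite (_ : Num.sqrt n%:R ^+ 4 = n%:R ^+ 2); last first.
    by rewrite (_ : 4 = 2 * 2)%N// exprM sqr_sqrtr.
  rewrite (_ : 11 * n%:R ^+ 2 * fine (mu E) / _ = 11 * fine (mu E) * (c ^+ 4)^-1); last first.
    by field; rewrite pnatr_eq0 -lt0n n0 gt_eqF.
  rewrite ler_wpM2l ?mulr_ge0 ?fine_ge0// -(powR_mulrn _ (ltW c0)) -powRN.
  by rewrite ler_powR ?(ltW c1)//; lra.
apply/seteqP; split => t /=; rewrite normrM gtr0_norm ?invr_gt0//.
  by rewrite ltr_pdivlMl// mulrC.
by rewrite ltr_pdivlMl// mulrC.
Qed.

End bounded_functions.

(** * Rademacher functions on a set of finite measure *)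

Section rademacher.
Context {R : realType} {d : measure_display} {T : measurableType d}.
Variables (mu : {measure set T -> \bar R}) (E : set T).
Hypotheses (na : purely_non_atomic mu) (mE : measurable E) (Efin : (mu E < +oo)%E).

Lemma halving : exists h : set T -> set T, forall A, measurable A ->
  (mu A < +oo)%E -> [/\ measurable (h A), h A `<=` A & mu (h A) = (fine (mu A) / 2)%:E].
Proof.
suff /choice[h hh] A : exists B, measurable A -> (mu A < +oo)%E ->
    [/\ measurable B, B `<=` A & mu B = (fine (mu A) / 2)%:E] by exists h.
have [[mA Af]|n] := pselect (measurable A /\ (mu A < +oo)%E); last first.
  by exists set0 => ? ?; case: n.
have [|B hB] := @nonatomic_intermediate _ _ _ mu na A (fine (mu A) / 2) mA Af.
  by have := fine_ge0 (measure_ge0 mu A); lra.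
by exists B.
Qed.

(** The n-th test set is half of each cell of the code computed so far, and [x n] is 1 on it and -1
    on the rest of [E]. Earlier functions are constant on these cells and [x n] has integral 0 over
    each, so it is orthogonal to every bounded function of the earlier ones, in particular to sums
    and their cubes. *)
Lemma rademacher : exists x : nat -> T -> R,
  [/\ forall k, unit_on E (x k), forall k t, E t -> x k t ^+ 2 = 1 &
      forall (y : nat -> nat) n m, (forall k, (k < n)%N -> (y k < m)%N) ->
        orth mu E (fun k => x (y k)) n (x m)].
Proof.
have [h hh] := halving.
pose H (n : nat) (kf : T -> nat) := \bigcup_j h (E `&` [set t | kf t = j]).
pose C n j := E `&` [set t | key H n t = j].
have mCn n (mk : forall i, measurable [set t | key H n t = i]) : measurable (H n (key H n)).
  apply: bigcup_measurable => j _.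
  have mC : measurable (E `&` [set t | key H n t = j]) by exact: measurableI.
  by have [] := hh _ mC (fin_subset mC mE (@subIsetl _ _ _) Efin).
have mkey n j : measurable [set t | key H n t = j].
  by apply: measurable_key => m _; exact: mCn.
have mC n j : measurable (C n j) by exact: measurableI.
have Cfin n j : (mu (C n j) < +oo)%E by apply: fin_subset Efin => //; exact: subIsetl.
have HC n j : C n j `&` H n (key H n) = h (C n j).
  have [_ hC _] := hh _ (mC n j) (Cfin n j).
  apply/seteqP; split => t.
    move=> [[_ kj] [i _ hi]]; have [_ hC' _] := hh _ (mC n i) (Cfin n i).
    by have [_ ki] := hC' _ hi; rewrite /= in kj ki; rewrite -kj ki.
  by move=> ht; split; [exact: hC|exists j].
pose x n t : R := if `[< E t >] then (if `[< H n (key H n) t >] then 1 else -1) else 0.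
have mH n : measurable (H n (key H n)) by exact: mCn.
have x1 k : unit_on E (x k).
  split.
  - rewrite (_ : x k = fun t => \1_(E `&` H k (key H k)) t - \1_(E `\` H k (key H k)) t).
      apply: measurable_funB; apply: measurable_indic; [exact: measurableI|exact: measurableD].
    apply/funext => t; rewrite /x !indicE.
    have [Et|Et] := pselect (E t); last first.
      by rewrite asboolF// !memNset ?subr0//; [move=> []|move=> []].
    rewrite asboolT//; have [Ht|Ht] := pselect (H k (key H k) t).
      by rewrite asboolT// mem_set// memNset ?subr0//; move=> [].
    by rewrite asboolF// memNset ?mem_set ?sub0r//; move=> [].
  - by move=> t; rewrite /x; case: ifP => _; [case: ifP => _|]; rewrite ?normrN ?normr1// normr0.
  - by move=> t nE; rewrite /x asboolF.
exists x; split => //.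
- by move=> k t Et; rewrite /x asboolT//; case: ifP => _; rewrite ?sqrrN expr1n.
have key_x k n s t : (k < n)%N -> E s -> E t -> key H n s = key H n t -> x k s = x k t.
  move=> kn Es Et /(key_eqW kn) /key_inj[_ e].
  by rewrite /x (asboolT Es) (asboolT Et) (_ : `[< H k (key H k) s >] = `[< H k (key H k) t >])//; exact/asbool_equiv_eq.
have cell_zero n j : \int[mu]_(t in C n j) x n t = 0.
  have [mh hC hmu] := hh _ (mC n j) (Cfin n j).
  have b1 : bdd (fun t => \1_(h (C n j)) t : R).
    split; first exact: measurable_indic.
    by exists 1 => t; rewrite indicE; case: (_ \in _); rewrite ?normr1 ?normr0.
  rewrite (_ : \int[mu]_(t in _) _ = \int[mu]_(t in C n j) (2 * \1_(h (C n j)) t + (-1))).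
    rewrite bdd_intD ?bdd_intZ//; [|exact: bddZ|exact: bdd_cst].
    rewrite Rintegral_cst// /Rintegral integral_indic// setIidl// hmu/=; lra.
  apply: eq_Rintegral => t; rewrite inE => Ct; rewrite /x asboolT; last by case: Ct.
  rewrite indicE; have [Ht|Ht] := pselect (H n (key H n) t).
    rewrite (asboolT Ht) mem_set; [rewrite /=; lra|by rewrite -HC].
  by rewrite (asboolF Ht) memNset; [rewrite /=; lra|rewrite -HC; case].
have orthm n (g : T -> R) : (forall s t, E s -> E t -> key H n s = key H n t -> g s = g t) ->
    bdd g -> \int[mu]_(t in E) (x n t * g t) = 0.
  move=> hg bg.
  have EC : E = \big[setU/set0]_(j < 2 ^ n) C n j.
    rewrite -bigcup_mkord; apply/seteqP; split => [t Et|t [j _ []]//].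
    by exists (key H n t) => //=; exact: key_lt.
  rewrite (Rintegral_partition EC)//; last 2 first.
  - by move=> i j t [_ <-] [_ <-].
  - by apply: bdd_integrable => //; apply: bddM => //; exact: unit_on_bdd (x1 n).
  apply: big1 => j _.
  have [[s Cs]|none] := pselect (exists s, C n j s); last first.
    rewrite (_ : C n j = set0) ?Rintegral_set0//.
    by apply/seteqP; split => // t Ct; case: none; exists t.
  rewrite (_ : \int[mu]_(t in _) _ = \int[mu]_(t in C n j) (g s * x n t)); last first.
    apply: eq_Rintegral => t; rewrite inE => -[Et kt]; rewrite mulrC (hg t s)//; first by case: Cs.
    by case: Cs => _ /= ->.
  by rewrite bdd_intZ ?cell_zero ?mulr0//; exact: unit_on_bdd (x1 n).
move=> y n m yx a.
have bS : bdd (fun t => \sum_(k < n) a k * x (y k) t).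
  by exact: (bdd_S a (fun k => x1 (y k)) n).
have cS s t : E s -> E t -> key H m s = key H m t ->
    \sum_(k < n) a k * x (y k) s = \sum_(k < n) a k * x (y k) t.
  move=> Es Et e; apply: eq_bigr => k _; congr (_ * _).
  by apply: (key_x (y k) m) => //; exact: yx.
split; first by apply: orthm.
apply: (orthm _ (fun t => (\sum_(k < n) a k * x (y k) t) ^+ 3)); last exact: bddX.
by move=> s t Es Et e; rewrite (cS s t).
Qed.

End rademacher.

Section separation.
Context {R : realType}.

Lemma powR_unbounded (r B : R) : 0 < r -> exists2 n, (0 < n)%N & B < n%:R `^ r.
Proof.
move=> r0; pose b := `|B| + 1; have b0 : 0 < b by rewrite ltr_wpDl.
exists (Num.truncn (b `^ r^-1)).+1 => //.
have h := truncnS_gt (b `^ r^-1).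
apply: (@lt_le_trans _ _ b).
  by apply: le_lt_trans (ler_norm _) _; rewrite ltrDl.
have eb : b = (b `^ r^-1) `^ r by rewrite -powRrM mulVf ?powRr1 ?gt_eqF// ltW.
rewrite [leLHS]eb.
by apply: ge0_ler_powR; rewrite ?nnegrE ?powR_ge0 ?(ltW r0) ?(ltW h).
Qed.

Lemma powR_little_o (q r A e : R) : q < r -> 0 < e ->
  exists2 n, (0 < n)%N & n%:R `^ q * A < e * n%:R `^ r.
Proof.
move=> qr e0; have [|n n0 hn] := @powR_unbounded (r - q) (A / e); first by rewrite subr_gt0.
exists n => //; rewrite -[r in ltRHS](subrK q) powRD_gt0 ?ltr0n// mulrA mulrC.
rewrite ltr_pM2r ?powR_gt0 ?ltr0n//.
by move: hn; rewrite ltr_pdivrMr// mulrC.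
Qed.

Lemma powR_divN (a b q : R) : 0 < a -> 0 < b -> (a / b) `^ (- q) = a `^ (- q) * b `^ q.
Proof.
move=> a0 b0; rewrite powRM ?invr_ge0 ?(ltW a0) ?(ltW b0)//.
by rewrite -(powR_inv1 (ltW b0)) -powRrM mulN1r opprK.
Qed.

Lemma sumr_const_ord n (c : R) : \sum_(k < n) c = n%:R * c.
Proof. by rewrite sumr_const card_ord mulr_natl. Qed.

Definition sep (dl : R) n (v : nat -> R) :=
  forall j k, (j < k < n)%N -> ~ (dl < `|v j| /\ dl < `|v k|).

Lemma sep_dist dl n v k : 0 <= dl -> sep dl n v -> (k < n)%N -> dl < `|v k| ->
  `|\sum_(j < n) v j - v k| <= n%:R * dl.
Proof.
move=> dl0 sv kn vk; rewrite (bigD1 (Ordinal kn))//= addrAC subrr add0r.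
apply: le_trans (ler_norm_sum _ _ _) _.
apply: (@le_trans _ _ (\sum_(j < n | j != Ordinal kn) dl)).
  apply: ler_sum => j jk; rewrite leNgt; apply/negP => vj.
  have [jk'|kj|e] := ltngtP j k.
  - by apply: (sv j k); rewrite ?jk'.
  - by apply: (sv k j); rewrite ?kj/=.
  - by move/eqP: jk; apply; exact: val_inj.
apply: (@le_trans _ _ (\sum_(j < n) dl)); last by rewrite sumr_const card_ord mulr_natl.
by rewrite [leRHS](bigD1 (Ordinal kn))//= lerDr.
Qed.

Lemma sep_lower dl n v k s : 0 < dl -> sep dl n v -> (k < n)%N ->
  n%:R * dl <= s / 2 -> s < `|v k| -> s / 2 < `|\sum_(j < n) v j|.
Proof.
move=> dl0 sv kn nd sk.
have n1 : 1 <= n%:R :> R by rewrite ler1n (leq_trans _ kn).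
have d1 : dl <= n%:R * dl by rewrite ler_peMl// ltW.
have vk : dl < `|v k| by apply: le_lt_trans sk; lra.
have := sep_dist (ltW dl0) sv kn vk.
have := ler_normB (\sum_(j < n) v j) (\sum_(j < n) v j - v k).
rewrite subKr; lra.
Qed.

Lemma sep_upper dl n v t : 0 <= dl -> sep dl n v ->
  n%:R * dl <= t / 2 -> 0 < t -> t < `|\sum_(j < n) v j| -> exists2 k, (k < n)%N & t / 2 < `|v k|.
Proof.
move=> dl0 sv nd t0 h.
have [[k [kn vk]]|none] := pselect (exists k, (k < n)%N /\ dl < `|v k|).
  exists k => //; have := sep_dist dl0 sv kn vk.
  have := ler_normD (\sum_(j < n) v j - v k) (v k).
  by rewrite subrK; lra.
exfalso; suff : `|\sum_(j < n) v j| <= n%:R * dl by lra.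
apply: le_trans (ler_norm_sum _ _ _) _.
rewrite mulr_natl -[n in leRHS]card_ord -sumr_const.
by apply: ler_sum => j _; rewrite leNgt; apply/negP => vj; apply: none; exists j.
Qed.

End separation.

(** * Levels of the images *)

Section union_bounds.
Context {R : realType} {d : measure_display} {T : measurableType d}.
Variable nu : {measure set T -> \bar R}.

Lemma union_le (A : nat -> set T) n (l : nat -> R) : (forall k, measurable (A k)) ->
  (forall k, (k < n)%N -> (nu (A k) <= (l k)%:E)%E) ->
  (nu (\big[setU/set0]_(k < n) A k) <= (\sum_(k < n) l k)%:E)%E.
Proof.
move=> mA; elim: n => [|n IH] h; first by rewrite !big_ord0 measure0.
rewrite !big_ord_recr/= EFinD.
apply: le_trans (measureU2 _ _ _) _ => //; first exact: measurable_bigsetU_ord.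
by apply: leeD; [apply: IH => k kn; apply: h; exact: ltnW|exact: h].
Qed.

Lemma disjoint_union_ge (A : nat -> set T) (X : set T) n (l : nat -> R) (e : R) :
  (forall k, measurable (A k)) -> measurable X -> (nu X <= e%:E)%E ->
  (forall k, (k < n)%N -> ((l k)%:E <= nu (A k))%E) ->
  (forall j k t, (j < k < n)%N -> A j t -> A k t -> X t) ->
  ((\sum_(k < n) l k - n%:R * e)%:E <= nu (\big[setU/set0]_(k < n) A k))%E.
Proof.
move=> mA mX Xe; elim: n => [|n IH] lA AX.
  by rewrite !big_ord0 mul0r subr0 measure0.
rewrite !big_ord_recr/=.
set U := \big[setU/set0]_(k < n) A k.
have mU : measurable U by exact: measurable_bigsetU_ord.
have -> : U `|` A n = U `|` (A n `\` U).
  apply/seteqP; split => t [Ut|]; [by left| |by left|by case=> ? _; right].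
  by move=> At; have [Ut|Ut] := pselect (U t); [left|right].
rewrite measureU//; last 2 first.
- exact: measurableD.
- by apply/seteqP; split => // t [? []].
have AUX : A n `&` U `<=` X.
  rewrite /U -bigcup_mkord => t [An [k kn Ak]].
  by apply: (AX k n t) => //; rewrite kn /=.
have h1 : ((l n)%:E <= nu (A n `\` U) + e%:E)%E.
  apply: le_trans (lA n (ltnSn n)) _.
  apply: (@le_trans _ _ (nu ((A n `\` U) `|` X))).
    apply: le_measure; rewrite ?inE//; first by apply: measurableU => //; exact: measurableD.
    by move=> t At; have [Ut|Ut] := pselect (U t); [right; exact: AUX|left].
  apply: le_trans (measureU2 _ _ _) _ => //; first exact: measurableD.
  by rewrite leeD2l.
have IH' : ((\sum_(k < n) l k - n%:R * e)%:E <= nu U)%E.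
  apply: IH => [k kn|j k t /andP[jk kn]]; first by apply: lA; exact: ltnW.
  by apply: AX; rewrite jk ltnW.
rewrite -natr1 mulrDl mul1r.
have -> : \sum_(k < n) l k + l n - (n%:R * e + e) = (\sum_(k < n) l k - n%:R * e) + (l n - e) by ring.
rewrite EFinD; apply: leeD => //.
by rewrite EFinB leeBlDr.
Qed.

Lemma overlap (D : nat -> set T) n (e : R) : (forall k, measurable (D k)) ->
  (forall j k, (j < k)%N -> (nu (D j `&` D k) <= e%:E)%E) -> 0 <= e ->
  exists X, [/\ measurable X, (nu X <= (n%:R ^+ 2 * e)%:E)%E &
    forall j k t, (j < k < n)%N -> D j t -> D k t -> X t].
Proof.
move=> mD De e0.
pose Y k := \big[setU/set0]_(j < n) (if (j < k)%N then D j `&` D k else set0).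
have mI j k : measurable (if (j < k)%N then D j `&` D k else set0).
  by case: ifP => // _; exact: measurableI.
have mY k : measurable (Y k).
  exact: (measurable_bigsetU_ord (A := fun j => if (j < k)%N then D j `&` D k else set0)).
exists (\big[setU/set0]_(k < n) Y k); split.
- exact: measurable_bigsetU_ord.
- have hY k : (nu (Y k) <= (n%:R * e)%:E)%E.
    have := @union_le (fun j => if (j < k)%N then D j `&` D k else set0) n (fun=> e).
    rewrite sumr_const card_ord mulr_natl; apply => // j _.
    by case: ifP => [/De//|_]; rewrite measure0 lee_fin.
  have := @union_le Y n (fun=> n%:R * e) mY (fun k _ => hY k).
  by rewrite sumr_const card_ord -[X in (X%:E)%E]mulr_natl mulrA.
- move=> j k t /andP[jk kn] Dj Dk; rewrite -bigcup_mkord; exists k => //.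
  rewrite /Y (bigD1 (Ordinal (ltn_trans jk kn)))//=; left.
  by rewrite jk.
Qed.

(** Off [X] at most one summand exceeds [dl] and the others add up to at most s/2, so the sum
    exceeds s/2 where a summand exceeds s. The loss counts [X] once for every term made disjoint and
    once for the points of [X] themselves. *)
Lemma near_disjoint_lower (h : nat -> T -> R) n (s dl e : R) (l : nat -> R) X :
  (forall k, measurable_fun setT (h k)) -> measurable X -> (nu X <= e%:E)%E -> 0 <= e ->
  (forall t, ~ X t -> sep dl n (h ^~ t)) -> 0 < dl -> n%:R * dl <= s / 2 ->
  (forall k, (k < n)%N -> ((l k)%:E <= nu [set t | (s < `|h k t|)%R])%E) ->
  ((\sum_(k < n) l k - n.+1%:R * e)%:E <= nu [set t | (s / 2 < `|\sum_(k < n) h k t|)%R])%E.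
Proof.
move=> mh mX Xe e0 hsep dl0 nd hl.
pose A k := [set t | s < `|h k t|].
have mA k : measurable (A k) by exact: measurable_gt_norm.
have AX j k t : (j < k < n)%N -> A j t -> A k t -> X t.
  move=> jkn Aj Ak; apply: contrapT => nX; apply: (hsep _ nX j k jkn).
  have n1 : 1 <= n%:R :> R by rewrite ler1n (leq_trans _ (proj2 (andP jkn))).
  have d1 : dl <= n%:R * dl by rewrite ler_peMl// ltW.
  by move: Aj Ak; rewrite /A /=; lra.
have := disjoint_union_ge mA mX Xe hl AX; set U := \big[setU/set0]_(k < n) A k => hU.
have mU : measurable U by exact: measurable_bigsetU_ord.
have mS : measurable [set t | s / 2 < `|\sum_(k < n) h k t|].
  by apply: measurable_gt_norm; exact: measurable_sum.
rewrite -natr1 mulrDl mul1r opprD addrA EFinB leeBlDr//.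
apply: le_trans hU _.
apply: (@le_trans _ _ (nu ([set t | s / 2 < `|\sum_(k < n) h k t|] `|` X))).
  apply: le_measure; rewrite ?inE//; first exact: measurableU.
  move=> t; rewrite /U -bigcup_mkord => -[k kn Ak].
  have [Xt|nX] := pselect (X t); first by right.
  by left; exact: sep_lower (hsep _ nX) kn nd Ak.
by apply: le_trans (measureU2 _ _ _) _ => //; rewrite leeD2l.
Qed.

Lemma near_disjoint_upper (h : nat -> T -> R) n (t dl e : R) (l : nat -> R) X :
  (forall k, measurable_fun setT (h k)) -> measurable X -> (nu X <= e%:E)%E ->
  (forall t, ~ X t -> sep dl n (h ^~ t)) -> 0 <= dl -> n%:R * dl <= t / 2 -> 0 < t ->
  (forall k, (k < n)%N -> (nu [set y | (t / 2 < `|h k y|)%R] <= (l k)%:E)%E) ->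
  (nu [set y | (t < `|\sum_(k < n) h k y|)%R] <= (\sum_(k < n) l k + e)%:E)%E.
Proof.
move=> mh mX Xe hsep dl0 nd t0 hl.
pose A k := [set y | t / 2 < `|h k y|].
have mA k : measurable (A k) by exact: measurable_gt_norm.
have mU : measurable (\big[setU/set0]_(k < n) A k) by exact: measurable_bigsetU_ord.
apply: (@le_trans _ _ (nu ((\big[setU/set0]_(k < n) A k) `|` X))).
  apply: le_measure; rewrite ?inE//.
  - by apply: measurable_gt_norm; exact: measurable_sum.
  - exact: measurableU.
  - move=> y /= hy; have [Xy|nX] := pselect (X y); first by right.
    left; rewrite -bigcup_mkord.
    by have [k kn hk] := sep_upper dl0 (hsep _ nX) nd t0 hy; exists k.
apply: le_trans (measureU2 _ _ _) _ => //.
by rewrite EFinD; apply: leeD => //; exact: union_le.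
Qed.

Lemma ae_eq_fun_gt (f g : T -> R) c : measurable_fun setT f -> measurable_fun setT g ->
  ae_eq_fun nu f g -> nu [set t | c < `|f t|] = nu [set t | c < `|g t|].
Proof.
move=> mf mg [N [mN N0 hN]]; apply/eqP; rewrite eq_le.
by apply/andP; split; apply: (measure_le_ae _ _ mN N0);
  [exact: measurable_gt_norm|exact: measurable_gt_norm|idtac|exact: measurable_gt_norm|exact: measurable_gt_norm|idtac] => t /= h;
  have [e|/hN] := pselect (f t = g t); [left; rewrite -?e ?e in h *|right|left; rewrite -?e ?e in h *|right].
Qed.

End union_bounds.

Section growth.
Context {R : realType} {d : measure_display} {T : measurableType d}.
Variables (mu : {measure set T -> \bar R}) (E : set T).
Hypotheses (mE : measurable E) (Efin : (mu E < +oo)%E) (E0 : 0 < fine (mu E)).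

(** By orthogonality the second moment of the sum is at least c n m, but a weak bound linear in n
    allows only order n^(2/p) m, and 2/p < 1. The number n depends on the constants alone, so it is
    available before the functions are chosen. *)
Lemma no_linear_growth (p c K : R) : 2 < p -> 0 < c -> exists2 n, (0 < n)%N &
  forall x : nat -> T -> R, (forall k, unit_on E (x k)) ->
  (forall k, orth mu E x k (x k)) ->
  (forall k, c * fine (mu E) <= \int[mu]_(t in E) (x k t ^+ 2)) ->
  ~ wb mu p (fun t => \sum_(k < n) 1 * x k t) (n%:R * K * fine (mu E)).
Proof.
pose m := fine (mu E); have m0 : 0 < m by [].
move=> p2 c0; pose q := (p / 2)^-1; pose D := (1 + cI (p / 2)) * K `^ q.
have q1 : 0 < 1 - q by rewrite subr_gt0 /q invf_lt1; lra.
have [n n0 hn] := powR_unbounded (D / c) q1.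
exists n => // x x1 xo xc w; have n0' : 0 < n%:R :> R by rewrite ltr0n.
have a1 : forall k : nat, `|1 : R| <= 1 by move=> _; rewrite normr1.
have nKm := wb_ge0 w.
have K0 : 0 <= K by rewrite pmulr_lge0// pmulr_rge0// in nKm.
have := moment2_weak (a := fun=> 1) mE Efin x1 p2 w; rewrite (moment2 mE Efin (fun=> 1) x1 xo) -/m -/q.
apply/negP; rewrite -ltNge.
apply: (@lt_le_trans _ _ (n%:R * (c * m))); last first.
  rewrite mulr_natl -[X in _ *+ X](card_ord n) -sumr_const.
  by apply: ler_sum => k _; rewrite expr1n mul1r.
have nK : 0 <= n%:R * K by rewrite mulr_ge0.
rewrite (powRM q nK (ltW m0)) (powRM q (ltW n0') K0).
have em : m `^ q * m `^ (1 - q) = m by rewrite -powRD_gt0// addrC subrK powRr1// ltW.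
rewrite (_ : _ * _ * m `^ (1 - q) = D * n%:R `^ q * m); last first.
  by rewrite -[m in RHS]em /D; ring.
rewrite mulrA ltr_pM2r//.
have -> : n%:R * c = n%:R `^ (1 - q) * n%:R `^ q * c.
  by rewrite -powRD_gt0// subrK powRr1// ltW.
rewrite [ltRHS]mulrAC ltr_pM2r ?powR_gt0//.
by move: hn; rewrite ltr_pdivrMr.
Qed.

End growth.

Section levels.
Context {R : realType} {d : measure_display} {T : measurableType d}
  {d' : measure_display} {T' : measurableType d'}.
Variables (mu : {measure set T -> \bar R}) (nu : {measure set T' -> \bar R}).
Variables (p : R) (J : (T -> R) -> (T' -> R)).
Hypotheses (p1 : 1 < p) (emb : weakLp_embedding mu nu p J).

Let p0 : 0 < p. Proof. by apply: lt_trans p1. Qed.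

(** The tail of the image at [t] is as large, up to [eps], as a function with bound [m] may have it
    there. *)
Definition level (m eps t : R) (u : T -> R) :=
  ((eps * t `^ (- p) * m)%:E <= nu [set y | (t < `|J u y|)%R])%E.

Lemma embedding_gt (h : nat -> T -> R) (a : nat -> R) n c :
  (forall k, weakLp mu p (h k)) ->
  nu [set y | c < `|J (fun t => \sum_(k < n) a k * h k t) y|] =
  nu [set y | c < `|\sum_(k < n) a k * J (h k) y|].
Proof.
move=> hL; apply: ae_eq_fun_gt.
- by apply: embedding_measurable emb _ _; exact: weakLp_sum.
- apply: measurable_sum => k; apply: measurable_funM => //.
  exact: embedding_measurable emb _ _.
- exact: (embedding_sum p1 emb).
Qed.

Lemma embedding_lower : exists2 eps, 0 < eps & forall u (m : R), weakLp mu p u -> 0 < m ->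
  ~ wb mu p u m -> exists2 t, 0 < t & level m eps t u.
Proof.
have [C C0 hC] := embedding_wb p1 emb; exists C^-1; first by rewrite invr_gt0.
move=> u m uL m0 nw; apply: contrapT => none; apply: nw.
have K0 : 0 <= C^-1 * m by rewrite mulr_ge0// ltW// invr_gt0.
have -> : m = C * (C^-1 * m) by rewrite mulVKf// gt_eqF.
apply: (hC _ _ uL K0).2 => c c0; rewrite leNgt; apply/negP => h.
by apply: none; exists c => //; rewrite /level mulrAC; exact: ltW.
Qed.

End levels.

Section nonatomic_levels.
Context {R : realType} {d : measure_display} {T : measurableType d}
  {d' : measure_display} {T' : measurableType d'}.
Variables (mu : {measure set T -> \bar R}) (nu : {measure set T' -> \bar R}).
Variables (p : R) (J : (T -> R) -> (T' -> R)).
Hypotheses (p1 : 1 < p) (emb : weakLp_embedding mu nu p J) (pa : purely_atomic nu).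
Variable (E : set T).
Hypotheses (na : purely_non_atomic mu) (mE : measurable E) (Efin : (mu E < +oo)%E)
  (E0 : 0 < fine (mu E)).

Let p0 : 0 < p. Proof. by apply: lt_trans p1. Qed.
Let m := fine (mu E).

Lemma tame_weakLp u : tame mu E p u -> weakLp mu p u.
Proof.
move=> hu; apply/(weakLp_wb mu p1); split; first by case: hu.
by exists (11 * m); [rewrite mulr_ge0// ltW|exact: tame_wb].
Qed.

Lemma rademacher_subsequence (x : nat -> T -> R) (dl e : R) :
  (forall k, unit_on E (x k)) ->
  (forall (y : nat -> nat) n m, (forall k, (k < n)%N -> (y k < m)%N) ->
        orth mu E (fun k => x (y k)) n (x m)) -> 0 < dl -> 0 < e ->
  exists y : nat -> nat, (forall n, orth mu E (fun k => x (y k)) n (x (y n))) /\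
    forall k n, (k < n)%N -> (nu ([set t | (dl < `|J (x (y k)) t|)%R] `&`
        [set t | (dl < `|J (x (y n)) t|)%R]) <= e%:E)%E.
Proof.
move=> x1 xo dl0 e0.
pose adm (y : nat -> nat) n := [set i | forall k, (k < n)%N -> (y k < i)%N].
have [||||||y [_ [yadm yov]]] := @near_extract _ _ _ _ _ mu nu p J p1 emb pa nat x \oo _ adm
  (fun n => n%:R `^ Num.max 1 (p - 1) * m) _ _ _ _ _ (fun=> setT) dl e _ dl0 e0.
- by move=> i; apply: tame_weakLp; exact: unit_on_tame.
- move=> y z n yz; apply/seteqP; split => i h k kn; have := h k kn; by rewrite yz.
- move=> y n; exists (\sum_(k < n) (y k).+1)%N => // i /= hi k kn.
  apply: leq_trans hi; rewrite (bigD1 (Ordinal kn))//=; exact: leq_addr.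
- move=> y n a yadm a1.
  apply: (@S_wb _ _ _ mu E mE Efin (fun k => x (y k)) a) => // [k|k]; last by rewrite a1.
  by apply: xo => j; exact: yadm.
- by move=> e' e'0; apply: powR_little_o => //; rewrite gt_max p1; lra.
- move=> n Q /= [N _ hN]; by exists N => //; apply: hN => /=.
exists y; split; first by move=> n; apply: xo => k; exact: yadm.
by move=> k n kn; apply: ltW; exact: yov.
Qed.

Lemma not_wb_half (f : T -> R) : (forall t, E t -> 1 <= `|f t|) -> measurable_fun setT f ->
  ~ wb mu p f (m / (2 `^ p) / 2).
Proof.
move=> f1 mf h; have h2 : 0 < (2^-1 : R) by rewrite invr_gt0.
have := h _ h2; apply/negP; rewrite -ltNge.
apply: (@lt_le_trans _ _ (mu E)); last first.
  apply: le_measure; rewrite ?inE//; first exact: measurable_gt_norm.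
  move=> t Et /=; apply: lt_le_trans (f1 t Et); lra.
rewrite -[ltRHS]fineK ?ge0_fin_numE// lte_fin -/m.
have -> : (2^-1 : R) `^ (- p) = 2 `^ p by rewrite -[2^-1]powR_inv1// -powRrM mulN1r opprK.
rewrite (_ : _ * 2 `^ p = m / 2); first by have := E0; rewrite /m; lra.
by field; rewrite gt_eqF// powR_gt0.
Qed.

(** Suppose that all levels of tame functions lie between 1/M and M. If p <= 2, a sum of n
    Rademacher functions divided by sqrt n is tame, but as the images are almost disjoint it has a
    level of order 1/sqrt n. If p > 2, the images being almost disjoint between these levels gives
    the sum a weak bound linear in n, against [no_linear_growth]. *)
Theorem levels_unbounded : exists2 eps, 0 < eps & forall M, 0 < M -> exists u t,
  [/\ tame mu E p u, 0 < t, t < M^-1 \/ M < t & level nu p J m eps t u].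
Proof.
apply: contrapT => none.
have {none} bounded eps : 0 < eps -> exists2 M, 0 < M & forall u t,
    tame mu E p u -> 0 < t -> level nu p J m eps t u -> M^-1 <= t <= M.
  move=> eps0; apply: contrapT => h; apply: none; exists eps => // M M0.
  apply: contrapT => h2; apply: h; exists M => // u t tu t0 lu.
  rewrite !leNgt -negb_or; apply/negP => /orP h3; apply: h2; by exists u, t.
have [x [x1 x2 xo]] := rademacher na mE Efin.
have xt k : tame mu E p (x k) by exact: unit_on_tame.
have xL k : weakLp mu p (x k) by exact: tame_weakLp.
have mJx k : measurable_fun setT (J (x k)) by exact: embedding_measurable emb _ _.
have [p2|p2] := leP p 2.
  have [eps eps0 heps] := embedding_lower p1 emb.
  pose eps1 := eps / (2 `^ p) / 2.
  have eps10 : 0 < eps1 by rewrite !divr_gt0// powR_gt0.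
  have xl k : exists2 t, 0 < t & level nu p J m eps1 t (x k).
    have [||t t0 ht] := heps (x k) (m / (2 `^ p) / 2) (xL k).
    - by rewrite !divr_gt0// powR_gt0.
    - apply: not_wb_half; last by case: (x1 k).
      by move=> t Et; rewrite -[leLHS](normr1 R) -(ler_pXn2r (_ : (0 < 2)%N))// ?nnegrE// !real_normK ?num_real// x2 ?expr1n.
    exists t => //; move: ht; rewrite /level /eps1.
    by congr (_%:E <= _)%E; ring.
  have [M M0 hM] := bounded _ eps10.
  pose l := eps1 * M `^ (- p) * m.
  have l0 : 0 < l by rewrite !mulr_gt0// powR_gt0.
  pose s := M^-1 / 2.
  have s0 : 0 < s by rewrite divr_gt0// invr_gt0.
  have xs k : (l%:E <= nu [set y | (s < `|J (x k) y|)%R])%E.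
    have [t t0 lt] := xl k; have /andP[Mt tM] := hM _ _ (xt k) t0 lt.
    apply: (@le_trans _ _ ((eps1 * t `^ (- p) * m)%:E)).
      rewrite lee_fin /l ler_pM2r// ler_pM2l// !powRN lef_pV2 ?posrE ?powR_gt0//.
      by apply: ge0_ler_powR; rewrite ?nnegrE ?(ltW t0) ?(ltW M0) ?(ltW p0).
    apply: le_trans lt _; apply: le_measure; rewrite ?inE; [exact: measurable_gt_norm..|].
    by move=> y /=; apply: lt_trans; apply: lt_le_trans Mt; rewrite /s ltr_pdivrMr// ltr_pMr ?invr_gt0// ltr1n.
  (* Makes the level inequality at s / (2 sqrt n) hold for all n at once; p <= 2 enters through
     (sqrt n)^p <= n. *)
  pose eps2 := eps1 * M `^ (- p) / 2 * (s / 2) `^ p.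
  have eps20 : 0 < eps2 by rewrite !mulr_gt0 ?invr_gt0 ?powR_gt0// divr_gt0.
  have [L L0 hL] := bounded _ eps20.
  have lev n : (0 < n)%N -> L^-1 <= s / 2 / Num.sqrt n%:R.
    move=> n0; have n0' : 0 < n%:R :> R by rewrite ltr0n.
    have q0 : 0 < Num.sqrt n%:R :> R by rewrite sqrtr_gt0.
    have dl0 : 0 < s / 2 / n%:R by do 2 apply: divr_gt0 => //.
    pose e := l / 2 / n.+1%:R.
    have e0 : 0 < e by do 2 apply: divr_gt0 => //.
    have e'0 : 0 < e / n%:R ^+ 2 by rewrite divr_gt0 ?exprn_gt0.
    have [y [yo yov]] := rademacher_subsequence x1 xo dl0 e'0.
    have [|X [mX Xe hX]] := overlap n _ yov (ltW e'0); first by move=> k; exact: measurable_gt_norm.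
    have {}Xe : (nu X <= e%:E)%E by move: Xe; rewrite mulrC divfK// gt_eqF ?exprn_gt0.
    have p12 : 1 < p <= 2 by rewrite p1.
    have ut := tame_normalized_sum mE Efin p12 n0 (fun k => x1 (y k)) yo.
    set u := (fun t => _) in ut.
    have uE : u = fun t => \sum_(k < n) (Num.sqrt n%:R)^-1 * x (y k) t.
      by apply/funext => t; rewrite /u mulr_sumr; apply: eq_bigr => k _; rewrite mul1r.
    have t0 : 0 < s / 2 / Num.sqrt n%:R by do 2 apply: divr_gt0 => //.
    suff lu : level nu p J m eps2 (s / 2 / Num.sqrt n%:R) u by have /andP[] := hL _ _ ut t0 lu.
    rewrite /level uE (embedding_gt p1 emb (h := fun k => x (y k)) (fun=> (Num.sqrt n%:R)^-1))//.
    rewrite (_ : [set z | _] = [set z | s / 2 < `|\sum_(k < n) J (x (y k)) z|]); last first.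
      have e2 z : (s / 2 / Num.sqrt n%:R < `|\sum_(k < n) (Num.sqrt n%:R)^-1 * J (x (y k)) z|) =
          (s / 2 < `|\sum_(k < n) J (x (y k)) z|).
        by rewrite -mulr_sumr normrM gtr0_norm ?invr_gt0// mulrC ltr_pM2l ?invr_gt0.
      by apply/seteqP; split => z /=; rewrite e2.
    apply: le_trans (near_disjoint_lower (l := fun=> l) (fun k => mJx (y k)) mX Xe (ltW e0) _ dl0 _ _).
    - rewrite lee_fin sumr_const_ord /e.
      rewrite (_ : n.+1%:R * (l / 2 / n.+1%:R) = l / 2); last by rewrite mulrC divfK// pnatr_eq0.
      have sn : Num.sqrt n%:R `^ p <= n%:R.
        rewrite -powR12_sqrt// -powRrM -[leRHS](powRr1 (ltW n0')).
        by apply: ler_powR; [rewrite ler1n|lra].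
      rewrite (_ : eps2 * _ * m = l / 2 * Num.sqrt n%:R `^ p); last first.
        have s20 : 0 < s / 2 by rewrite divr_gt0.
        rewrite (powR_divN _ s20 q0) /eps2 /l (powRN (s / 2)).
        by field; rewrite gt_eqF// powR_gt0.
      have n1 : 1 <= n%:R :> R by rewrite ler1n.
      nra.
    - move=> z nXz j k jk [zj zk]; apply: nXz; exact: hX jk zj zk.
    - by rewrite mulrC divfK// gt_eqF.
    - by move=> k _; exact: xs.
  have [n n0 hn] := @powR_unbounded R 1 ((L * (s / 2)) ^+ 2) ltr01.
  have := lev n n0; rewrite leNgt => /negP; apply.
  have n0' : 0 < n%:R :> R by rewrite ltr0n.
  rewrite powRr1 ?ltW// in hn.
  have q0 : 0 < Num.sqrt n%:R :> R by rewrite sqrtr_gt0.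
  have s20 : 0 < s / 2 by rewrite divr_gt0.
  have Ls : 0 <= L * (s / 2) by exact: mulr_ge0 (ltW L0) (ltW s20).
  rewrite ltr_pdivrMr// ltr_pdivlMl//.
  by rewrite -(ltr_pXn2r (_ : (0 < 2)%N))// ?nnegrE ?(ltW q0)// sqr_sqrtr// ltW.
have [C C0 hC] := embedding_wb p1 emb.
have [n n0 hn] := no_linear_growth mE Efin E0 (C * (11 * C * 2 `^ p + 1)) p2 ltr01.
have n0' : 0 < n%:R :> R by rewrite ltr0n.
(* With [eps] = n^-p, having level t/n means a tail of at least m t^-p there. *)
have [M M0 hM] := bounded (n%:R `^ (- p)) (powR_gt0 _ n0').
have dl0 : 0 < (2 * M)^-1 by rewrite invr_gt0 mulr_gt0.
pose e := n%:R * m * (n%:R * M) `^ (- p).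
have e0 : 0 < e by rewrite !mulr_gt0// powR_gt0// mulr_gt0.
have e'0 : 0 < e / n%:R ^+ 2 by rewrite divr_gt0 ?exprn_gt0.
have [y [yo yov]] := rademacher_subsequence x1 xo dl0 e'0.
have [|X [mX Xe hX]] := overlap n _ yov (ltW e'0); first by move=> k; exact: measurable_gt_norm.
have {}Xe : (nu X <= e%:E)%E by move: Xe; rewrite mulrC divfK// gt_eqF ?exprn_gt0.
apply: (hn (fun k => x (y k)) (fun k => x1 (y k)) yo).
  move=> k; rewrite mul1r -[leLHS]mul1r -Rintegral_cst//.
  by apply: bdd_int_le => // [| |t Et]; [exact: bdd_cst|apply: bddX; exact: unit_on_bdd (x1 _)|rewrite x2].
have SL : weakLp mu p (fun t => \sum_(k < n) 1 * x (y k) t) by apply: (@weakLp_sum _ _ _ mu p p1 (fun k => x (y k)) (fun=> 1)) => k.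
have K0 : 0 <= n%:R * ((11 * C * 2 `^ p + 1) * m).
  by rewrite !mulr_ge0// ?(ltW E0)// addr_ge0// !mulr_ge0 ?powR_ge0// ltW.
rewrite (_ : _ * _ * m = C * (n%:R * ((11 * C * 2 `^ p + 1) * m))); last by ring.
apply: (hC _ _ SL K0).2 => t t0.
rewrite (embedding_gt p1 emb (h := fun k => x (y k)) (fun=> 1))//.
rewrite (_ : [set z | _] = [set z | t < `|\sum_(k < n) J (x (y k)) z|]); last first.
  have e2 z : \sum_(k < n) 1 * J (x (y k)) z = \sum_(k < n) J (x (y k)) z.
    by apply: eq_bigr => k _; rewrite mul1r.
  by apply/seteqP; split => z /=; rewrite e2.
have tn0 : 0 < t / n%:R by rewrite divr_gt0.
have tp : 0 < t `^ (- p) by exact: powR_gt0.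
(* If t/n lies in the range of levels, the images are almost disjoint at the threshold 1/(2M). If
   not, no image has level t/n, so each tail at t/n is below m t^-p, and the sum exceeds t only
   where some term exceeds t/n. *)
have [/andP[Mt tM]|out] := boolP (M^-1 <= t / n%:R <= M).
  have ndl : n%:R * (2 * M)^-1 <= t / 2.
    by move: Mt; rewrite ler_pdivlMr// invfM mulrCA; lra.
  apply: le_trans (near_disjoint_upper (l := fun=> C * (11 * m) * (t / 2) `^ (- p))
    (fun k => mJx (y k)) mX Xe _ (ltW dl0) ndl t0 _) _.
  - move=> z nXz j k jk [zj zk]; apply: nXz; exact: hX jk zj zk.
  - move=> k _; have w := tame_wb mE Efin p0 (xt (y k)).
    have h11 : 0 <= 11 * m by rewrite mulr_ge0// ltW.
    by apply: (hC _ _ (xL (y k)) h11).1 w _ _; rewrite divr_gt0.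
  rewrite lee_fin sumr_const_ord.
  have e1 : e <= n%:R * m * t `^ (- p).
    rewrite /e ler_pM2l ?mulr_gt0// !powRN lef_pV2 ?posrE ?powR_gt0 ?mulr_gt0//.
    apply: ge0_ler_powR; rewrite ?nnegrE ?(ltW t0) ?(ltW p0) ?(mulr_ge0 (ltW n0') (ltW M0))//.
    by move: tM; rewrite ler_pdivrMr// mulrC.
  rewrite (powR_divN _ t0 (ltr0n R 2)).
  by move: e1; lra.
have small k : (nu [set z | (t / n%:R < `|J (x (y k)) z|)%R] <= (m * t `^ (- p))%:E)%E.
  rewrite leNgt; apply/negP => h; move/negP: out; apply.
  apply: (hM _ _ (xt (y k)) tn0); rewrite /level; apply: le_trans (ltW h).
  rewrite lee_fin (powR_divN _ t0 n0').
  rewrite (_ : _ * _ * m = m * t `^ (- p) * (n%:R `^ (- p) * n%:R `^ p)); last by ring.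
  by rewrite (powRN n%:R) mulVf ?mulr1// gt_eqF// powR_gt0.
apply: (@le_trans _ _ (nu (\big[setU/set0]_(k < n) [set z | t / n%:R < `|J (x (y k)) z|]))).
  have mD k : measurable [set z | t / n%:R < `|J (x (y k)) z|] by exact: measurable_gt_norm.
  apply: le_measure; rewrite ?inE//.
  - by apply: measurable_gt_norm; apply: measurable_sum => k; exact: mJx.
  - exact: (measurable_bigsetU_ord (A := fun k => [set z | t / n%:R < `|J (x (y k)) z|])).
  - move=> z /= hz; rewrite -(bigcup_mkord n (fun k => [set z | t / n%:R < `|J (x (y k)) z|])).
    apply: contrapT => nz; move: hz; apply/negP; rewrite -leNgt.
    apply: le_trans (ler_norm_sum _ _ _) _.
    apply: (@le_trans _ _ (\sum_(k < n) t / n%:R)).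
      by apply: ler_sum => k _; rewrite leNgt; apply/negP => h; apply: nz; exists k => /=.
    by rewrite sumr_const_ord mulrC divfK// gt_eqF.
apply: le_trans (union_le (l := fun=> m * t `^ (- p)) _ (fun k _ => small k)) _.
  by move=> k; exact: measurable_gt_norm.
rewrite lee_fin sumr_const_ord.
rewrite (_ : _ * _ * t `^ _ = n%:R * (m * t `^ (- p)) + n%:R * (11 * C * 2 `^ p * m) * t `^ (- p)); last by ring.
by rewrite lerDl !mulr_ge0 ?powR_ge0 ?ltW.
Qed.

End nonatomic_levels.

(** * Sums of blocks at separated levels *)

Section doubling.
Context {R : realType}.

(** A block of weight w contributes to one level set at most its whole mass, of order w, and by its
    tail of exponent 2p at most order r^2 / w. The number of blocks does not enter the bound. *)
Lemma doubling_sum_up (w : nat -> R) (r : R) n : 0 < r -> (forall i, 0 < w i) ->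
  (forall i, 2 * w i <= w i.+1) ->
  \sum_(i < n) Num.min (w i) (r ^+ 2 / w i) <= 4 * r.
Proof.
move=> r0 w0 w2; case: n => [|n]; first by rewrite big_ord0 mulr_ge0// ltW.
(* The terms grow geometrically up to [r]; afterwards each one is at most the
   increase of [4 * r - r ^+ 2 / w n]. *)
suff : \sum_(i < n.+1) Num.min (w i) (r ^+ 2 / w i) <=
    (if w n < r then 2 * w n else 4 * r - r ^+ 2 / w n).
  move/le_trans; apply; case: ifP => h; first by lra.
  by rewrite gerBl divr_ge0 ?exprn_ge0// ltW.
have minl i : Num.min (w i) (r ^+ 2 / w i) <= w i by rewrite ge_min lexx.
have minr i : Num.min (w i) (r ^+ 2 / w i) <= r ^+ 2 / w i by rewrite ge_min lexx orbT.
have quot i : r <= w i -> r ^+ 2 / w i <= r.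
  by move=> h; rewrite ler_pdivrMr// expr2 ler_pM2l.
elim: n => [|n IH].
  rewrite big_ord1; case: ifP => h; have := minl 0%N; have := minr 0%N; have := w0 0%N; first lra.
  by have := quot 0%N; rewrite leNgt h => /(_ isT); lra.
rewrite big_ord_recr/=; have hw := w2 n; have hw0 := w0 n.
case: ifP => h.
  by move: IH; rewrite (_ : w n < r); [have := minl n.+1; lra|lra].
have hq := quot n.+1; rewrite leNgt h in hq; have {}hq := hq isT.
move: IH; case: ifP => h2 IH.
  by have := minr n.+1; lra.
have : 2 * (r ^+ 2 / w n.+1) <= r ^+ 2 / w n.
  rewrite mulrCA ler_pM2l ?exprn_gt0// ler_pdivrMr//.
  by rewrite ler_pdivlMl// mulrC.
by have := minr n.+1; lra.
Qed.

(** Decreasing weights are reduced to increasing ones by passing to 1/w and 1/r and multiplying by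
    r^2, which swaps the two entries of the minimum. *)
Lemma doubling_sum (w : nat -> R) (r : R) n : 0 < r -> (forall i, 0 < w i) ->
  (forall i, 2 * w i <= w i.+1) \/ (forall i, 2 * w i.+1 <= w i) ->
  \sum_(i < n) Num.min (w i) (r ^+ 2 / w i) <= 4 * r.
Proof.
move=> r0 w0 [|w2]; first exact: doubling_sum_up.
have v0 i : 0 < (w i)^-1 by rewrite invr_gt0.
have v2 i : 2 * (w i)^-1 <= (w i.+1)^-1.
  by rewrite -ler_pdivlMl// -invfM lef_pV2 ?posrE ?mulr_gt0// mulrC.
have rV : 0 < r^-1 by rewrite invr_gt0.
have := doubling_sum_up n rV v0 v2.
rewrite -(ler_pM2l (exprn_gt0 2 r0)) mulr_sumr.
rewrite (_ : r ^+ 2 * (4 * r^-1) = 4 * r); last by field; rewrite gt_eqF.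
apply: le_trans; apply: ler_sum => i _.
rewrite (minr_pMr _ _ (exprn_ge0 2 (ltW r0))) le_min !ge_min.
have -> : r ^+ 2 * (r^-1 ^+ 2 / (w i)^-1) = w i.
  by rewrite invrK exprVn; field; rewrite gt_eqF.
by rewrite !lexx /= orbT.
Qed.

(** The sequence [b] runs through block 0, block 1 and so on, repeating [i] exactly [N i] times. *)
Lemma block_sum (N : nat -> nat) K : exists n (b : nat -> nat),
  (forall k, (k < n)%N -> (b k < K)%N) /\
  forall F : nat -> R, \sum_(k < n) F (b k) = \sum_(i < K) (N i)%:R * F i.
Proof.
elim: K => [|K [n [b [bK hb]]]].
  by exists 0%N, (fun=> 0%N); split => // F; rewrite !big_ord0.
exists (n + N K)%N, (fun k => if (k < n)%N then b k else K); split.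
  by move=> k kn; case: ifP => // /bK /ltnW.
move=> F; rewrite big_split_ord big_ord_recr/= -hb; congr (_ + _).
  by apply: eq_bigr => k _; rewrite ltn_ord.
rewrite (eq_bigr (fun=> F K)); last by move=> k _; rewrite ltnNge leq_addr.
by rewrite sumr_const_ord.
Qed.

(** An explicit positive lower bound for finitely many positive numbers. *)
Lemma inv_sum_le (t : nat -> R) n k : (forall i, 0 < t i) -> (k < n)%N ->
  (1 + \sum_(i < n) (t i)^-1)^-1 <= t k.
Proof.
move=> t0 kn; rewrite -[leRHS]invrK lef_pV2 ?posrE ?invr_gt0//; last first.
  by rewrite ltr_wpDr// sumr_ge0// => i _; rewrite invr_ge0 ltW.
rewrite (bigD1 (Ordinal kn))//= addrCA lerDl addr_ge0// sumr_ge0// => i _.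
by rewrite invr_ge0 ltW.
Qed.

End doubling.

Section block_combination.
Context {R : realType} {d : measure_display} {T : measurableType d}
  {d' : measure_display} {T' : measurableType d'}.
Variables (mu : {measure set T -> \bar R}) (nu : {measure set T' -> \bar R}).
Variables (p : R) (J : (T -> R) -> (T' -> R)).
Hypotheses (p1 : 1 < p) (emb : weakLp_embedding mu nu p J) (pa : purely_atomic nu).
Context {I : Type} (phi : I -> T -> R) (FF : set_system I) {FFf : Filter FF}.
Variables (adm : (nat -> I) -> nat -> set I) (om : nat -> R).
Hypothesis phiL : forall i, weakLp mu p (phi i).
Hypothesis adm_dep : initial_dep adm.
Hypothesis adm_FF : forall x n, FF (adm x n).
Hypothesis om_wb : forall x n (a : nat -> R),
  (forall k, adm x k (x k)) -> (forall k, `|a k| = 1) ->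
  wb mu p (fun t => \sum_(k < n) a k * phi (x k) t) (om n).
Hypothesis om_o : forall e, 0 < e -> exists2 n, (0 < n)%N & om n < e * n%:R `^ p.

(** After division by its level every image exceeds 1 on a set of measure at least [l i]. The images
    are chosen so nearly disjoint that at least half of the total measure survives in the sum, at
    the level 1/2. *)
Lemma block_combination (P : nat -> set I) (t l : nat -> R) (N : nat -> nat) K :
  (forall i, positive_set FF (P i)) -> (forall i, 0 < t i) ->
  (forall i z, P i z -> ((l i)%:E <= nu [set y | (t i < `|J (phi z) y|)%R])%E) ->
  0 < \sum_(i < K) (N i)%:R * l i ->
  exists n b x, [/\ forall k, (k < n)%N -> (b k < K)%N,
    forall F : nat -> R, \sum_(k < n) F (b k) = \sum_(i < K) (N i)%:R * F i,
    forall k, P (b k) (x k), forall k, adm x k (x k) &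
    (((\sum_(i < K) (N i)%:R * l i) / 2)%:E <=
      nu [set y | (1 / 2 < `|J (fun z => (\sum_(k < n) (t (b k))^-1 * phi (x k) z)%R) y|)%R])%E].
Proof.
move=> Ppos t0 hl L0; have [n [b [bK hb]]] := block_sum (R := R) N K.
pose L := \sum_(i < K) (N i)%:R * l i.
have n0 : (0 < n)%N.
  by rewrite lt0n; apply/eqP => e; move: L0; rewrite -hb e big_ord0 ltxx.
have n0' : 0 < n%:R :> R by rewrite ltr0n.
(* [tau] lies below every level in use: images separated at the threshold [dl * tau] stay separated
   at [dl] after division by any of the levels. *)
pose tau := (1 + \sum_(i < K) (t i)^-1)^-1.
have tau0 : 0 < tau.
  by rewrite invr_gt0 ltr_wpDr// sumr_ge0// => i _; rewrite invr_ge0 ltW.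
pose dl : R := (2 * n%:R)^-1.
have dl0 : 0 < dl by rewrite invr_gt0 mulr_gt0.
pose e := L / 2 / n.+1%:R; have e0 : 0 < e by rewrite /e; do 2 apply: divr_gt0 => //.
have e'0 : 0 < e / n%:R ^+ 2 by rewrite divr_gt0 ?exprn_gt0.
have [x [Px [ax ov]]] := near_extract p1 emb pa phiL adm_dep adm_FF om_wb om_o
  (fun k => Ppos (b k)) (mulr_gt0 dl0 tau0) e'0.
have mJ i : measurable_fun setT (J (phi i)) by exact: embedding_measurable emb _ _.
have [||X [mX Xe hX]] := overlap (nu := nu) (D := fun k => [set y | dl * tau < `|J (phi (x k)) y|]) n _ _ (ltW e'0).
- by move=> k; exact: measurable_gt_norm.
- by move=> j k jk; exact: ltW (ov _ _ jk).
have {}Xe : (nu X <= e%:E)%E by move: Xe; rewrite mulrC divfK// gt_eqF ?exprn_gt0.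
exists n, b, x; split => //.
rewrite (embedding_gt p1 emb (h := fun k => phi (x k)) (fun k => (t (b k))^-1))//.
apply: le_trans (near_disjoint_lower (h := fun k y => (t (b k))^-1 * J (phi (x k)) y)
  (l := fun k => l (b k)) _ mX Xe (ltW e0) _ dl0 _ _).
- rewrite lee_fin hb -/L /e (_ : n.+1%:R * (L / 2 / n.+1%:R) = L / 2); first by lra.
  by rewrite mulrC divfK// pnatr_eq0.
- by move=> k; exact: measurable_funM.
- move=> z nX j k /andP[jk kn] [zj zk]; apply: nX.
  have h i : (i < n)%N -> dl < `|(t (b i))^-1 * J (phi (x i)) z| -> dl * tau < `|J (phi (x i)) z|.
    move=> i_n; rewrite normrM gtr0_norm ?invr_gt0// mulrC ltr_pdivlMr//.
    by apply: le_lt_trans; rewrite ler_pM2l//; apply: inv_sum_le => //; exact: bK.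
  apply: (hX j k z); [by rewrite jk|apply: h => //; exact: ltn_trans kn|exact: h].
- by rewrite /dl invfM mulrCA mulfV ?gt_eqF// mulr1 mul1r.
- move=> k kn; apply: le_trans (hl _ _ (Px k)) _; apply: le_measure; rewrite ?inE.
  + exact: measurable_gt_norm.
  + by apply: measurable_gt_norm; exact: measurable_funM.
  + by move=> z /= h; rewrite normrM gtr0_norm ?invr_gt0// mulrC ltr_pdivlMr// mul1r.
Qed.

End block_combination.

(** * The sigma-finite part *)

Section sigma_finite_part.
Context {R : realType} {d : measure_display} {T : measurableType d}
  {d' : measure_display} {T' : measurableType d'}.
Variables (mu : {measure set T -> \bar R}) (nu : {measure set T' -> \bar R}).
Variables (p : R) (J : (T -> R) -> (T' -> R)).
Hypotheses (p1 : 1 < p) (emb : weakLp_embedding mu nu p J) (pa : purely_atomic nu).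
Hypothesis na : purely_non_atomic mu.

Let p0 : 0 < p. Proof. by apply: lt_trans p1. Qed.

Definition sf Z := measurable Z /\ sigma_finite Z mu.

Lemma sf_bigcup (Z : nat -> set T) : (forall n, sf (Z n)) -> sf (\bigcup_n Z n).
Proof.
move=> hZ; split; first by apply: bigcup_measurable => n _; case: (hZ n).
have /choice[F hF] n : exists F : nat -> set T, Z n = \bigcup_i F i /\
    forall i, measurable (F i) /\ (mu (F i) < +oo)%E.
  by case: (hZ n) => _ [F e h]; exists F.
exists (fun k => if @unpickle (nat * nat)%type k is Some ij then F ij.1 ij.2 else set0).
  apply/seteqP; split => t.
    move=> [i _]; case: (hF i) => -> _ [j _ Ft]; exists (pickle (i, j)) => //.
    by rewrite pickleK.
  move=> [k _]; case: unpickle => [ij Ft|//]; exists ij.1 => //.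
  by case: (hF ij.1) => -> _; exists ij.2.
move=> k; case: unpickle => [ij|]; first by case: (hF ij.1) => _.
by rewrite measure0.
Qed.

Lemma sf_finite Z : measurable Z -> (mu Z < +oo)%E -> sf Z.
Proof.
move=> mZ Zf; split => //; exists (fun=> Z) => //.
by rewrite bigcup_const//; exists 0%N.
Qed.

Lemma sf0 : sf set0.
Proof. by apply: sf_finite => //; rewrite measure0. Qed.

(** A tame function bundled with its carrier. All carriers have the same measure, so that one notion
    of level serves for all of them. *)
Definition exact_tame (m : R) := {Eu : set T * (T -> R) |
  [/\ measurable Eu.1, mu Eu.1 = m%:E & tame mu Eu.1 p Eu.2]}.

(** The properties that hold for all carriers avoiding some sigma-finite set. *)
Definition off_sf (m : R) : set_system (exact_tame m) :=
  [set P | exists2 Z, sf Z & forall i, (sval i).1 `<=` ~` Z -> P i].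
Arguments off_sf : clear implicits.

#[local] Instance off_sf_filter m : Filter (off_sf m).
Proof.
split; first by exists set0; [exact: sf0|].
  move=> P Q [Z sZ hP] [Y sY hQ]; exists (Z `|` Y).
    by rewrite -bigcup2E; apply: sf_bigcup => -[|[|n]] //=; exact: sf0.
  move=> i hi; split; [apply: hP|apply: hQ] => t Et Zt; apply: (hi t Et); by [left|right].
by move=> P Q PQ [Z sZ hP]; exists Z => // i hi; apply: PQ; exact: hP.
Qed.

Definition disjoint_from m (x : nat -> exact_tame m) n : set (exact_tame m) :=
  [set i | forall k, (k < n)%N -> (sval (x k)).1 `&` (sval i).1 = set0].

Section fixed_measure.
Variable m : R.
Hypothesis m0 : 0 < m.
Hypothesis large : forall Z, sf Z ->
  exists E, [/\ measurable E, E `<=` ~` Z & mu E = m%:E].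

Let u (i : exact_tame m) := (sval i).2.
Let sE (i : exact_tame m) := (sval i).1.

Let mE i : measurable (sE i). Proof. by case: (svalP i). Qed.
Let muE i : fine (mu (sE i)) = m. Proof. by case: (svalP i) => _ ->. Qed.
Let Efin i : (mu (sE i) < +oo)%E. Proof. by case: (svalP i) => _ -> _; rewrite ltry. Qed.
Let tE i : tame mu (sE i) p (u i). Proof. by case: (svalP i). Qed.
Let mu_ i : measurable_fun setT (u i). Proof. by case: (tE i). Qed.

Let uL i : weakLp mu p (u i).
Proof. by apply: (tame_weakLp p1 (mE i) (Efin i) _ (tE i)); rewrite muE. Qed.

Let sep_u (x : nat -> exact_tame m) (a : nat -> R) n t :
  (forall k, disjoint_from x k (x k)) -> sep 0 n (fun k => a k * u (x k) t).
Proof.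
move=> dx j k /andP[jk kn]; rewrite !normr_gt0 => -[h1 h2].
have uE i : u i t != 0 -> sE i t.
  by move=> h; apply: contrapT => nE; case: (tE i) h => _ /(_ t nE) ->; rewrite eqxx.
suff : set0 t by [].
by rewrite -(dx k j jk); split; apply: uE; [move: h1|move: h2]; rewrite mulf_eq0 negb_or => /andP[].
Qed.

(** Otherwise, for each constant 1/(k+1), every level outside some interval from 1/M to M is
    excluded off a sigma-finite set. Only countably many such sets may be discarded, so this is done
    for rational levels; a set of measure m disjoint from all of them contradicts
    [levels_unbounded]. Replacing a level t by a rational in (t/2, t) costs the factor 2^p. *)
Lemma level_positive : exists2 eps, 0 < eps & forall M, 0 < M -> exists t,
  [/\ 0 < t, t < M^-1 \/ M < t &
      positive_set (off_sf m) [set i | level nu p J m eps t (u i)]].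
Proof.
apply: contrapT => none.
have {none} /choice[M hM] k : exists M, 0 < M /\ forall t, 0 < t -> t < M^-1 \/ M < t ->
    ~ positive_set (off_sf m) [set i | level nu p J m k.+1%:R^-1 t (u i)].
  apply: contrapT => h; apply: none; exists k.+1%:R^-1; first by rewrite invr_gt0.
  move=> M M0; apply: contrapT => h2; apply: h; exists M; split => // t t0 tM Pt.
  by apply: h2; exists t.
have /choice[Z hZ] (kq : nat * rat) : exists Z, sf Z /\ (0 < ratr kq.2 :> R ->
    (ratr kq.2 < (M kq.1)^-1 \/ M kq.1 < ratr kq.2) -> forall i, sE i `<=` ~` Z ->
    ~ level nu p J m kq.1.+1%:R^-1 (ratr kq.2) (u i)).
  have [[q0 qM]|h] := pselect (0 < ratr kq.2 :> R /\ (ratr kq.2 < (M kq.1)^-1 \/ M kq.1 < ratr kq.2)); last first.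
    by exists set0; split; [exact: sf0|move=> ? ?; case: h].
  have [_ /(_ _ q0 qM) /not_positive[Y sY hY]] := hM kq.1.
  by exists Y; split => // _ _ i /hY.
pose W n := if @unpickle (nat * rat)%type n is Some kq then Z kq else set0.
have sW : sf (\bigcup_n W n).
  by apply: sf_bigcup => n; rewrite /W; case: unpickle => [kq|]; [case: (hZ kq)|exact: sf0].
have [E [mE' EW Em]] := large sW.
have Efin' : (mu E < +oo)%E by rewrite Em ltry.
have Em' : fine (mu E) = m by rewrite Em.
have E0 : 0 < fine (mu E) by rewrite Em'.
have [eps eps0 heps] := levels_unbounded p1 emb pa na mE' Efin' E0.
have e2 : 0 < eps / 2 `^ p by rewrite divr_gt0// powR_gt0.
pose k := Num.truncn (eps / 2 `^ p)^-1.
have hk : k.+1%:R^-1 <= eps / 2 `^ p.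
  rewrite -[leRHS]invrK lef_pV2 ?posrE ?invr_gt0//; apply: ltW; exact: truncnS_gt.
have [M0 _] := hM k.
(* [2 * M k] leaves the margin that keeps the rational level in (t/2, t) outside the excluded
   interval. *)
have [v [t [tv t0 tM lv]]] := heps _ (mulr_gt0 (ltr0n R 2) M0).
have [q /andP[q1 q2]] : exists q : rat, t / 2 < ratr q < t.
  have : t / 2 < t by lra.
  by move=> /rat_in_itvoo[q]; rewrite in_itv/= => h; exists q.
have q0 : 0 < ratr q :> R by apply: lt_trans q1; rewrite divr_gt0.
have qM : ratr q < (M k)^-1 \/ M k < ratr q.
  case: tM => h; [left|right]; last by lra.
  apply: lt_trans q2 (lt_trans h _); rewrite ltf_pV2 ?posrE ?mulr_gt0//; lra.
have [_ hq] := hZ (k, q).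
pose i : exact_tame m := exist _ (E, v) (And3 mE' Em tv).
apply: (hq q0 qM i).
  by move=> z Ez Zz; apply: (EW z Ez); exists (pickle (k, q)) => //; rewrite /W pickleK.
have hqp : (ratr q) `^ (- p) <= (t / 2) `^ (- p).
  have t2 : 0 < t / 2 by rewrite divr_gt0.
  rewrite !powRN lef_pV2 ?posrE ?powR_gt0//.
  by apply: ge0_ler_powR; rewrite ?nnegrE ?(ltW p0) ?(ltW q0) ?(ltW q1) ?(ltW t2).
have kV : 0 <= k.+1%:R^-1 :> R by rewrite invr_ge0.
have qp := powR_ge0 (ratr q) (- p).
rewrite /level; apply: (@le_trans _ _ (nu [set y | t < `|J v y|])).
  apply: le_trans lv; rewrite lee_fin Em' ler_pM2r//.
  apply: (@le_trans _ _ (eps / 2 `^ p * (t / 2) `^ (- p))).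
    exact: ler_pM.
  rewrite powR_divN// (_ : _ * _ = eps * t `^ (- p)); first by [].
  by field; rewrite gt_eqF// powR_gt0.
have vL : weakLp mu p v := tame_weakLp p1 mE' Efin' E0 tv.
have mJv : measurable_fun setT (J v) by exact: embedding_measurable emb _ _.
apply: le_measure; rewrite ?inE; [exact: measurable_gt_norm..|].
by move=> y /=; exact: lt_trans.
Qed.

(** Either arbitrarily large levels occur, or the levels are bounded above and must come arbitrarily
    close to 0. *)
Lemma spread_sequence (Q : R -> Prop) :
  (forall M, 0 < M -> exists t, [/\ 0 < t, t < M^-1 \/ M < t & Q t]) ->
  exists t : nat -> R, (forall i, 0 < t i /\ Q (t i)) /\
    ((forall i, 2 * t i <= t i.+1) \/ (forall i, 2 * t i.+1 <= t i)).
Proof.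
move=> h.
have [up|/existsNP[M1 nup]] := pselect (forall M, 0 < M -> exists t, M < t /\ Q t).
  have /choice[f hf] M : exists t, 0 < M -> M < t /\ Q t.
    by have [/up[t ht]|nM] := pselect (0 < M); [exists t|exists 0].
  pose t := fix t n := if n is m.+1 then f (2 * t m) else f 1.
  have ht i : 0 < t i /\ Q (t i).
    elim: i => [|i [ti _]] /=.
      by have [h1 Q1] := hf 1 ltr01; split => //; exact: lt_trans h1.
    have t2 : 0 < 2 * t i by rewrite mulr_gt0.
    by have [h1 Q1] := hf _ t2; split => //; exact: lt_trans h1.
  exists t; split => //; left => i /=.
  have t2 : 0 < 2 * t i by rewrite mulr_gt0//; case: (ht i).
  by have [h1 _] := hf _ t2; exact: ltW.
have [M10 nM1] : 0 < M1 /\ forall t, Q t -> t <= M1.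
  have M10 : 0 < M1 by apply: contrapT => n; apply: nup => /n.
  split => // t Qt; rewrite leNgt; apply/negP => Mt; apply: nup => _; by exists t.
have /choice[f hf] M : exists t, 0 < M -> [/\ 0 < t, t < M & Q t].
  have [M0|nM] := pselect (0 < M); last by exists 0.
  have s0 : 0 < M1 + M^-1 by rewrite addr_gt0// invr_gt0.
  have [t [t0 [tM|Mt] Qt]] := h _ s0; exists t => _; split => //.
    apply: lt_le_trans tM _; rewrite -[leRHS]invrK lef_pV2 ?posrE ?invr_gt0//.
    by rewrite lerDr ltW.
  have Mi : 0 < M^-1 by rewrite invr_gt0.
  by have := nM1 _ Qt; lra.
pose t := fix t n := if n is m.+1 then f (t m / 2) else f 1.
have ht i : 0 < t i /\ Q (t i).
  elim: i => [|i [ti _]] /=; first by have [] := hf 1 ltr01.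
  have t2 : 0 < t i / 2 by rewrite divr_gt0.
  by have [] := hf _ t2.
exists t; split => //; right => i /=.
have t2 : 0 < t i / 2 by rewrite divr_gt0//; case: (ht i).
have [_ h1 _] := hf _ t2; move: h1; lra.
Qed.

Lemma tame_min i c : 0 < c ->
  (mu [set z | (c < `|u i z|)%R] <= (11 * m * Num.min 1 (c `^ (- p) ^+ 2))%:E)%E.
Proof.
move=> c0; rewrite minr_pMr ?mulr_ge0 ?(ltW m0)// mulr1 EFin_min le_min; apply/andP; split.
  apply: (@le_trans _ _ (mu (sE i))).
    apply: le_measure; rewrite ?inE//; first exact: measurable_gt_norm.
    move=> t /= h; apply: contrapT => nE; move: h; case: (tE i) => _ -> // _.
    by rewrite normr0 ltNge ltW.
  by rewrite -[leLHS]fineK ?ge0_fin_numE// lee_fin muE; have := m0; lra.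
case: (tE i) => _ _ /(_ c c0) /le_trans; apply.
have -> : c `^ (- p) ^+ 2 = c `^ (- (2 * p)).
  by rewrite -powR_mulrn ?powR_ge0// -powRrM mulNr mulrC.
by rewrite muE.
Qed.

Let sum_wb (x : nat -> exact_tame m) n (a : nat -> R) :
  (forall k, disjoint_from x k (x k)) -> (forall k, `|a k| = 1) ->
  wb mu p (fun t => \sum_(k < n) a k * u (x k) t) (n%:R * (11 * m * 2 `^ p)).
Proof.
move=> dx a1 c c0.
have c2 : 0 < c / 2 by rewrite divr_gt0.
have := @near_disjoint_upper _ _ _ mu (fun k z => a k * u (x k) z) n c 0 0
  (fun=> 11 * m * (c / 2) `^ (- p)) set0 _ _ _ (fun t _ => @sep_u x a n t dx) _ _ c0 _.
rewrite addr0 sumr_const_ord powR_divN// => h.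
rewrite (_ : n%:R * (11 * m * 2 `^ p) * c `^ (- p) = n%:R * (11 * m * (c `^ (- p) * 2 `^ p))); last by ring.
apply: h => //.
- by move=> k; exact: measurable_funM.
- by rewrite measure0.
- by rewrite mulr0 ltW.
- move=> k _; rewrite (_ : [set y | _] = [set y | c / 2 < `|u (x k) y|]).
    by have := tame_wb (mE (x k)) (Efin (x k)) p0 (tE (x k)) c2; rewrite muE powR_divN.
  by apply/seteqP; split => z /=; rewrite normrM a1 mul1r.
Qed.

(** Block i has about kap t_i^p functions on disjoint carriers, divided by t_i. Its image adds at
    least kap eps m to the tail at 1/2, whereas [doubling_sum] bounds the whole combination
    independently of the number [K] of blocks. *)
Lemma no_fixed_measure : False.
Proof.
have [eps eps0 heps] := level_positive.
have [t [ht tsep]] := spread_sequence heps.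
have t0 i : 0 < t i by case: (ht i).
have Pt i := (ht i).2.
pose w i := t i `^ p; have w0 i : 0 < w i by exact: powR_gt0.
have wsep : (forall i, 2 * w i <= w i.+1) \/ (forall i, 2 * w i.+1 <= w i).
  have two : 2 <= 2 `^ p :> R by rewrite -[leLHS]powRr1// ler_powR// ?ler1n// ltW.
  have mono a b : 0 < a -> 2 * a <= b -> 2 * a `^ p <= b `^ p.
    move=> a0 ab; apply: (@le_trans _ _ (2 `^ p * a `^ p)); first by rewrite ler_pM2r// powR_gt0.
    rewrite -powRM ?(ltW a0)//; apply: ge0_ler_powR; rewrite ?nnegrE ?(ltW p0)//.
      by rewrite mulr_ge0// ltW.
    by apply: le_trans ab; rewrite mulr_ge0// ltW.
  by case: tsep => h; [left|right] => i; exact: mono.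
have [C C0 hC] := embedding_wb p1 emb.
(* 88 = 2 x 11 x 4: rounding the block sizes, the tail constant of tame functions, and
   [doubling_sum]; 2^p is the price of halving the level. *)
pose A : R := 88 * 2 `^ p.
pose K := (Num.truncn (C * A * 2 `^ p * 2 / eps)).+1.
have hK : C * A * 2 `^ p * 2 < K%:R * eps by rewrite -ltr_pdivrMr//; exact: truncnS_gt.
(* So large that [kap * w i >= 1] for all blocks in use; rounding up to the integer [N i] then costs
   at most a factor 2. *)
pose kap := 1 + \sum_(i < K) (w i)^-1.
have kap0 : 0 < kap by rewrite ltr_wpDr// sumr_ge0// => i _; rewrite invr_ge0 ltW.
have kapw i : (i < K)%N -> 1 <= kap * w i.
  move=> iK; have := inv_sum_le w0 iK; rewrite -/kap => h.
  by rewrite -ler_pdivrMl// mulr1.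
pose N i := (Num.truncn (kap * w i)).+1.
have N1 i : kap * w i <= (N i)%:R by apply: ltW; exact: truncnS_gt.
have N2 i : (i < K)%N -> (N i)%:R <= 2 * (kap * w i).
  move=> /kapw h; have kw : 0 <= kap * w i by apply: le_trans h.
  by have /andP[h1 _] := truncn_itv kw; rewrite /N -natr1; lra.
pose l i := eps * t i `^ (- p) * m.
have lw i : l i = eps * m / w i by rewrite /l powRN /w; ring.
have L1 : K%:R * (kap * eps * m) <= \sum_(i < K) (N i)%:R * l i.
  rewrite -sumr_const_ord; apply: ler_sum => i _; rewrite lw.
  rewrite (_ : kap * eps * m = kap * w i * (eps * m / w i)); last by field; rewrite gt_eqF.
  by rewrite ler_pM2r// divr_gt0// mulr_gt0.
have K0 : 0 < K%:R :> R by rewrite ltr0n.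
have L0 : 0 < \sum_(i < K) (N i)%:R * l i.
  by apply: lt_le_trans L1; rewrite !mulr_gt0.
have om_o e : 0 < e -> exists2 n, (0 < n)%N & n%:R * (11 * m * 2 `^ p) < e * n%:R `^ p.
  by move=> e0; have [n n0 hn] := powR_little_o (11 * m * 2 `^ p) p1 e0; exists n => //; rewrite powRr1 in hn.
have [|||n [b [x [bK hb Px dx hlow]]]] := @block_combination _ _ _ _ _ mu nu p J p1 emb pa _ u (off_sf m) _
  (@disjoint_from m) (fun n => n%:R * (11 * m * 2 `^ p)) uL _ _ sum_wb om_o _ t l N K Pt t0 _ L0.
- move=> x y n xy; apply/seteqP; split => i h k kn; have := h k kn; by rewrite xy.
- move=> x n; exists (\bigcup_k (if (k < n)%N then sE (x k) else set0)).
    apply: sf_bigcup => k; case: ifP => _; [exact: sf_finite|exact: sf0].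
  move=> i hi k kn; apply/seteqP; split => // z [Ek Ei]; apply: (hi z Ei).
  by exists k => //; rewrite kn.
- by move=> i z; apply.
pose F z := \sum_(k < n) (t (b k))^-1 * u (x k) z.
have FL : weakLp mu p F.
  by apply: (@weakLp_sum _ _ _ mu p p1 (fun k => u (x k)) (fun k => (t (b k))^-1)) => k.
have wF : wb mu p F (kap * m * A).
  move=> c c0; have c2 : 0 < c / 2 by rewrite divr_gt0.
  pose r := (c / 2) `^ (- p); have r0 : 0 < r by exact: powR_gt0.
  have hup := @near_disjoint_upper _ _ _ mu (fun k z => (t (b k))^-1 * u (x k) z) n c 0 0
    (fun k => 11 * m * Num.min 1 (r ^+ 2 / w (b k) ^+ 2)) set0 _ _ _
    (fun z _ => @sep_u x (fun k => (t (b k))^-1) n z dx) _ _ c0 _.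
  apply: le_trans (hup _ _ _ _ _ _) _ => //.
  - by move=> k; exact: measurable_funM.
  - by rewrite measure0.
  - by rewrite mulr0 ltW.
  - move=> k _; have ct : 0 < c / 2 * t (b k) by rewrite mulr_gt0.
    rewrite (_ : [set y | _] = [set y | c / 2 * t (b k) < `|u (x k) y|]).
      have := tame_min (x k) ct; rewrite powRM ?(ltW c2) ?(ltW (t0 _))// exprMn -/r.
      by rewrite powRN exprVn.
    have e2 z : (c / 2 < `|(t (b k))^-1 * u (x k) z|) = (c / 2 * t (b k) < `|u (x k) z|).
      by rewrite normrM gtr0_norm ?invr_gt0// [X in _ < X]mulrC ltr_pdivlMr.
    by apply/seteqP; split => z /=; rewrite e2.
  rewrite addr0 lee_fin (hb (fun i => 11 * m * Num.min 1 (r ^+ 2 / w i ^+ 2))).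
  apply: (@le_trans _ _ (\sum_(i < K) 22 * m * kap * Num.min (w i) (r ^+ 2 / w i))).
    apply: ler_sum => i _.
    have -> : Num.min (w i) (r ^+ 2 / w i) = w i * Num.min 1 (r ^+ 2 / w i ^+ 2).
      by rewrite minr_pMr ?(ltW (w0 _))// mulr1; congr Num.min; field; rewrite gt_eqF.
    set mn := Num.min 1 _; have mn0 : 0 <= mn.
      by rewrite le_min ler01 divr_ge0 ?exprn_ge0// ltW.
    rewrite (_ : 22 * m * kap * (w i * mn) = 2 * (kap * w i) * (11 * m * mn)); last by ring.
    by apply: ler_wpM2r; [rewrite !mulr_ge0// ltW|exact: N2].
  rewrite -mulr_sumr; apply: (@le_trans _ _ (22 * m * kap * (4 * r))).
    by apply: ler_wpM2l; [rewrite !mulr_ge0// ltW|exact: doubling_sum].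
  by rewrite /r powR_divN// /A le_eqVlt; apply/orP; left; apply/eqP; ring.
have KA : 0 <= kap * m * A by exact: wb_ge0 wF.
have := (hC _ _ FL KA).1 wF (1 / 2) (divr_gt0 ltr01 (ltr0n R 2)).
have -> : (1 / 2 : R) `^ (- p) = 2 `^ p by rewrite powR_divN// powR1 mul1r.
move=> h; have := le_trans hlow h; rewrite lee_fin.
apply/negP; rewrite -ltNge.
apply: (@lt_le_trans _ _ (K%:R * (kap * eps * m) / 2)); last by rewrite ler_pM2r ?invr_gt0.
rewrite (_ : C * (kap * m * A) * 2 `^ p = C * A * 2 `^ p * 2 * (kap * m / 2)); last by field.
rewrite (_ : K%:R * (kap * eps * m) / 2 = K%:R * eps * (kap * m / 2)); last by ring.
by rewrite ltr_pM2r// divr_gt0// mulr_gt0.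
Qed.

End fixed_measure.
(** If there is no such [Z], sets of positive finite measure exist off every sigma-finite set, but
    their measures may shrink. A common value 1/(n+1) exists: were each n refuted by some [Z n], a
    set off the union of these would contain, by [nonatomic_intermediate], a subset of measure
    1/(n+1) for some n. *)
Theorem sigma_finite_support : exists Z, sf Z /\
  forall s, measurable s -> s `<=` ~` Z -> mu s = 0%E \/ mu s = +oo%E.
Proof.
apply: contrapT => none.
have pos Z : sf Z -> exists s, [/\ measurable s, s `<=` ~` Z, (mu s < +oo)%E & 0 < fine (mu s)].
  move=> sZ; apply: contrapT => h; apply: none; exists Z; split => // s ms sZ'.
  have [->|s0] := eqVneq (mu s) 0%E; [by left|right].
  apply: contrapT => /eqP sy; apply: h; exists s.
  have sf' : (mu s < +oo)%E by rewrite lt_neqAle sy leey.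
  split => //; rewrite lt_neqAle fine_ge0// andbT eq_sym; apply: contra_neq s0 => h.
  by rewrite -[LHS]fineK ?h// ge0_fin_numE.
suff [n hn] : exists n : nat, forall Z, sf Z ->
    exists E, [/\ measurable E, E `<=` ~` Z & mu E = (n.+1%:R^-1)%:E].
  by apply: (no_fixed_measure (m := n.+1%:R^-1)) => //; rewrite invr_gt0.
apply: contrapT => h.
have /choice[Z hZ] n : exists Z, sf Z /\ forall E, measurable E -> E `<=` ~` Z ->
    mu E <> (n.+1%:R^-1)%:E.
  apply: contrapT => h2; apply: h; exists n => Z sZ; apply: contrapT => h3; apply: h2.
  by exists Z; split => // E mE EZ e; apply: h3; exists E.
have [s [ms sZ sfin s0]] := pos _ (sf_bigcup (fun n => (hZ n).1)).
pose n := Num.truncn (fine (mu s))^-1.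
have hn : n.+1%:R^-1 <= fine (mu s).
  by rewrite -[leRHS]invrK lef_pV2 ?posrE ?invr_gt0//; apply: ltW; exact: truncnS_gt.
have [|E [mE Es Em]] := @nonatomic_intermediate _ _ _ mu na s n.+1%:R^-1 ms sfin.
  by rewrite invr_ge0 ler0n.
by apply: ((hZ n).2 E mE _ Em) => t /Es /sZ nt Zt; apply: nt; exists n.
Qed.

End sigma_finite_part.

(** * Countable generation *)

Section conditional_expectation.
Context {R : realType} {d : measure_display} {T : measurableType d}.
Variables (mu : {measure set T -> \bar R}) (G : set (set T)) (E : set T).
Hypotheses (mG : G `<=` measurable) (GE : G E) (Efin : (mu E < +oo)%E).

Let T' := g_sigma_algebraType G.

Lemma sigma_sub B : <<s G >> B -> measurable B.
Proof. by apply: smallest_sub => //; exact: sigma_algebra_measurable. Qed.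

Let mE : measurable E. Proof. exact: mG. Qed.

Lemma sub_measure : exists m' : {measure set T' -> \bar R}, forall B, m' B = mu B.
Proof.
pose n' : set T' -> \bar R := fun B => mu (B : set T).
have n0 : n' set0 = 0%E by rewrite /n' measure0.
have nge0 B : (0 <= n' B)%E by exact: measure_ge0.
have nsig : semi_sigma_additive n'.
  move=> F mF tF mUF; apply: (@measure_semi_sigma_additive _ _ _ mu) => //.
    by move=> i; apply: sigma_sub; exact: mF.
  exact: sigma_sub.
pose c : {measure set T' -> \bar R} :=
  HB.pack n' (isMeasure.Build _ _ _ n' n0 nge0 nsig).
by exists c.
Qed.

(** The density, on the coarser measurable space, of the measure of intersections with [A];
    [weak_limit] is applied to a constant sequence and acts as the Radon-Nikodym theorem. *)
Lemma conditional_expectation A : measurable A -> exists g : T -> R,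
  [/\ forall Y, measurable Y -> <<s G >> (g @^-1` Y), forall t, 0 <= g t <= 1 &
   forall B, <<s G >> B -> B `<=` E -> \int[mu]_(t in B) (\1_A t - g t) = 0].
Proof.
move=> mA; have [m' m'E] := sub_measure.
have mE' : measurable (E : set T') by exact: sub_sigma_algebra.
have Efin' : (m' E < +oo)%E by rewrite m'E.
have [U [UF Uoo]] := ultraFilterLemma (@eventually_filter).
pose mm (n : nat) (B : set T') : R := fine (mu (A `&` (B `&` E))).
have mI (B : set T') : measurable B -> measurable (A `&` (B `&` E) : set T).
  by move=> mB; apply: measurableI => //; apply: measurableI => //; exact: sigma_sub.
have fI (B : set T') : measurable B -> (mu (A `&` (B `&` E)) < +oo)%E.
  by move=> mB; apply: fin_subset Efin; [exact: mI|exact: mE|move=> t [_ []]].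
have [||||g0 [mg0 ig0 hg0]] := @weak_limit R _ T' m' U UF E 1 1 mm mE' Efin'.
- exact: ler01.
- exact: ltr01.
- move=> n B C mB mC BC; rewrite /mm setIUl setIUr fine_muU//; [exact: mI|exact: mI| |exact: fI|exact: fI].
  apply/seteqP; split => // t [[_ [Bt _]] [_ [Ct _]]].
  by have : (B `&` C) t by []; rewrite BC.
- move=> n B mB; rewrite mul1r powRr1 ?fine_ge0// ger0_norm ?fine_ge0// m'E.
  apply: fine_mu_le; [exact: mI|by apply: measurableI => //; exact: sigma_sub|exact: subIsetr|].
  by apply: fin_subset Efin; [by apply: measurableI => //; exact: sigma_sub|exact: mE|exact: subIsetr].
have g0E (B : set T') : measurable B -> B `<=` E -> \int[m']_(t in B) g0 t = fine (mu (A `&` B)).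
  move=> mB BE; have := hg0 B mB; rewrite /mm (setIidl BE) => h.
  by apply/esym; apply: (cvg_unique _ _ h) => //; exact: cvg_cst.
have igS (B : set T') : measurable B -> B `<=` E -> m'.-integrable B (EFin \o g0).
  by move=> mB BE; exact: integrableS ig0.
have null (B : set T') (phi : T' -> R) : measurable B -> measurable_fun setT phi ->
    m'.-integrable B (EFin \o phi) ->
    (forall C : set T', measurable C -> C `<=` B -> \int[m']_(t in C) phi t = 0) ->
    (forall t, B t -> phi t <> 0) -> mu B = 0%E.
  move=> mB mphi iphi h0 hn; have := Rintegral_ae_zero mB mphi iphi h0.
  move=> hae; suff : m' B = 0%E by rewrite m'E.
  apply/negligibleP => //.
  by apply: negligibleS hae => t Bt /= h; exact: hn Bt (h Bt).
pose N0 : set T' := E `&` g0 @^-1` `]-oo, 0[.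
pose N1 : set T' := E `&` g0 @^-1` `]1, +oo[.
have mN0 : measurable N0 by apply: measurableI => //; rewrite -[X in measurable X]setTI; exact: mg0.
have mN1 : measurable N1 by apply: measurableI => //; rewrite -[X in measurable X]setTI; exact: mg0.
have iC0 (C : set T') c : measurable C -> C `<=` E -> m'.-integrable C (EFin \o (fun=> c)).
  move=> mC CE; apply: measurable_bounded_integrable => //; last exact: bounded_cst.
  by rewrite m'E; apply: (fin_subset (sigma_sub mC) mE CE Efin).
have ic0 (C : set T') c : measurable C -> \int[m']_(t in C) c = c * fine (mu C).
  by move=> mC; rewrite Rintegral_cst// m'E.
have N00 : mu N0 = 0%E.
  apply: (null _ g0) => //; first by apply: igS => //; exact: subIsetl.
    move=> C mC CN; have CE : C `<=` E by move=> t /CN[].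
    apply/eqP; rewrite eq_le; apply/andP; split; last by rewrite g0E ?fine_ge0.
    rewrite -[leRHS](mul0r (fine (mu C))) -ic0//; apply: le_Rintegral => //; [exact: igS|exact: iC0|].
    by move=> t /CN[_ /=]; rewrite in_itv/=; exact: ltW.
  by move=> t [_ /=]; rewrite in_itv/= => h e; rewrite e ltxx in h.
have N10 : mu N1 = 0%E.
  have mg1 : measurable_fun setT (fun t => g0 t - 1) by apply: measurable_funB => //; exact: measurable_cst.
  have ig1 (C : set T') : measurable C -> C `<=` E ->
      \int[m']_(t in C) (g0 t - 1) = \int[m']_(t in C) g0 t - fine (mu C).
    by move=> mC CE; rewrite RintegralB//; [rewrite ic0// mul1r|exact: igS|exact: iC0].
  apply: (null _ (fun t => g0 t - 1)) => //.
  - rewrite (_ : (fun t => g0 t - 1) = fun t => 1 * g0 t + (-1)); last by apply/funext => t; rewrite mul1r.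
    have N1E : N1 `<=` E by exact: subIsetl.
    exact: integrable_lin mN1 (igS _ mN1 N1E) (iC0 _ _ mN1 N1E).
  - move=> C mC CN; have CE : C `<=` E by move=> t /CN[].
    have mC' := sigma_sub mC; have Cf : (mu C < +oo)%E by apply: fin_subset Efin => //; exact: mE.
    apply/eqP; rewrite eq_le; apply/andP; split.
      rewrite ig1// subr_le0 g0E//; apply: fine_mu_le => //; exact: measurableI.
    by apply: Rintegral_ge0 => t /CN[_ /=]; rewrite in_itv/= andbT subr_ge0; exact: ltW.
  - by move=> t [_ /=]; rewrite in_itv/= andbT -subr_gt0 => h e; rewrite e ltxx in h.
(* The density lies in [0, 1] only almost everywhere on [E]; replacing it by 0 off [D] gives the
   bounds everywhere and keeps it measurable for the coarser sigma-algebra. *)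
pose D : set T' := E `\` (N0 `|` N1).
have mD : measurable D by apply: measurableD => //; exact: measurableU.
have D01 t : D t -> 0 <= g0 t <= 1.
  move=> [Et nN]; apply/andP; split; rewrite leNgt; apply/negP => h; apply: nN; [left|right];
  by split => //=; rewrite in_itv/= ?andbT.
pose g (t : T') : R := \1_D t * g0 t.
have mg : measurable_fun setT g by apply: measurable_funM => //; exact: measurable_indic.
have g01 t : 0 <= g t <= 1.
  rewrite /g indicE; have [Dt|nD] := pselect (D t).
    by rewrite mem_set// mul1r; exact: D01.
  by rewrite memNset// mul0r lexx ler01.
exists g; split => //.
  by move=> Y mY; have := mg measurableT Y mY; rewrite setTI.
have mgT : measurable_fun setT (g : T -> R).
  by move=> _ Y mY; rewrite setTI; apply: sigma_sub; have := mg measurableT Y mY; rewrite setTI.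
have bg : bdd (g : T -> R).
  by split => //; exists 1 => t; have /andP[h1 h2] := g01 t; rewrite ger0_norm.
have bA : bdd (\1_A : T -> R).
  split; first exact: measurable_indic.
  by exists 1 => t; rewrite indicE; case: (_ \in _); rewrite ?normr1 ?normr0.
move=> B sB BE; have mB := sigma_sub sB.
have Bfin : (mu B < +oo)%E by exact: fin_subset mB mE BE Efin.
have mB' : measurable (B : set T') by [].
have transfer : \int[m']_(t in B) g t = \int[mu]_(t in B) g t.
  have e : (m' : set T' -> \bar R) = pushforward mu (idfun : T -> T').
    by apply/funext => Z; rewrite m'E.
  rewrite /Rintegral; congr fine.
  transitivity (\int[pushforward mu (idfun : T -> T')]_(t in B) (EFin \o g) t)%E.
    by rewrite -e.
  apply: (@integral_pushforward _ _ T T') => //.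
  - by move=> _ Y mY; rewrite setTI; exact: sigma_sub.
  - exact/measurable_EFinP.
  - exact: bdd_integrable.
have gB : \int[m']_(t in B) g t = fine (mu (A `&` B)).
  rewrite -(g0E B mB' BE) /Rintegral; congr fine.
  have mN : measurable (N0 `|` N1) by exact: measurableU.
  have N0' : m' (N0 `|` N1) = 0%E by rewrite measureU0// m'E.
  have ig : m'.-integrable B (EFin \o g).
    apply: measurable_bounded_integrable => //; [by rewrite m'E|exact: measurable_funTS|].
    exists 1; split; [exact: num_real|move=> x x1 t Bt /=].
    by have /andP[h1 h2] := g01 t; rewrite ger0_norm// (le_trans h2)// ltW.
  rewrite [LHS](negligible_integral mN mB' ig N0') [RHS](negligible_integral mN mB' (igS _ mB' BE) N0').
  apply: eq_integral => t; rewrite inE => -[Bt nN] /=.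
  by rewrite /g indicE mem_set ?mul1r//; split => //; exact: BE.
rewrite (_ : (fun t => _) = fun t => \1_A t + (-1) * g t); last by apply/funext => t; rewrite mulN1r.
rewrite (bdd_intD mB Bfin) ?(bdd_intZ mB Bfin)//; last exact: bddZ.
rewrite -transfer gB /Rintegral integral_indic// mulN1r; exact: subrr.
Qed.

End conditional_expectation.

Section level_sets.
Context {R : realType} {d : measure_display} {T : measurableType d}.
Variables (mu : {measure set T -> \bar R}) (E : set T).
Hypotheses (mE : measurable E) (Efin : (mu E < +oo)%E).

(** [H] is within e of a step function on its level sets of width e, and [f] integrates to 0 over
    each of these. *)
Lemma integral_zero_levels (f H : T -> R) : bdd f -> bdd H ->
  (forall a b, \int[mu]_(t in E `&` [set t | a <= H t < b]) f t = 0) ->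
  \int[mu]_(t in E) (H t * f t) = 0.
Proof.
move=> bf bH hf; have [mf [L hL]] := bf; have [mH [M hM]] := bH.
have L0 : 0 <= L by apply: le_trans (hL point).
have M0 : 0 <= M by apply: le_trans (hM point).
apply/eqP; rewrite -normr_le0; apply/ler_addgt0Pr => e' e'0; rewrite add0r.
pose m := fine (mu E); have m0 : 0 <= m by exact: fine_ge0.
pose e := e' / (L * m + 1).
have Lm : 0 < L * m + 1 by rewrite ltr_wpDl// mulr_ge0.
have e0 : 0 < e by rewrite divr_gt0.
pose n := (Num.truncn ((M + M) / e)).+1.
pose a (j : nat) := j%:R * e - M.
pose C j := E `&` [set t | a j <= H t < a j.+1].
have Cj j t : C j t -> j = Num.truncn ((H t + M) / e).
  move=> [_ /= /andP[h1 h2]]; apply/esym/truncn_def.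
  rewrite ler_pdivlMr// ltr_pdivrMr//; move: h1 h2; rewrite /a; lra.
have mC j : measurable (C j).
  apply: measurableI => //; rewrite -[X in measurable X]setTI.
  rewrite (_ : [set t | _] = H @^-1` `[a j, a j.+1[); first exact: mH.
  by apply/seteqP; split => t /=; rewrite in_itv.
have dC : disj_fam C by move=> i j t /Cj -> /Cj ->.
have EC : E = \big[setU/set0]_(j < n) C j.
  rewrite -bigcup_mkord; apply/seteqP; split => [t Et|t [j _ []]//].
  have := hM t; rewrite ler_norml => /andP[h1 h2].
  have HM0 : 0 <= (H t + M) / e by rewrite divr_ge0 ?(ltW e0)//; lra.
  have /andP[k1 k2] := truncn_itv HM0.
  exists (Num.truncn ((H t + M) / e)).
    rewrite /n /= ltnS; apply: le_truncn; rewrite ler_pM2r ?invr_gt0//; lra.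
  split => //=; rewrite /a; rewrite ler_pdivlMr// in k1; rewrite ltr_pdivrMr// in k2.
  by apply/andP; split; lra.
have Cfin j : (mu (C j) < +oo)%E by apply: fin_subset Efin => //; exact: subIsetl.
have bHf : bdd (fun t => H t * f t) by exact: bddM.
rewrite (Rintegral_partition EC mC dC (bdd_integrable mE Efin bHf)).
have -> : e' = \sum_(j < n) e * (L * fine (mu (C j))) + e.
  have := Rintegral_partition EC mC dC (bdd_integrable mE Efin (bdd_cst 1)).
  rewrite Rintegral_cst// mul1r -/m => hm.
  rewrite -mulr_sumr -mulr_sumr (_ : \sum_(j < n) _ = m).
    by rewrite /e; field; rewrite gt_eqF.
  by rewrite hm; apply: eq_bigr => j _; rewrite Rintegral_cst// mul1r.
apply: le_trans (ler_norm_sum _ _ _) _; rewrite -[leLHS]addr0; apply: lerD; last exact: ltW.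
apply: ler_sum => j _.
have bHa : bdd (fun t => (H t + - a j) * f t).
  by apply: bddM => //; apply: bddD => //; exact: bdd_cst.
rewrite (_ : (fun t => H t * f t) = fun t => (H t + - a j) * f t + a j * f t); last first.
  by apply/funext => t; ring.
rewrite (bdd_intD (mC j) (Cfin j)) ?(bdd_intZ (mC j) (Cfin j))//; last exact: bddZ.
rewrite hf mulr0 addr0.
apply: le_trans (le_normr_Rintegral (mC j) (bdd_integrable (mC j) (Cfin j) bHa)) _.
rewrite mulrA -Rintegral_cst//.
apply: (bdd_int_le (mC j) (Cfin j)); [exact: bdd_norm|exact: bdd_cst|].
move=> t [_ /= /andP[h1 h2]]; rewrite normrM; apply: ler_pM => //.
by rewrite ger0_norm; move: h1 h2; rewrite /a -natr1; lra.
Qed.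

End level_sets.

Section ungenerated.
Context {R : realType} {d : measure_display} {T : measurableType d}.
Variables (mu : {measure set T -> \bar R}) (E : set T).
Hypotheses (mE : measurable E) (Efin : (mu E < +oo)%E).

Lemma bdd_indic A : measurable A -> bdd (\1_A : T -> R).
Proof.
move=> mA; split; first exact: measurable_indic.
by exists 1 => t; rewrite indicE; case: (_ \in _); rewrite ?normr1 ?normr0.
Qed.

Lemma measurable_gt_bdd (f : T -> R) c : bdd f -> measurable [set t | c < f t].
Proof.
move=> [mf _]; rewrite -[X in measurable X]setTI (_ : [set t | _] = f @^-1` `]c, +oo[).
  exact: mf.
by apply/seteqP; split => y /=; rewrite in_itv/= andbT.
Qed.

(** Let the sigma-algebra generated by [E] and the rational level sets of all [H k] have conditional
    expectations [g A]. The difference of the indicator of A and [g A] is orthogonal to every [H k].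
    If it vanished almost everywhere on [E] for all A, each A inside [E] would agree with the set
    where [g A > 1/2] up to a null set, and [E] would be countably generated. *)
Lemma orthogonal_unit (H : nat -> T -> R) : (forall k, bdd (H k)) ->
  ~ countably_generated_on mu E ->
  exists f, [/\ unit_on E f, forall k, \int[mu]_(t in E) (H k t * f t) = 0 &
    0 < \int[mu]_(t in E) (f t ^+ 2)].
Proof.
move=> bH ncg.
pose gen (n : nat) : set T := if n is m.+1 then
  (if @unpickle (nat * rat)%type m is Some kq then [set t | ratr kq.2 < H kq.1 t] else set0) else E.
pose G := range gen.
have mgen n : measurable (gen n).
  by case: n => //= n; case: unpickle => // kq; exact: measurable_gt_bdd.
have mG : G `<=` measurable by move=> _ [n _ <-].
have GE : G E by exists 0%N.
pose T' := g_sigma_algebraType G.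
have ray k q : measurable ([set t | ratr q < H k t] : set T').
  by apply: sub_sigma_algebra; exists (pickle (k, q)).+1 => //=; rewrite pickleK.
(* The set where a <= H k is the intersection of the generating sets with rational bounds q < a. *)
have closed_ray k a : measurable ([set t | a <= H k t] : set T').
  pose V (n : nat) : set T' := if @unpickle rat n is Some q then
    (if ratr q < a then ~` [set t | ratr q < H k t] else set0) else set0.
  rewrite (_ : [set t | _] = ~` (\bigcup_n V n)).
    apply: measurableC; apply: bigcup_measurable => n _; rewrite /V.
    case: unpickle => [q|]; last exact: measurable0.
    by case: ifP => _; [exact: measurableC|exact: measurable0].
  apply/seteqP; split => t /=.
    move=> at_ [n _]; rewrite /V; case: unpickle => // q; case: ifP => // qa.
    by apply; exact: lt_le_trans at_.
  move=> h; rewrite leNgt; apply/negP => /rat_in_itvoo[q]; rewrite in_itv/= => /andP[q1 q2].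
  apply: h; exists (pickle q); first exact: I.
  rewrite /V pickleK q2.
  by move=> q3; have := lt_trans q1 q3; rewrite ltxx.
have ico k a b : <<s G >> (E `&` [set t | a <= H k t < b]).
  rewrite (_ : _ `&` _ = E `&` ([set t | a <= H k t] `\` [set t | b <= H k t])).
    apply: (@measurableI _ T'); first exact: sub_sigma_algebra.
    by apply: (@measurableD _ T'); exact: closed_ray.
  apply/seteqP; split => t /= [Et].
    by move=> /andP[h1 h2]; split => //; split => //; apply/negP; rewrite -ltNge.
  by move=> [h1 h2]; split => //; rewrite h1 ltNge; exact/negP.
have /choice[g hg] (A : set T) : exists g : T -> R, measurable A ->
  [/\ forall Y, measurable Y -> <<s G >> (g @^-1` Y), forall t, 0 <= g t <= 1 &
   forall B, <<s G >> B -> B `<=` E -> \int[mu]_(t in B) (\1_A t - g t) = 0].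
  have [mA|nA] := pselect (measurable A); last by exists (fun=> 0).
  by have [g hg] := conditional_expectation mG GE Efin mA; exists g.
pose f A (t : T) : R := \1_E t * (\1_A t - g A t).
have bg A : measurable A -> bdd (g A).
  move=> mA; have [g1 g2 _] := hg A mA; split.
    by move=> _ Y mY; rewrite setTI; apply: (sigma_sub mG); exact: g1.
  by exists 1 => t; have /andP[h1 h2] := g2 t; rewrite ger0_norm.
have bAg A : measurable A -> bdd (fun t => \1_A t - g A t).
  move=> mA; rewrite (_ : (fun t => _) = fun t => \1_A t + (-1) * g A t); last first.
    by apply/funext => t; rewrite mulN1r.
  by apply: bddD; [exact: bdd_indic|exact: bddZ (bg A mA)].
have uf A : measurable A -> unit_on E (f A).
  move=> mA; split.
  - by have [] := bddM (bdd_indic mE) (bAg A mA).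
  - move=> t; have [_ /(_ t)/andP[g0 g1] _] := hg A mA.
    by rewrite /f !indicE; case: (t \in E); case: (t \in A);
      rewrite ?mul1r ?mul0r ?normr0 ?ler01// ler_norml /=; lra.
  - by move=> t nE; rewrite /f indicE memNset// mul0r.
have fE A t : E t -> f A t = \1_A t - g A t.
  by move=> Et; rewrite /f indicE mem_set// mul1r.
have orthf A k : measurable A -> \int[mu]_(t in E) (H k t * f A t) = 0.
  move=> mA; apply: integral_zero_levels => //; first exact: unit_on_bdd (uf A mA).
  move=> a b; have [_ _ h] := hg A mA.
  rewrite -[RHS](h _ (ico k a b) (@subIsetl _ _ _)).
  by apply: eq_Rintegral => t; rewrite inE => -[Et _]; exact: fE.
apply: contrapT => none; apply: ncg.
(* Where A and the set [g A > 1/2] disagree, [f A ^+ 2] is at least 1/4, so 1/5 is exceeded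
   strictly. *)
have zero A : measurable A -> mu (E `&` [set t | 5^-1 < f A t ^+ 2]) = 0%E.
  move=> mA; have bf2 : bdd (fun t => f A t ^+ 2) by apply: bddX; exact: unit_on_bdd (uf A mA).
  have i0 : \int[mu]_(t in E) (f A t ^+ 2) <= 0.
    rewrite leNgt; apply/negP => h; apply: none.
    by exists (f A); split; [exact: uf|move=> k; exact: orthf|].
  have := bdd_markov mE Efin bf2 (fun t => sqr_ge0 _) (_ : 0 <= 5^-1).
  rewrite invr_ge0 ler0n => /(_ isT) /le_trans /(_ i0).
  rewrite pmulr_rle0 ?invr_gt0// => h.
  have mD : measurable (E `&` [set t | 5^-1 < f A t ^+ 2]).
    by apply: measurableI => //; exact: measurable_gt_bdd.
  have Df := fin_subset mD mE (@subIsetl _ _ _) Efin.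
  rewrite -[LHS]fineK ?ge0_fin_numE//; congr EFin.
  by apply/eqP; rewrite eq_le h fine_ge0.
exists (fun n => gen n `&` E); split.
  by move=> _ [n _ <-]; split; [exact: measurableI|exact: subIsetr].
set S := (X in <<s E, X >>).
have sS B : <<s G >> B -> <<s E, S >> (B `&` E).
  move: B; apply: (smallest_sub (X := [set B | <<s E, S >> (B `&` E)])).
    split.
    - by rewrite /= set0I; exact: sigma_algebra0.
    - move=> B /= hB; rewrite setTD (_ : ~` B `&` E = E `\` (B `&` E)); first exact: sigma_algebraCD.
      by rewrite setDIr setDv setU0 setDE setIC.
    - by move=> F hF /=; rewrite setI_bigcupl; exact: sigma_algebra_bigcup.
  by move=> _ [n _ <-] /=; apply: sub_sigma_algebra; left; exists n.
apply/seteqP; split => [A [mA AE]|A].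
  have [g1 g2 _] := hg A mA.
  pose B := g A @^-1` `]2^-1, +oo[.
  have sB : <<s G >> B by exact: g1.
  have mB := sigma_sub mG sB.
  have nul (N : set T) : measurable N -> N `<=` E `&` [set t | 5^-1 < f A t ^+ 2] -> <<s E, S >> N.
    move=> mN NE; apply: sub_sigma_algebra; right; split => //; first by move=> t /NE[].
    apply/eqP; rewrite eq_le measure_ge0 andbT -(zero A mA); apply: le_measure; rewrite ?inE//.
    apply: measurableI => //; apply: measurable_gt_bdd; apply: bddX; exact: unit_on_bdd (uf A mA).
  have sU (X Y : set T) : <<s E, S >> X -> <<s E, S >> Y -> <<s E, S >> (X `|` Y).
    move=> sX sY; rewrite -bigcup2E; apply: sigma_algebra_bigcup => -[|[|n]] //=.
    exact: sigma_algebra0.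
  have sC (X : set T) : <<s E, S >> X -> <<s E, S >> (E `\` X) by exact: sigma_algebraCD.
  have -> : A = (E `\` ((E `\` (B `&` E)) `|` ((B `&` E) `\` A))) `|` (A `\` B).
    apply/seteqP; split => t.
      move=> At; have Et := AE _ At; have [Bt|nB] := pselect (B t); last by right.
      by left; split => // -[[_ h]|[_ h]]; apply: h.
    move=> [[Et h]|[]//]; apply: contrapT => nA; apply: h.
    have [Bt|nB] := pselect (B t); [by right|left; split => //; by move=> []].
  apply: (sU).
    apply: (sC); apply: (sU); first by apply: (sC); exact: sS.
    apply: (nul); first by apply: measurableD => //; exact: measurableI.
    move=> t [[/= Bt Et] nA]; split => //=; rewrite fE// indicE memNset//.
    by move: Bt; rewrite /B/= in_itv/= andbT => Bt; nra.
  apply: (nul); first exact: measurableD.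
  move=> t [At nB]; have Et := AE _ At; split => //=; rewrite fE// indicE mem_set//.
  have : g A t <= 2^-1 by rewrite leNgt; apply/negP => h; apply: nB; rewrite /B/= in_itv/= andbT.
  move=> h; have h2 : 2^-1 <= 1 - g A t by lra.
  by have := ler_pM _ _ h2 h2; rewrite -expr2 mulr1n invr_ge0 ler0n => /(_ isT isT); lra.
move: A; apply: smallest_sub.
  split.
  - by split => //; exact: sub0set.
  - by move=> A [mA AE]; split; [exact: measurableD|exact: subDsetl].
  - move=> F hF; split; first by apply: bigcup_measurable => n _; case: (hF n).
    by move=> t [n _ Ft]; case: (hF n) => _; exact.
move=> A [[n _ <-]|[mA AE _]]; last by split.
by split; [exact: measurableI|exact: subIsetr].
Qed.

End ungenerated.

(** * Countably many orthogonality constraints as a filter *)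

Section orthogonality.
Context {R : realType} {d : measure_display} {T : measurableType d}.
Variables (mu : {measure set T -> \bar R}) (E : set T).
Hypotheses (mE : measurable E) (Efin : (mu E < +oo)%E).

Definition unit_fun := {f : T -> R | unit_on E f}.

(** The properties enforced by orthogonality to some countable family. The filter is closed under
    countable intersections, so a positive set split into countably many parts has a positive
    part. *)
Definition ctbl_orth : set_system unit_fun :=
  [set P | exists2 H : nat -> T -> R, forall k, bdd (H k) &
     forall i : unit_fun, (forall k, \int[mu]_(t in E) (H k t * sval i t) = 0) -> P i].

Lemma ctbl_orth_bigcap (P : nat -> set unit_fun) : (forall n, ctbl_orth (P n)) ->
  ctbl_orth (\bigcap_n P n).
Proof.
move=> h; have /choice[H hH] n : exists H : nat -> T -> R, (forall k, bdd (H k)) /\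
    forall i : unit_fun, (forall k, \int[mu]_(t in E) (H k t * sval i t) = 0) -> P n i.
  by have [H h1 h2] := h n; exists H.
exists (fun m => if @unpickle (nat * nat)%type m is Some nk then H nk.1 nk.2 else (fun=> 0)).
  by move=> m; case: unpickle => [nk|]; [case: (hH nk.1)|exact: bdd_cst].
move=> i hi n _; apply: (hH n).2 => k.
by have := hi (pickle (n, k)); rewrite pickleK.
Qed.

#[local] Instance ctbl_orth_filter : Filter ctbl_orth.
Proof.
split; first by exists (fun _ _ => 0) => // k; exact: bdd_cst.
  move=> P Q hP hQ; have h n : ctbl_orth (if n is 0%N then P else Q) by case: n.
  have [H bH hH] := ctbl_orth_bigcap h; exists H => // i /hH hi.
  by split; [exact: (hi 0%N I)|exact: (hi 1%N I)].
by move=> P Q PQ [H bH hH]; exists H => // i hi; apply: PQ; exact: hH.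
Qed.

Lemma positive_bigcup (P : set unit_fun) (Q : nat -> set unit_fun) :
  positive_set ctbl_orth P -> P `<=` \bigcup_n Q n ->
  exists n, positive_set ctbl_orth (P `&` Q n).
Proof.
move=> Ppos PQ; apply: contrapT => none.
have h n : ctbl_orth (~` (P `&` Q n)).
  by apply: not_positive => hn; apply: none; exists n.
have [i Pi hi] := Ppos _ (ctbl_orth_bigcap h).
by have [n _ Qi] := PQ i Pi; apply: (hi n I).
Qed.

Lemma restrict_unit B (i : unit_fun) : measurable B -> unit_on E (fun t => \1_B t * sval i t).
Proof.
move=> mB; have [mf f1 f0] := svalP i; split.
- by apply: measurable_funM => //; exact: measurable_indic.
- move=> t; rewrite normrM -[leRHS]mulr1; apply: ler_pM => //.
  by rewrite indicE; case: (_ \in _); rewrite ?normr1 ?normr0.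
- by move=> t /f0 ->; rewrite mulr0.
Qed.

Definition restrict B (mB : measurable B) (i : unit_fun) : unit_fun :=
  exist _ _ (restrict_unit i mB).

(** Orthogonality of the restriction of f to [H k] is orthogonality of f to the restriction of
    [H k]. *)
Lemma ctbl_orth_restrict B (mB : measurable B) (Q : set unit_fun) : ctbl_orth Q ->
  ctbl_orth [set i | Q (restrict mB i)].
Proof.
move=> [H bH hH]; exists (fun k t => \1_B t * H k t).
  by move=> k; apply: bddM => //; exact: bdd_indic.
move=> i hi /=; apply: hH => k; rewrite -[RHS](hi k) /=.
by congr (Rintegral mu E _); apply/funext => t; ring.
Qed.

Definition previous_orth (x : nat -> unit_fun) n : set unit_fun :=
  [set i | orth mu E (fun k => sval (x k)) n (sval i)].

Lemma previous_orth_dep : initial_dep previous_orth.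
Proof.
move=> x y n xy; apply/seteqP; split => i h a.
  by have [h1 h2] := h a; split; [rewrite -[RHS]h1|rewrite -[RHS]h2];
    congr (Rintegral mu E _); apply/funext => t; congr (_ * _);
    [|congr (_ ^+ 3)]; apply: eq_bigr => k _; rewrite xy.
by have [h1 h2] := h a; split; [rewrite -[RHS]h1|rewrite -[RHS]h2];
  congr (Rintegral mu E _); apply/funext => t; congr (_ * _);
  [|congr (_ ^+ 3)]; apply: eq_bigr => k _; rewrite xy.
Qed.

(** The countable family consists of the earlier functions and their triple products; the boolean
    tells which. Expanding sums and cubes multilinearly reduces all coefficients to these. *)
Lemma ctbl_orth_previous x n : ctbl_orth (previous_orth x n).
Proof.
pose f k := sval (x k); have bf k : bdd (f k) by exact: unit_on_bdd (svalP (x k)).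
exists (fun m => if @unpickle (bool * (nat * (nat * nat)))%type m is Some (b, (i, (j, l))) then
    (if b then (fun t => f i t) else (fun t => f i t * f j t * f l t)) else (fun=> 0)).
  move=> m; case: unpickle => [[[] [i [j l]]]|]; [exact: bf| |exact: bdd_cst].
  exact: (bddM (bddM (bf i) (bf j)) (bf l)).
move=> y hy a; set g := sval y; have bg : bdd g by exact: unit_on_bdd (svalP y).
have h1 i : \int[mu]_(t in E) (g t * f i t) = 0.
  have := hy (pickle (true, (i, (0%N, 0%N)))); rewrite pickleK => h0; rewrite -[RHS]h0.
  by congr (Rintegral mu E _); apply/funext => t; rewrite mulrC.
have h3 i j l : \int[mu]_(t in E) (g t * f i t * f j t * f l t) = 0.
  have := hy (pickle (false, (i, (j, l)))); rewrite pickleK => h0; rewrite -[RHS]h0.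
  by congr (Rintegral mu E _); apply/funext => t; rewrite -/g; ring.
pose S t := \sum_(k < n) a k * f k t.
have bS : bdd S by exact: bdd_S (fun k => svalP (x k)) n.
have lin h : bdd h -> (forall i, \int[mu]_(t in E) (h t * f i t) = 0) ->
    \int[mu]_(t in E) (h t * S t) = 0.
  move=> bh hh; rewrite /S; elim: (n) => [|m IH].
    under eq_Rintegral do rewrite big_ord0 mulr0.
    by rewrite Rintegral_cst// mul0r.
  have bSm : bdd (fun t => \sum_(k < m) a k * f k t) by exact: bdd_S (fun k => svalP (x k)) m.
  rewrite (_ : (fun t => _) = fun t => h t * \sum_(k < m) a k * f k t + a m * (h t * f m t)); last first.
    by apply/funext => t; rewrite big_ord_recr/=; ring.
  rewrite (bdd_intD mE Efin) ?(bdd_intZ mE Efin)//; [|exact: bddM|exact: bddM|by apply: bddZ; exact: bddM].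
  by rewrite IH hh mulr0 addr0.
split; first exact: lin.
have hc h h' : (forall t, h t = h' t) -> \int[mu]_(t in E) h t = 0 -> \int[mu]_(t in E) h' t = 0.
  by move=> e <-; congr (Rintegral mu E _); apply/funext => t; rewrite e.
have l1 i j : \int[mu]_(t in E) (g t * f i t * f j t * S t) = 0.
  by apply: lin; [exact: (bddM (bddM bg (bf i)) (bf j))|exact: h3].
have l2 i : \int[mu]_(t in E) (g t * f i t * S t * S t) = 0.
  apply: lin; first exact: (bddM (bddM bg (bf i)) bS).
  by move=> j; apply: hc (l1 i j) => t; ring.
have l3 : \int[mu]_(t in E) (g t * S t * S t * S t) = 0.
  apply: lin; first exact: (bddM (bddM bg bS) bS).
  by move=> i; apply: hc (l2 i) => t; ring.
by apply: hc l3 => t; rewrite /S; ring.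
Qed.

Hypothesis ncg : ~ countably_generated_on mu E.

Definition large_on (c : R) B : set unit_fun :=
  [set i | (forall t, ~ B t -> sval i t = 0) /\
     c * fine (mu B) <= \int[mu]_(t in E) (sval i t ^+ 2)].

Lemma ungenerated_gt0 : 0 < fine (mu E).
Proof.
have [|f [uf _ f2]] := orthogonal_unit mE Efin (H := fun _ _ => 0) _ ncg.
  by move=> k; exact: bdd_cst.
exact: lt_le_trans f2 (int_sq_le mE Efin uf).
Qed.

(** Otherwise, for each n, countably many constraints force the second moment below mu E / (n+1).
    Imposed together, they contradict the nonzero function of [orthogonal_unit]. *)
Lemma large_on_whole : exists2 c, 0 < c & positive_set ctbl_orth (large_on c E).
Proof.
apply: contrapT => none.
have h n : ctbl_orth (~` large_on n.+1%:R^-1 E).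
  by apply: not_positive => hn; apply: none; exists n.+1%:R^-1 => //; rewrite invr_gt0.
have [H bH hH] := ctbl_orth_bigcap h.
have [f [uf fH f2]] := orthogonal_unit mE Efin bH ncg.
have m0 := ungenerated_gt0; set I2 := \int[mu]_(t in E) _ in f2.
pose n := Num.truncn (fine (mu E) / I2).
apply: (hH (exist _ f uf) fH n I); split => /=; first by case: uf.
rewrite -/I2 mulrC ler_pdivrMr// mulrC -ler_pdivrMr//.
by apply: ltW; exact: truncnS_gt.
Qed.

Lemma restrict_integral B (f : T -> R) : measurable B -> B `<=` E -> bdd f ->
  (forall t, ~ B t -> f t = 0) -> \int[mu]_(t in E) f t = \int[mu]_(t in B) f t.
Proof.
move=> mB BE bf f0; rewrite -[in RHS](setIidr BE) Rintegral_mkcondr.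
apply: eq_Rintegral => t _; rewrite patchE; case: ifP => // /negbT.
by rewrite notin_setE => /f0.
Qed.

Lemma restrict_sq B (mB : measurable B) (i : unit_fun) : B `<=` E ->
  \int[mu]_(t in E) (sval (restrict mB i) t ^+ 2) <= fine (mu B).
Proof.
move=> BE; have [mf f1 _] := svalP (restrict mB i).
have off t : ~ B t -> sval (restrict mB i) t = 0.
  by move=> nB /=; rewrite indicE memNset// mul0r.
rewrite (restrict_integral mB BE).
- by apply: (int_sq_le mB (fin_subset mB mE BE Efin)); split.
- by apply: bddX; exact: unit_on_bdd (svalP (restrict mB i)).
- by move=> t /off ->; rewrite expr0n.
Qed.

Lemma restrict_split B B' B'' (mB' : measurable B') (mB'' : measurable B'') (i : unit_fun) :
  B = B' `|` B'' -> B' `&` B'' = set0 -> (forall t, ~ B t -> sval i t = 0) ->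
  \int[mu]_(t in E) (sval i t ^+ 2) = \int[mu]_(t in E) (sval (restrict mB' i) t ^+ 2) +
    \int[mu]_(t in E) (sval (restrict mB'' i) t ^+ 2).
Proof.
move=> eB dB iB; have b2 A (mA : measurable A) : bdd (fun t => sval (restrict mA i) t ^+ 2).
  by apply: bddX; exact: unit_on_bdd (svalP (restrict mA i)).
rewrite -(bdd_intD mE Efin (b2 _ mB') (b2 _ mB'')).
congr (Rintegral mu E _); apply/funext => t /=; rewrite !indicE.
have [Bt'|nB'] := pselect (B' t).
  rewrite (mem_set Bt') memNset ?mul1r ?mul0r ?expr0n/= ?addr0// => Bt''.
  by have : (B' `&` B'') t by []; rewrite dB.
rewrite (memNset nB') mul0r expr0n/= add0r.
have [Bt''|nB''] := pselect (B'' t); first by rewrite mem_set// mul1r.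
by rewrite memNset// mul0r iB// eB => -[].
Qed.

(** Second moments add over the two parts, so the restriction to one of them keeps at least the
    density c. *)
Lemma large_on_half c B B' B'' : measurable B' -> measurable B'' -> B `<=` E ->
  B = B' `|` B'' -> B' `&` B'' = set0 ->
  positive_set ctbl_orth (large_on c B) ->
  positive_set ctbl_orth (large_on c B') \/ positive_set ctbl_orth (large_on c B'').
Proof.
move=> mB' mB'' BE eB dB Ppos; apply: contrapT => /not_orP[n1 n2].
have f1 : ctbl_orth (~` large_on c B') by exact: not_positive.
have f2 : ctbl_orth (~` large_on c B'') by exact: not_positive.
have h1 := ctbl_orth_restrict mB' f1.
have h2 := ctbl_orth_restrict mB'' f2.
have [i [iB ic] [h1' h2']] := Ppos _ (filterI h1 h2).
have off A (mA : measurable A) t : ~ A t -> sval (restrict mA i) t = 0.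
  by move=> nA /=; rewrite indicE memNset// mul0r.
have lt1 : \int[mu]_(t in E) (sval (restrict mB' i) t ^+ 2) < c * fine (mu B').
  by rewrite ltNge; apply/negP => h; apply: h1'; split => //; exact: off.
have lt2 : \int[mu]_(t in E) (sval (restrict mB'' i) t ^+ 2) < c * fine (mu B'').
  by rewrite ltNge; apply/negP => h; apply: h2'; split => //; exact: off.
have e : fine (mu B) = fine (mu B') + fine (mu B'').
  have B'E : B' `<=` E by move=> t Bt; apply: BE; rewrite eB; left.
  have B''E : B'' `<=` E by move=> t Bt; apply: BE; rewrite eB; right.
  by rewrite eB fine_muU//; [exact: fin_subset mB' mE B'E Efin|exact: fin_subset mB'' mE B''E Efin].
move: ic; rewrite (restrict_split mB' mB'' eB dB iB) e; lra.
Qed.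

Hypothesis na : purely_non_atomic mu.

Lemma large_on_shrink c B n : measurable B -> B `<=` E ->
  positive_set ctbl_orth (large_on c B) -> exists B', [/\ measurable B', B' `<=` B,
    positive_set ctbl_orth (large_on c B') & fine (mu B') = 2^-1 ^+ n * fine (mu B)].
Proof.
move=> mB BE Bpos; elim: n => [|n [B' [mB' B'B pos' mu']]].
  by exists B; split => //; rewrite expr0 mul1r.
have B'E : B' `<=` E by exact: subset_trans BE.
have B'f := fin_subset mB' mE B'E Efin.
have [|A [mA AB' muA]] := @nonatomic_intermediate _ _ _ mu na B' (2^-1 * fine (mu B')) mB' B'f.
  by have := fine_ge0 (measure_ge0 mu B'); lra.
have mD := measurableD mB' mA.
have eB : B' = A `|` (B' `\` A) by rewrite setDUK.
have dB : A `&` (B' `\` A) = set0 by rewrite setDIK.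
have fA : fine (mu A) = 2^-1 ^+ n.+1 * fine (mu B) by rewrite muA/= mu' exprS; ring.
have fD : fine (mu (B' `\` A)) = 2^-1 ^+ n.+1 * fine (mu B).
  by rewrite fine_muD// muA/= mu' exprS; field.
have [h|h] := large_on_half mA mD B'E eB dB pos'.
  by exists A; split => //; exact: subset_trans B'B.
by exists (B' `\` A); split => //; apply: subset_trans B'B; exact: subDsetl.
Qed.

(** Differences of a nested sequence [A i] whose measures shrink by the factor 2^-n. As |f| <= 1,
    the removed part carries a second moment of at most 2^-n mu (A i) <= (c/2) mu (A i), so the
    density c/2 is left on the difference. *)
Lemma large_on_disjoint_seq : exists c (B : nat -> set T),
  [/\ 0 < c, forall i, measurable (B i) /\ B i `<=` E, disj_fam B,
      forall i, 0 < fine (mu (B i)) /\ 2 * fine (mu (B i.+1)) <= fine (mu (B i)) &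
      forall i, positive_set ctbl_orth (large_on c (B i))].
Proof.
have [c0 c00 Epos0] := large_on_whole.
(* With c <= 1/2 the ratio 2^-n is at most 1/4, which makes the measures of the differences at least
   halve. *)
pose c := Num.min c0 2^-1.
have c0' : 0 < c by rewrite lt_min c00 invr_gt0 ltr0n.
have c2 : c <= 2^-1 by rewrite ge_min lexx orbT.
have Epos : positive_set ctbl_orth (large_on c E).
  move=> Q FQ; have [i [iB ic] Qi] := Epos0 Q FQ; exists i => //; split => //.
  apply: le_trans ic; rewrite ler_wpM2r ?fine_ge0//.
  by rewrite ge_min lexx.
have [n hn] := exists_pow2_ge (2 / c).
have qn : 2^-1 ^+ n <= c / 2.
  rewrite exprVn -[leRHS]invrK lef_pV2 ?posrE ?invr_gt0 ?exprn_gt0 ?divr_gt0//.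
  by rewrite invf_div.
have q0 : 0 < 2^-1 ^+ n :> R by rewrite exprn_gt0// invr_gt0.
have /choice[nxt hnxt] (B : set T) : exists B', measurable B -> B `<=` E ->
    positive_set ctbl_orth (large_on c B) -> [/\ measurable B', B' `<=` B,
    positive_set ctbl_orth (large_on c B') & fine (mu B') = 2^-1 ^+ n * fine (mu B)].
  have [[mB BE Bpos]|h] := pselect [/\ measurable B, B `<=` E & positive_set ctbl_orth (large_on c B)].
    by have [B' hB'] := large_on_shrink n mB BE Bpos; exists B'.
  by exists set0 => ? ? ?; case: h.
pose A := fix A i := if i is j.+1 then nxt (A j) else E.
have hA i : [/\ measurable (A i), A i `<=` E, positive_set ctbl_orth (large_on c (A i)) & 0 < fine (mu (A i))].
  elim: i => [|i [mA AE Apos Ag0]] /=; first by split => //; exact: ungenerated_gt0.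
  have [mA' AA' pos' mu'] := hnxt _ mA AE Apos.
  by split => //; [exact: subset_trans AE|rewrite mu' mulr_gt0].
have AS i : A i.+1 `<=` A i /\ fine (mu (A i.+1)) = 2^-1 ^+ n * fine (mu (A i)).
  by have [mA AE Apos _] := hA i; have [_ AA' _ mu'] := hnxt _ mA AE Apos.
have Amon i j : (i <= j)%N -> A j `<=` A i.
  elim: j => [|j IH]; first by rewrite leqn0 => /eqP ->.
  rewrite leq_eqVlt => /orP[/eqP -> //|ij]; apply: subset_trans (IH ij).
  by case: (AS j).
have mA i : measurable (A i) by case: (hA i).
have AE i : A i `<=` E by case: (hA i).
have Af i : (mu (A i) < +oo)%E := fin_subset (mA i) mE (@AE i) Efin.
pose B i := A i `\` A i.+1.
have mB i : measurable (B i) by exact: measurableD.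
have BE i : B i `<=` E by move=> t [/AE].
have muB i : fine (mu (B i)) = fine (mu (A i)) - fine (mu (A i.+1)).
  by rewrite fine_muD//; case: (AS i).
have A0 i : 0 < fine (mu (A i)) by case: (hA i).
exists (c / 2), B; split => //.
- by rewrite divr_gt0.
- move=> i j t [Ai nAi] [Aj nAj]; have [ij|ij|//] := ltngtP i j.
    by case: nAi; exact: (Amon i.+1 j).
  by case: nAj; exact: (Amon j.+1 i).
- move=> i; rewrite !muB (AS i.+1).2 (AS i).2.
  have qA : 2^-1 ^+ n * fine (mu (A i)) <= 4^-1 * fine (mu (A i)).
    by rewrite ler_pM2r//; lra.
  have qA0 : 0 < 2^-1 ^+ n * fine (mu (A i)) by rewrite mulr_gt0.
  have qqA0 : 0 < 2^-1 ^+ n * (2^-1 ^+ n * fine (mu (A i))) by rewrite mulr_gt0.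
  by have := A0 i; split; lra.
- move=> i Q FQ; have [_ _ pos _] := hA i.
  have [f [fA fc] Qf] := pos _ (ctbl_orth_restrict (mB i) FQ).
  exists (restrict (mB i) f) => //; split.
    by move=> t nB /=; rewrite indicE memNset// mul0r.
  have eA : A i = B i `|` A i.+1.
    by rewrite setUC setDUK//; case: (AS i).
  have dA : B i `&` A i.+1 = set0 by rewrite setIC setDIK.
  have := restrict_split (mB i) (mA i.+1) eA dA fA.
  have := restrict_sq (mA i.+1) f (AE i.+1).
  have mB_le : fine (mu (B i)) <= fine (mu (A i)) by rewrite muB; have := A0 i.+1; lra.
  have c2B : c / 2 * fine (mu (B i)) <= c / 2 * fine (mu (A i)).
    by rewrite ler_pM2l// divr_gt0.
  rewrite (AS i).2 => h1 h2; rewrite h2 in fc.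
  have : 2^-1 ^+ n * fine (mu (A i)) <= c / 2 * fine (mu (A i)) by rewrite ler_pM2r.
  lra.
Qed.

End orthogonality.

(** * Embeddings of spaces that are not countably generated *)

Section generated.
Context {R : realType} {d : measure_display} {T : measurableType d}
  {d' : measure_display} {T' : measurableType d'}.
Variables (mu : {measure set T -> \bar R}) (nu : {measure set T' -> \bar R}).
Variables (p : R) (J : (T -> R) -> (T' -> R)).
Hypotheses (p1 : 1 < p) (emb : weakLp_embedding mu nu p J) (pa : purely_atomic nu).
Variable (E : set T).
Hypotheses (na : purely_non_atomic mu) (mE : measurable E) (Efin : (mu E < +oo)%E)
  (ncg : ~ countably_generated_on mu E).

Let p0 : 0 < p. Proof. by apply: lt_trans p1. Qed.
Let m := fine (mu E).
Let E0 : 0 < m. Proof. exact: ungenerated_gt0. Qed.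
Let phi (i : unit_fun (R:=R) E) := sval i.
Let FF := @ctbl_orth _ _ _ mu E.
Let om n : R := n%:R `^ Num.max 1 (p - 1) * m.
Let u1 i : unit_on E (phi i). Proof. exact: svalP i. Qed.

#[local] Instance ctbl_orth_filter' : Filter FF.
Proof. exact: ctbl_orth_filter. Qed.

Let phi_tame i : tame mu E p (phi i). Proof. exact: unit_on_tame. Qed.

Let phiL i : weakLp mu p (phi i). Proof. exact: (tame_weakLp p1 mE Efin E0). Qed.

Let om_wb (x : nat -> unit_fun (R:=R) E) n (a : nat -> R) :
  (forall k, previous_orth mu x k (x k)) -> (forall k, `|a k| = 1) ->
  wb mu p (fun t => \sum_(k < n) a k * phi (x k) t) (om n).
Proof.
move=> xo a1; apply: (@S_wb _ _ _ mu E mE Efin (fun k => phi (x k)) a) => //.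
by move=> k; rewrite a1.
Qed.

Let om_o e : 0 < e -> exists2 n, (0 < n)%N & om n < e * n%:R `^ p.
Proof. by move=> e0; apply: powR_little_o => //; rewrite gt_max p1; lra. Qed.

Let dep := @previous_orth_dep _ _ _ mu E.
Let prev := @ctbl_orth_previous _ _ _ mu E mE Efin.
Let mJ i : measurable_fun setT (J (phi i)).
Proof. exact: embedding_measurable emb _ _. Qed.

(** Closure of the filter under countable intersections lets [near] hold for all thresholds and
    tolerances at once, so the overlap is null and not merely small. *)
Let null_overlap (j : unit_fun (R:=R) E) :
  FF [set i | nu ([set y | 0 < `|J (phi j) y|] `&` [set y | 0 < `|J (phi i) y|]) = 0%E].
Proof.
pose Y (n : nat) := [set y | n.+1%:R^-1 < `|J (phi j) y|].
pose Z i (n : nat) := [set y | n.+1%:R^-1 < `|J (phi i) y|].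
have mY n : measurable (Y n) by exact: measurable_gt_norm.
have mZ i n : measurable (Z i n) by exact: measurable_gt_norm.
have inv0 n : 0 < n.+1%:R^-1 :> R by rewrite invr_gt0.
have Yfin n : (nu (Y n) < +oo)%E.
  have [_ [K K0 wK]] : measurable_fun setT (J (phi j)) /\ exists2 K, 0 <= K & wb nu p (J (phi j)) K.
    by apply/(weakLp_wb nu p1); case: emb => + _ _ _; apply.
  by apply: le_lt_trans (wK _ (inv0 n)) _; rewrite ltry.
have h n q : FF [set i | (nu (Y n `&` Z i n) < (q.+1%:R^-1)%:E)%E].
  exact: (near p1 emb pa phiL dep prev om_wb om_o (mY n) (Yfin n) (inv0 n) (inv0 q)).
have := ctbl_orth_bigcap (fun n => ctbl_orth_bigcap (h n)).
apply: filterS => i hi /=.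
have nul n : nu (Y n `&` Z i n) = 0%E.
  have mI := measurableI _ _ (mY n) (mZ i n).
  have fI := fin_subset mI (mY n) (@subIsetl _ _ _) (Yfin n).
  rewrite -[LHS]fineK ?ge0_fin_numE//; congr EFin; apply/eqP; rewrite eq_le fine_ge0// andbT.
  apply/ler_addgt0Pr => e e0; rewrite add0r.
  have := hi n I (Num.truncn e^-1) I; rewrite /= -[X in (X < _)%E]fineK ?ge0_fin_numE// lte_fin => /ltW /le_trans; apply.
  by rewrite -[leRHS]invrK lef_pV2 ?posrE ?invr_gt0//; apply: ltW; exact: truncnS_gt.
rewrite (_ : _ `&` _ = \bigcup_n (Y n `&` Z i n)).
  have mI n : measurable (Y n `&` Z i n) by exact: measurableI.
  apply/negligibleP; first exact: bigcup_measurable.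
  by apply: negligible_bigcup => n; apply/negligibleP; [exact: mI|exact: nul].
apply/seteqP; split => y; last first.
  by move=> [n _ [h1 h2]]; split; [exact: lt_trans h1|exact: lt_trans h2].
move=> [/= h1 h2].
have mn0 : 0 < Num.min `|J (phi j) y| `|J (phi i) y| by rewrite lt_min h1.
exists (Num.truncn (Num.min `|J (phi j) y| `|J (phi i) y|)^-1) => //.
have lt : (Num.truncn (Num.min `|J (phi j) y| `|J (phi i) y|)^-1).+1%:R^-1 <
    Num.min `|J (phi j) y| `|J (phi i) y|.
  by rewrite -[ltRHS]invrK ltf_pV2 ?posrE ?invr_gt0//; exact: truncnS_gt.
by split => /=; apply: lt_le_trans lt _; rewrite ge_min lexx ?orbT.
Qed.

Lemma p_le2 : p <= 2.
Proof.
rewrite leNgt; apply/negP => p2.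
have [c c0 Epos] := large_on_whole mE Efin ncg.
have [C C0 hC] := embedding_wb p1 emb.
pose A : R := 11 * C * 2 `^ p.
have A0 : 0 <= A by rewrite !mulr_ge0 ?powR_ge0// ltW.
have [n n0 hn] := no_linear_growth mE Efin E0 (C * A) p2 c0.
pose D i := [set y | 0 < `|J (phi i) y|].
pose Q x k := previous_orth mu x k `&` [set i | forall j, (j < k)%N -> nu (D (x j) `&` D i) = 0%E].
have [||x hx] := @extract _ FF _ (fun=> large_on mu c E) Q _ (fun=> Epos).
- move=> x y k xy; rewrite /Q (dep xy); congr (_ `&` _).
  by apply/seteqP; split => i h j jk /=; [rewrite -xy|rewrite xy] => //; exact: h.
- move=> x k; apply: filterI; first exact: prev.
  suff h q : FF [set i | forall j, (j < q)%N -> nu (D (x j) `&` D i) = 0%E] by exact: h.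
  elim: q => [|q IH]; first by apply: filterS filterT.
  apply: filterS (filterI IH (null_overlap (x q))) => i /= [h1 h2] j.
  by rewrite ltnS leq_eqVlt => /orP[/eqP ->|/h1].
have xo k : previous_orth mu x k (x k) by case: (hx k) => _ [].
have [|||X [mX X0 hX]] := overlap (nu := nu) (D := fun k => D (x k)) n (e := 0).
- by move=> k; exact: measurable_gt_norm.
- by move=> j k jk; case: (hx k) => _ [_ /(_ _ jk) ->].
- exact: lexx.
rewrite mulr0 in X0.
apply: (hn (fun k => phi (x k)) (fun k => u1 (x k)) xo) => [k|].
  by case: (hx k) => -[_].
have SL : weakLp mu p (fun t => \sum_(k < n) 1 * phi (x k) t).
  by apply: (@weakLp_sum _ _ _ mu p p1 (fun k => phi (x k)) (fun=> 1)) => k.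
have K0 : 0 <= n%:R * A * m by rewrite !mulr_ge0// ltW.
rewrite (_ : n%:R * (C * A) * _ = C * (n%:R * A * m)); last by rewrite /m; ring.
apply: (hC _ _ SL K0).2 => t t0.
rewrite (embedding_gt p1 emb (h := fun k => phi (x k)) (fun=> 1))//.
have t2 : 0 < t / 2 by rewrite divr_gt0.
have := near_disjoint_upper (nu := nu) (h := fun k y => 1 * J (phi (x k)) y) (n := n) (t := t) (dl := 0) (e := 0)
  (l := fun=> C * (11 * m) * (t / 2) `^ (- p)) (X := X).
rewrite addr0 sumr_const_ord (_ : n%:R * (C * _ * _) = n%:R * A * m * t `^ (- p)); last first.
  by rewrite powR_divN// /A; ring.
apply => //.
- by move=> k; exact: measurable_funM.
- move=> z nX j k jk [zj zk]; apply: nX; apply: (hX j k z jk).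
    by move: zj; rewrite mul1r.
  by move: zk; rewrite mul1r.
- by rewrite mulr0 ltW.
- move=> k _; have h11 : 0 <= 11 * m by rewrite mulr_ge0// ltW.
  have := (hC _ _ (phiL (x k)) h11).1 (tame_wb mE Efin p0 (phi_tame (x k))) _ t2.
  by rewrite (_ : [set y | t / 2 < `|1 * J (phi (x k)) y|] = [set y | t / 2 < `|J (phi (x k)) y|])//;
    apply/seteqP; split => y /=; rewrite mul1r.
Qed.

(** With |f| <= 1 and mean square at least c on [B], |f| exceeds sqrt(c/2) on at least the fraction
    c/2 of [B]. *)
Lemma large_not_wb c B (i : unit_fun (R:=R) E) : 0 < c -> measurable B -> B `<=` E ->
  0 < fine (mu B) -> large_on mu c B i ->
  ~ wb mu p (phi i) (c / 4 * Num.sqrt (c / 2) `^ p * fine (mu B)).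
Proof.
move=> c0 mB BE B0 [iB ic] w.
have Bf := fin_subset mB mE BE Efin.
have c2 : 0 < c / 2 by rewrite divr_gt0.
have s0 : 0 < Num.sqrt (c / 2) by rewrite sqrtr_gt0.
have bi := unit_on_bdd (u1 i).
pose D := [set t | Num.sqrt (c / 2) < `|phi i t|].
have mD : measurable D by apply: measurable_gt_norm; case: bi.
have DB : D `<=` B.
  move=> t h; apply: contrapT => nB; move: h.
  by rewrite /D /= /phi iB// normr0 ltNge ltW.
have Df := fin_subset mD mB DB Bf.
have lower : c / 2 * fine (mu B) <= fine (mu D).
  rewrite (restrict_integral mu mB BE) in ic; last 2 first.
  - exact: bddX.
  - by move=> t /iB ->; rewrite expr0n.
  have : \int[mu]_(t in B) (phi i t ^+ 2) <= \int[mu]_(t in B) (\1_D t + c / 2).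
    apply: (bdd_int_le mB Bf); [exact: bddX|apply: bddD; [exact: bdd_indic|exact: bdd_cst]|].
    move=> t _; rewrite indicE; have [Dt|nD] := pselect (D t).
      rewrite mem_set//; have [_ h _] := u1 i.
      have : phi i t ^+ 2 <= 1 by rewrite -real_normK ?num_real// expr_le1.
      by move=> h2; apply: le_trans h2 _; rewrite lerDl ltW.
    rewrite memNset// add0r -real_normK ?num_real// -(sqr_sqrtr (ltW c2)).
    by rewrite ler_pXn2r ?nnegrE// leNgt; apply/negP.
  rewrite (bdd_intD mB Bf (bdd_indic mD) (bdd_cst _)) Rintegral_cst//.
  have -> : \int[mu]_(t in B) \1_D t = fine (mu D).
    by rewrite /Rintegral integral_indic// setIidl.
  have ic' : c * fine (mu B) <= \int[mu]_(t in B) (phi i t ^+ 2) by exact: ic.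
  by move=> h; lra.
have := w _ s0; rewrite -[X in (X <= _)%E]fineK ?ge0_fin_numE// lee_fin.
set q := Num.sqrt (c / 2); rewrite -/q in s0 *.
rewrite (_ : c / 4 * q `^ p * fine (mu B) * q `^ (- p) = c / 4 * fine (mu B) * (Num.sqrt (c / 2) `^ p * Num.sqrt (c / 2) `^ (- p))); last by ring.
rewrite powRN mulfV ?gt_eqF ?powR_gt0// mulr1 => upper.
have := le_trans lower upper; rewrite ler_pM2r//; lra.
Qed.

(** [embedding_lower] gives each function a level of its own; lowered to a rational, at the cost of
    2^p, it takes countably many values, and one of them is shared by a positive set. *)
Lemma level_pigeonhole c B : 0 < c -> measurable B -> B `<=` E -> 0 < fine (mu B) ->
  positive_set FF (large_on mu c B) -> forall eps, 0 < eps ->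
  (forall u (k : R), weakLp mu p u -> 0 < k -> ~ wb mu p u k ->
    exists2 t, 0 < t & level nu p J k eps t u) ->
  exists2 t, 0 < t & positive_set FF (large_on mu c B `&`
    [set i | level nu p J (fine (mu B)) (eps * (c / 4 * Num.sqrt (c / 2) `^ p) / 2 `^ p) t (phi i)]).
Proof.
move=> c0 mB BE B0 Bpos eps eps0 heps.
pose kap := c / 4 * Num.sqrt (c / 2) `^ p.
have kap0 : 0 < kap by rewrite mulr_gt0 ?divr_gt0// powR_gt0// sqrtr_gt0 divr_gt0.
pose Q n := if @unpickle rat n is Some q then [set i | 0 < ratr q :> R /\
  level nu p J (fine (mu B)) (eps * kap / 2 `^ p) (ratr q) (phi i)] else set0.
have [|n hn] := positive_bigcup Bpos (Q := Q).
  move=> i Li; have kB : 0 < kap * fine (mu B) by rewrite mulr_gt0.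
  have [t t0 lt] := heps _ _ (phiL i) kB (large_not_wb c0 mB BE B0 Li).
  have [q /andP[q1 q2]] : exists q : rat, t / 2 < ratr q < t.
    have : t / 2 < t by lra.
    by move=> /rat_in_itvoo[q]; rewrite in_itv/= => h; exists q.
  have t2 : 0 < t / 2 by rewrite divr_gt0.
  have q0 : 0 < ratr q :> R by exact: lt_trans q1.
  exists (pickle q); first exact: I.
  rewrite /Q pickleK; split; first exact: q0.
  rewrite /level; apply: (@le_trans _ _ (nu [set y | t < `|J (phi i) y|])).
    apply: le_trans lt; rewrite lee_fin.
    have hq : ratr q `^ (- p) <= (t / 2) `^ (- p).
      rewrite !powRN lef_pV2 ?posrE ?powR_gt0//.
      by apply: ge0_ler_powR; rewrite ?nnegrE ?(ltW p0) ?(ltW q0) ?(ltW q1) ?(ltW t2).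
    rewrite (_ : eps * t `^ (- p) * _ = eps * kap / 2 `^ p * (t / 2) `^ (- p) * fine (mu B)).
      have ek : 0 < eps * kap / 2 `^ p.
        exact: divr_gt0 (mulr_gt0 eps0 kap0) (powR_gt0 p (ltr0n R 2)).
      by rewrite ler_pM2r// ler_pM2l.
    by rewrite powR_divN//; field; rewrite gt_eqF// powR_gt0.
  apply: le_measure; rewrite ?inE; [exact: measurable_gt_norm..|].
  by move=> y /=; exact: lt_trans.
move: hn; rewrite /Q; case: unpickle => [q hq|h0]; last first.
  by have [i [_ []]] := h0 _ filterT.
have q0 : 0 < ratr q :> R by have [i [_ [q0 _]] _] := hq _ filterT.
exists (ratr q) => // P FP; have [i [Li [_ lq]] Pi] := hq P FP.
by exists i.
Qed.

Section small_exponent.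
Variables (c : R) (B : nat -> set T) (t : nat -> R) (eps : R).
Hypotheses (c0 : 0 < c) (mB : forall i, measurable (B i)) (BE : forall i, B i `<=` E)
  (dB : disj_fam B) (B0 : forall i, 0 < fine (mu (B i)))
  (B2 : forall i, 2 * fine (mu (B i.+1)) <= fine (mu (B i)))
  (t0 : forall i, 0 < t i) (eps0 : 0 < eps) (p2 : p <= 2).
Hypothesis Ppos : forall i, positive_set FF (large_on mu c (B i) `&`
    [set z | level nu p J (fine (mu (B i))) eps (t i) (phi z)]).

Let Bf i : (mu (B i) < +oo)%E.
Proof. exact: fin_subset (mB i) mE (@BE i) Efin. Qed.

(** Functions of other blocks are replaced by 0 and get coefficient 0; this keeps the system
    orthogonal on [B i] and makes the fourth moment bound count only the [N] functions of block
    i. *)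
Lemma block_tail (x : nat -> unit_fun (R:=R) E) (b : nat -> nat) n i (N : nat) s :
  (forall k t, ~ B (b k) t -> phi (x k) t = 0) ->
  (forall k, previous_orth mu x k (x k)) ->
  \sum_(k < n) ((b k == i)%:R : R) = N%:R -> 0 < s ->
  (mu [set z | (s < `|\sum_(k < n) (b k == i)%:R * phi (x k) z|)%R] <=
    (11 * fine (mu (B i)) * Num.min 1 (N%:R ^+ 2 * (s ^+ 4)^-1))%:E)%E.
Proof.
move=> xB xo hN s0.
pose x' k z : R := (b k == i)%:R * phi (x k) z.
pose a k : R := (b k == i)%:R.
have x'1 k : unit_on (B i) (x' k).
  have [mf f1 f0] := u1 (x k); split.
  - exact: measurable_funM.
  - by move=> z; rewrite /x'; case: (_ == _); rewrite ?mul1r ?mul0r ?normr0.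
  - by move=> z nB; rewrite /x'; case: eqP => [e|_]; rewrite ?mul0r// xB ?mulr0// e.
have a1 k : `|a k| <= 1 by rewrite /a; case: (_ == _); rewrite ?normr1 ?normr0.
have a01 k : a k = 0 \/ a k ^+ 2 = 1.
  by rewrite /a; case: (_ == _); [right; rewrite expr1n|left].
have aa k : a k ^+ 2 = a k by rewrite /a; case: (_ == _); rewrite ?expr1n ?expr0n.
have bx' k : bdd (x' k) by exact: unit_on_bdd (x'1 k).
have x'o n' : orth mu (B i) x' n' (x' n').
  move=> a'; have bS : bdd (fun z => \sum_(k < n') a' k * x' k z) by exact: bdd_S a' x'1 n'.
  have off z : ~ B i z -> x' n' z = 0 by case: (x'1 n') => _ _; exact.
  have [e|ne] := eqVneq (b n') i; last first.
    have z0 z : x' n' z = 0 by rewrite /x' (negbTE ne) mul0r.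
    by split; under eq_Rintegral do rewrite z0 mul0r; rewrite Rintegral_cst ?mul0r.
  have [h1 h2] := xo n' (fun k => a' k * (b k == i)%:R).
  have eS z : \sum_(k < n') a' k * x' k z = \sum_(k < n') a' k * (b k == i)%:R * sval (x k) z.
    by apply: eq_bigr => k _; rewrite /x' mulrA.
  have ex z : x' n' z = sval (x n') z by rewrite /x' e eqxx mul1r.
  split.
    rewrite -[RHS]h1 -(restrict_integral mu (mB i) (@BE i)).
    - by congr (Rintegral mu E _); apply/funext => z; rewrite eS ex.
    - exact: bddM.
    - by move=> z /off ->; rewrite mul0r.
  rewrite -[RHS]h2 -(restrict_integral mu (mB i) (@BE i)).
  - by congr (Rintegral mu E _); apply/funext => z; rewrite eS ex.
  - by apply: bddM => //; exact: bddX.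
  - by move=> z /off ->; rewrite mul0r.
have eS z : \sum_(k < n) (b k == i)%:R * phi (x k) z = \sum_(k < n) a k * x' k z.
  by apply: eq_bigr => k _; rewrite /a /x'; case: (_ == _); rewrite ?mul1r ?mul0r.
rewrite (_ : [set z | _] = [set z | s < `|\sum_(k < n) a k * x' k z|]); last first.
  by apply/seteqP; split => z /=; rewrite eS.
rewrite minr_pMr ?mulr_ge0 ?fine_ge0// mulr1 EFin_min le_min; apply/andP; split.
  apply: le_trans (S_tail0 (mB i) (Bf i) a x'1 n s0) _; rewrite lee_fin.
  by have := B0 i; lra.
apply: le_trans (S_tail4 (mB i) (Bf i) x'1 x'o a1 a01 n s0) _; rewrite lee_fin.
rewrite (eq_bigr (fun k : 'I_n => (b k == i)%:R)); last by move=> k _; exact: aa.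
by rewrite hN le_eqVlt; apply/orP; left; apply/eqP; ring.
Qed.

(** Here the levels [t i] are arbitrary and the geometric decay comes from the measures of [B i]. By
    fourth moments, a block of about y_i^2 orthogonal functions is as large as a single function of
    amplitude y_i, while its image carries measure of order y_i^2 l_i >= y_i^p l_i, because y_i >= 1
    and p <= 2. *)
Lemma small_exponent_contradiction : False.
Proof.
pose w i := fine (mu (B i)); have w0 i : 0 < w i by exact: B0.
have [C C0 hC] := embedding_wb p1 emb.
(* 176 = 11 x 4 x 4: the fourth moment constant, the square of the rounding factor 2 in [N i], and
   [doubling_sum]. *)
pose A : R := 176 * 2 `^ p.
pose K := (Num.truncn (C * A * 2 `^ p * 2 / eps)).+1.
have hK : C * A * 2 `^ p * 2 < K%:R * eps by rewrite -ltr_pdivrMr//; exact: truncnS_gt.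
(* Normalized so that y_i^p w_i / t_i^p = lam^p is the same for all blocks. *)
pose y0 i := t i * w i `^ (- p^-1).
have y00 i : 0 < y0 i by rewrite mulr_gt0// powR_gt0.
(* Large enough for [y i >= 1] in all blocks in use. *)
pose lam := 1 + \sum_(i < K) (y0 i)^-1.
have lam0 : 0 < lam by rewrite ltr_wpDr// sumr_ge0// => i _; rewrite invr_ge0 ltW.
pose y i := lam * y0 i.
have yg0 i : 0 < y i by rewrite mulr_gt0.
have y1 i : (i < K)%N -> 1 <= y i.
  move=> iK; have := inv_sum_le y00 iK; rewrite -/lam => h.
  by rewrite -ler_pdivrMl// mulr1.
have yp i : y i `^ p = lam `^ p * t i `^ p / w i.
  have W0 : 0 <= w i `^ (- p^-1) by exact: powR_ge0.
  rewrite /y /y0 (powRM _ (ltW lam0) (ltW (y00 i))) (powRM _ (ltW (t0 i)) W0) -powRrM.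
  by rewrite mulNr mulVf ?gt_eqF// powR_inv1 ?(ltW (w0 i))// mulrA.
pose N i := (Num.truncn (y i ^+ 2)).+1.
have N1 i : y i ^+ 2 <= (N i)%:R by apply: ltW; exact: truncnS_gt.
have N2 i : (i < K)%N -> (N i)%:R <= 2 * y i ^+ 2.
  move=> /y1 h; have h2 : 1 <= y i ^+ 2 by rewrite expr_ge1// ltW.
  by have /andP[h1 _] := truncn_itv (sqr_ge0 (y i)); rewrite /N -natr1; lra.
pose l i := eps * t i `^ (- p) * w i.
have lE i : l i * y i `^ p = eps * lam `^ p.
  rewrite yp /l powRN; field.
  by rewrite (gt_eqF (w0 i)) gt_eqF// powR_gt0.
have L1 : K%:R * (eps * lam `^ p) <= \sum_(i < K) (N i)%:R * l i.
  rewrite -sumr_const_ord; apply: ler_sum => i _; rewrite -(lE i).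
  have l0 : 0 < l i by rewrite !mulr_gt0// powR_gt0.
  rewrite mulrC ler_pM2r//; apply: le_trans (N1 i).
  by rewrite -(powR_mulrn 2 (ltW (yg0 i))); apply: ler_powR; [exact: y1|].
have K0 : 0 < K%:R :> R by rewrite ltr0n.
have lp0 : 0 < lam `^ p by exact: powR_gt0.
have L0 : 0 < \sum_(i < K) (N i)%:R * l i.
  by apply: lt_le_trans L1; rewrite mulr_gt0// mulr_gt0.
have [|n [b [x [bK hb Px xo hlow]]]] := @block_combination _ _ _ _ _ mu nu p J p1 emb pa _ phi FF _
  (@previous_orth _ _ _ mu E) om phiL dep prev om_wb om_o _ t l N K Ppos t0 _ L0.
  by move=> i z [_].
have xB k z : ~ B (b k) z -> phi (x k) z = 0 by move=> nB; case: (Px k) => -[h _] _; exact: h.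
pose F z := \sum_(k < n) (t (b k))^-1 * phi (x k) z.
have FL : weakLp mu p F.
  by apply: (@weakLp_sum _ _ _ mu p p1 (fun k => phi (x k)) (fun k => (t (b k))^-1)) => k.
pose S i z := \sum_(k < n) (b k == i)%:R * phi (x k) z.
have mS i : measurable_fun setT (S i).
  apply: measurable_sum => k; apply: measurable_funM => //.
  by case: (u1 (x k)).
have FS z : F z = \sum_(i < K) (t i)^-1 * S i z.
  under [RHS]eq_bigr do rewrite /S mulr_sumr.
  rewrite exchange_big /=; apply: eq_bigr => k _.
  rewrite (bigD1 (Ordinal (bK k (ltn_ord k))))//= eqxx mul1r big1 ?addr0// => i ne.
  rewrite (_ : (b k == i) = false) ?mul0r ?mulr0//.
  by apply/negbTE; apply: contra_neq ne => e; exact: val_inj.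
have SB i z : S i z != 0 -> B i z.
  move=> h; apply: contrapT => nB; move/eqP: h; apply; apply: big1 => k _.
  by case: eqP => [e|_]; rewrite ?mul0r// xB ?mulr0// e.
have cntN i : (i < K)%N -> \sum_(k < n) ((b k == i)%:R : R) = (N i)%:R.
  move=> iK; rewrite (hb (fun j => (j == i)%:R)) (bigD1 (Ordinal iK))//= eqxx mulr1.
  rewrite big1 ?addr0// => j ne; rewrite (_ : (nat_of_ord j == i) = false) ?mulr0//.
  by apply/negbTE; apply: contra_neq ne => e; exact: val_inj.
have wF : wb mu p F (lam `^ p * A).
  move=> s s0; have s2 : 0 < s / 2 by rewrite divr_gt0.
  have ls0 : 0 < lam / (s / 2) by rewrite divr_gt0.
  pose r := (lam / (s / 2)) `^ p; have r0 : 0 < r by exact: powR_gt0.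
  have hup := @near_disjoint_upper _ _ _ mu (fun i z => (t i)^-1 * S i z) K s 0 0
    (fun i => 44 * Num.min (w i) (r ^+ 2 / w i)) set0.
  rewrite (_ : [set z | _] = [set z | s < `|\sum_(i < K) (t i)^-1 * S i z|]); last first.
    by apply/seteqP; split => z /=; rewrite FS.
  apply: le_trans (hup _ _ _ _ _ _ _ _) _ => //.
  - by move=> i; exact: measurable_funM.
  - by rewrite measure0.
  - move=> z _ i j /andP[ij _] [zi zj].
    have nz k : 0 < `|(t k)^-1 * S k z| -> B k z.
      by rewrite normr_gt0 mulf_eq0 negb_or => /andP[_ /SB].
    by have := dB (nz i zi) (nz j zj) => e; rewrite e ltnn in ij.
  - by rewrite mulr0 ltW.
  - move=> i iK; have st : 0 < s / 2 * t i by rewrite mulr_gt0.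
    have := block_tail (i := i) xB xo (cntN i iK) st.
    rewrite (_ : [set z | s / 2 * t i < _] = [set y | s / 2 < `|(t i)^-1 * S i y|]); last first.
      have e2 z : (s / 2 * t i < `|S i z|) = (s / 2 < `|(t i)^-1 * S i z|).
        by rewrite normrM gtr0_norm ?invr_gt0// [X in _ = (_ < X)]mulrC ltr_pdivlMr.
      by apply/seteqP; split => z /=; rewrite e2.
    move/le_trans; apply; rewrite lee_fin -/(w i).
    pose v := y i / (s / 2 * t i); have v0 : 0 < v by rewrite divr_gt0.
    have vp : v `^ p = r / w i.
      rewrite /v /r (powRM _ (ltW (yg0 i))) ?invr_ge0 ?(ltW st)// yp.
      rewrite (powRM _ (ltW lam0)) ?invr_ge0 ?(ltW s2)// invfM.
      rewrite (powRM _ _ _) ?invr_ge0 ?(ltW s2) ?(ltW (t0 i))//.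
      have -> : (t i)^-1 `^ p = (t i `^ p)^-1.
        by rewrite -(powR_inv1 (ltW (t0 i))) -powRrM mulN1r powRN.
      by field; rewrite (gt_eqF (w0 i)) gt_eqF// powR_gt0.
    have NV : (N i)%:R ^+ 2 / (s / 2 * t i) ^+ 4 <= 4 * v ^+ 4.
      rewrite /v expr_div_n mulrA ler_pM2r ?invr_gt0 ?exprn_gt0//.
      rewrite (_ : 4 * y i ^+ 4 = (2 * y i ^+ 2) ^+ 2); last by ring.
      by rewrite ler_pXn2r ?nnegrE ?N2// mulr_ge0// sqr_ge0.
    (* [v] compares the amplitude y_i / t_i with the level s/2. If v <= 1, then v^4 <= v^(2p) = (r /
       w_i)^2 as p <= 2; if v > 1, the minimum on the right is 1. *)
    have min1 : Num.min 1 ((N i)%:R ^+ 2 / (s / 2 * t i) ^+ 4) <= 4 * Num.min 1 ((r / w i) ^+ 2).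
      have [v1|v1] := leP v 1.
        have le44 : 4 * v ^+ 4 <= 4 * (r / w i) ^+ 2.
          rewrite ler_pM2l// -vp -(powR_mulrn 2 (powR_ge0 _ _)) -powRrM -(powR_mulrn 4 (ltW v0)).
          have p4 : p * 2%:R <= 4%:R :> R by rewrite (_ : 4%:R = 2%:R * 2%:R :> R) ?ler_pM2r// -natrM.
          by apply: ger_powR => //; rewrite v0 v1.
        have r1 : (r / w i) ^+ 2 <= 1.
          rewrite -vp expr_le1 ?powR_ge0//.
          rewrite -[leRHS](congr1 (@^~ p) (@powR1 R)).
          by apply: ge0_ler_powR; rewrite ?nnegrE ?(ltW p0) ?(ltW v0)//.
        by rewrite (min_r r1) ge_min; apply/orP; right; exact: le_trans le44.
      have r1 : 1 <= (r / w i) ^+ 2.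
        rewrite -vp expr_ge1 ?powR_ge0//.
        rewrite -[leLHS](congr1 (@^~ p) (@powR1 R)).
        by apply: ge0_ler_powR; rewrite ?nnegrE ?(ltW p0) ?(ltW v0)// ltW.
      by rewrite (min_l r1) ge_min; apply/orP; left; lra.
    have -> : Num.min (w i) (r ^+ 2 / w i) = w i * Num.min 1 ((r / w i) ^+ 2).
      rewrite minr_pMr ?(ltW (w0 _))// mulr1; congr Num.min.
      by field; rewrite gt_eqF.
    rewrite (_ : 44 * _ = 11 * w i * (4 * Num.min 1 ((r / w i) ^+ 2))); last by ring.
    by rewrite ler_wpM2l// mulr_ge0// ltW.
  rewrite addr0 lee_fin -mulr_sumr.
  apply: (@le_trans _ _ (44 * (4 * r))).
    by rewrite ler_pM2l//; apply: doubling_sum => //; right.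
  rewrite /r powRM ?invr_ge0 ?(ltW lam0) ?(ltW s2)//.
  have -> : (s / 2)^-1 `^ p = s `^ (- p) * 2 `^ p.
    by rewrite -powR_divN// -(powR_inv1 (ltW s2)) -powRrM mulN1r.
  by rewrite /A le_eqVlt; apply/orP; left; apply/eqP; ring.
have KA : 0 <= lam `^ p * A by exact: wb_ge0 wF.
have := (hC _ _ FL KA).1 wF (1 / 2) (divr_gt0 ltr01 (ltr0n R 2)).
have -> : (1 / 2 : R) `^ (- p) = 2 `^ p by rewrite powR_divN// powR1 mul1r.
move=> h; have := le_trans hlow h; rewrite lee_fin.
apply/negP; rewrite -ltNge.
apply: (@lt_le_trans _ _ (K%:R * (eps * lam `^ p) / 2)); last by rewrite ler_pM2r ?invr_gt0.
rewrite (_ : C * (lam `^ p * A) * 2 `^ p = C * A * 2 `^ p * 2 * (lam `^ p / 2)); last by field.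
rewrite (_ : K%:R * (eps * lam `^ p) / 2 = K%:R * eps * (lam `^ p / 2)); last by ring.
by rewrite ltr_pM2r// divr_gt0.
Qed.

End small_exponent.

Lemma ungenerated_contradiction : False.
Proof.
have [c [B [c0 hB dB hB2 Bpos]]] := large_on_disjoint_seq mE Efin ncg na.
have [eps eps0 heps] := embedding_lower p1 emb.
have mB i := (hB i).1; have BE i := (hB i).2; have B0 i := (hB2 i).1.
pose eps' := eps * (c / 4 * Num.sqrt (c / 2) `^ p) / 2 `^ p.
have eps'0 : 0 < eps'.
  rewrite divr_gt0 ?powR_gt0// mulr_gt0// mulr_gt0 ?divr_gt0// powR_gt0//.
  by rewrite sqrtr_gt0 divr_gt0.
have /choice[t ht] i : exists t, 0 < t /\ positive_set FF (large_on mu c (B i) `&`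
    [set z | level nu p J (fine (mu (B i))) eps' t (phi z)]).
  by have [t t0 tpos] := level_pigeonhole c0 (mB i) (BE i) (B0 i) (Bpos i) eps0 heps; exists t.
exact: (@small_exponent_contradiction c B t eps' mB BE dB B0 (fun i => (hB2 i).2) (fun i => (ht i).1) eps'0 p_le2 (fun i => (ht i).2)).
Qed.

End generated.

Lemma countably_generated_bigcup {R : realType} {d} {T : measurableType d}
  (mu : {measure set T -> \bar R}) (F : nat -> set T) :
  (forall n, measurable (F n)) -> (forall n, countably_generated_on mu (F n)) ->
  countably_generated_on mu (\bigcup_n F n).
Proof.
move=> mF /choice[G hG]; set Z := \bigcup_n F n.
have mZ : measurable Z by exact: bigcup_measurable.
have GF n k : measurable (G n k) /\ G n k `<=` F n.
  by case: (hG n) => h _; apply: h; exists k.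
have FZ n : F n `<=` Z by move=> t Ft; exists n.
(* The pieces [F n] are generators themselves, since a complement within [F n] has to be written as
   a complement within the union. *)
pose gen m := if @unpickle (nat * nat)%type m is Some nk then
  (if nk.2 is k.+1 then G nk.1 k else F nk.1) else set0.
exists gen.
have gen_trace m : trace_sigma Z (gen m).
  rewrite /gen; case: unpickle => [[n [|k]]|] /=; split => //.
  - by case: (GF n k).
  - by apply: subset_trans (FZ n); case: (GF n k).
split; first by move=> _ [m _ <-].
set S := (X in <<s Z, X >>).
have genS n k : S (if k is k'.+1 then G n k' else F n).
  by left; exists (pickle (n, k)) => //; rewrite /gen pickleK.
have sC X : <<s Z, S >> X -> <<s Z, S >> (Z `\` X) by exact: sigma_algebraCD.
have sU X Y : <<s Z, S >> X -> <<s Z, S >> Y -> <<s Z, S >> (X `|` Y).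
  move=> sX sY; rewrite -bigcup2E; apply: sigma_algebra_bigcup => -[|[|n]] //=.
  exact: sigma_algebra0.
apply/seteqP; split => [A [mA AZ]|A].
  have -> : A = \bigcup_n (A `&` F n) by rewrite -setI_bigcupr setIidl.
  apply: sigma_algebra_bigcup => n.
  have [_ e] := hG n.
  have : trace_sigma (F n) (A `&` F n) by split; [exact: measurableI|exact: subIsetr].
  rewrite e; apply: smallest_sub.
    split.
    - exact: sigma_algebra0.
    - move=> B sB.
      have -> : F n `\` B = Z `\` ((Z `\` F n) `|` B).
        apply/seteqP; split => t.
          by move=> [Ft nB]; split; [exact: FZ Ft|move=> [[_ nF]|//]].
        move=> [Zt h]; split; last by move=> Bt; apply: h; right.
        by apply: contrapT => nF; apply: h; left.
      apply: (sC); apply: (sU) => //; apply: (sC).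
      by apply: sub_sigma_algebra; exact: genS n 0%N.
    - by move=> B sB; exact: sigma_algebra_bigcup.
  move=> B [[k _ <-]|[mB BF B0]]; apply: sub_sigma_algebra; first exact: genS n k.+1.
  by right; split => //; exact: subset_trans (FZ n).
move: A; apply: smallest_sub.
  split.
  - by split => //; exact: sub0set.
  - by move=> A [mA AE]; split; [exact: measurableD|exact: subDsetl].
  - move=> H hH; split; first by apply: bigcup_measurable => n _; case: (hH n).
    by move=> t [n _ Ft]; case: (hH n) => _; exact.
move=> A [[m _ <-]|[mA AE _]]; last by split.
exact: gen_trace.
Qed.

Theorem theorem1 (R : realType) (d : measure_display) (T : measurableType d)
  (mu : {measure set T -> \bar R}) (p : R) :
  nontrivial_ms mu -> purely_non_atomic mu -> 1 < p ->
  [<->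
   (* (1) *)
   exists (d' : measure_display) (T' : measurableType d')
     (nu : {measure set T' -> \bar R}),
     [/\ nontrivial_ms nu, purely_atomic nu & weakLp_isomorphic mu nu p];
   (* (2) *)
   exists (d' : measure_display) (T' : measurableType d')
     (nu : {measure set T' -> \bar R}),
     [/\ nontrivial_ms nu, purely_atomic nu & weakLp_iso_subspace mu nu p];
   (* (3) *)
   exists O1 O2 : set T,
     [/\ measurable O1 /\ measurable O2, O1 `|` O2 = setT, O1 `&` O2 = set0,
         countably_generated_on mu O1 /\ sigma_finite O1 mu &
         forall s, measurable s -> s `<=` O2 -> mu s = 0%E \/ mu s = +oo%E];
   (* (4) *)
   weakLp_isomorphic mu (@counting nat R) p].
Proof.
move=> nt na p1; tfae.
- move=> [d' [T' [nu [ntn pa [J [emb _]]]]]].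
  by exists d', T', nu; split => //; exists J.
- move=> [d' [T' [nu [_ pa [J emb]]]]].
  have [Z [[mZ sZ] hZ]] := sigma_finite_support p1 emb pa na.
  exists Z, (~` Z); split => //; [by split => //; exact: measurableC|by rewrite setUv|by rewrite setICr|].
  split => //; case: sZ => F eZ hF; rewrite eZ.
  apply: countably_generated_bigcup => n; first by case: (hF n).
  have [mF Ff] := hF n; apply: contrapT => ncg.
  by have := ungenerated_contradiction p1 emb pa na mF Ff ncg.
- move=> [Y [Y' [[mY _] YT _ [cg sf] hY]]].
  apply: (essentially_separable_isomorphic (O := Y) na nt p1); split => // s ms sY.
  apply: hY => // t st; have : [set: T] t by [].
  by rewrite -YT => -[/(sY _ st)|].
- move=> iso; exists _, _, (@counting nat R); split => //.
  + exact: counting_nontrivial.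
  + exact: counting_purely_atomic.
Qed.
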